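(* Let $n\ge 2$, $R>0$, and let $S(R)\subset\mathbb{R}^{n+1}$ be de Sitter space-time with its Lorentzian metric $g$ and time orientation. Let $L\subset S(R)$ be (the image of) a complete time-like geodesic of $S(R)$, let $-L=\{-x : x\in L\}$, and let $\Gamma^{-}(L)$ and $\Gamma^{+}(L)$ be the past and the future event horizons of $L$. Then: 1. There is a hyperplane $\alpha$ in $\mathbb{R}^{n+1}$ through the origin such that $\Gamma^{-}(L)=S(R)\cap\alpha$, and $\Gamma^{-}(L)$ consists of isotropic geodesics (i.e. it is a union of isotropic geodesics of $S(R)$). 2. $J^{+}(L)=-J^{-}(-L)$ and $J^{-}(L)=-J^{+}(-L)$. 3. The sets $J^{-}(L)$ and $J^{+}(-L)$ are disjoint and have the common boundary $\Gamma^{-}(L)$; respectively, the sets $J^{+}(L)$ and $J^{-}(-L)$ are disjoint and have the common boundary $\Gamma^{+}(L)$. In particular, $\Gamma^{-}(L)=\Gamma^{+}(-L)$ and $\Gamma^{+}(L)=\Gamma^{-}(-L)$. 4. The sets $J^{+}(L)$, $J^{-}(-L)$, $J^{-}(L)$, $J^{+}(-L)$ are open submanifolds of $S(R)$. The quotient map $pr:S(R)\to S^1_n(R)$ gluing antipodal events of $S(R)$ restricts to a diffeomorphism (onto its image) on each of these four open submanifolds, and it identifies antipodal events of the boundaries of these submanifolds (i.e. of the corresponding event horizons). 5. The quotient manifold $(S^1_n(R),G)$, where $G$ is the metric determined by $g=pr^{\ast}G$, is the Lobachevsky space of positive curvature $\frac{1}{R^2}$ in the sense of B. A. Rosenfe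ld.
   Context: Minkowski space-time is $\mathbb{R}^{n+1}$ with coordinates $(x_1,\dots,x_n,t)$ and the Lorentzian metric $dx_1^2+\dots+dx_n^2-dt^2$ (signature $(+,\dots,+,-)$). De Sitter space-time (of the first kind) is the one-sheeted hyperboloid $$S(R)=\Big\{(x_1,\dots,x_n,t)\in\mathbb{R}^{n+1} : \sum_{k=1}^n x_k^2-t^2=R^2\Big\},\qquad R>0,\ n+1\ge 3,$$ with the Lorentzian metric $g$ induced from Minkowski space-time. Points of $S(R)$ are called events. For $A\subset S(R)$, $-A=\{-x : x\in A\}\subset S(R)$; events $x$ and $-x$ are called antipodal. A nonzero tangent vector $v$ is time-like, isotropic (null), or space-like if $g(v,v)$ is negative, zero, or positive, respectively; it is non-space-like if it is time-like or isotropic. A geodesic is time-like (isotropic) if its tangent vectors are. The time orientation of $S(R)$ is given by the unit time-like tangent vector field $Y$ that is orthogonal to all sections $S(R)\cap\{t=c\}$, $c\in\mathbb{R}$, and points in the direction of increasing $t$. A non-space-like tangent vector $v$ at $p$ is future directed if $g(Y(p),v)<0$ and past directed if $g(Y(p),v)>0$. A continuous piecewise smooth curve is future (past) directed if all its one-sided tangent vectors are non-space-like and future (past) directed. For $A\subset S(R)$, the causal future $J^{+}(A)$ (respectively, the causal past $J^{-}(A)$) is the set of all events $q\in S(R)$ for which there is a future directed (respectively, past directed) curve $c:[a,b]\to S(R)$ with $c(a)\in A$ and $c(b)=q$. The past event horizon $\Gamma^{-}(A)$ (respectively, the future event horizon $\Gamma^{+}(A)$) is the topological boundary in $S(R)$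 of $J^{-}(A)$ (respectively, of $J^{+}(A)$). $S^1_n(R)$ denotes the quotient manifold $S(R)/\{x\sim -x\}$ and $pr:S(R)\to S^1_n(R)$ the quotient map. The Lobachevsky space of positive curvature $\frac{1}{R^2}$ in the sense of Rosenfeld is the space obtained from the hyperboloid $S(R)$, with the Lorentzian metric induced from Minkowski space-time, by gluing antipodal events, with the metric for which the gluing map is a local isometry. *)

(* Defs.v *)
(* Throughout, [K] is the field of real numbers and [R : K] is the radius of the
   hyperboloid. *)
From HB Require Import structures.
From mathcomp Require Import all_boot all_order all_algebra.
From mathcomp Require Import all_classical all_reals all_analysis.
From mathcomp Require Import ring lra.

Set Implicit Arguments.
Unset Strict Implicit.
Unset Printing Implicit Defensive.

Import Order.TTheory GRing.Theory Num.Theory.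
Import numFieldNormedType.Exports.

Local Open Scope classical_set_scope.
Local Open Scope ring_scope.

Section Smooth.
Context {K : realType} {V W : normedModType K}.
Implicit Types (U X : set V) (f : V -> W).

(* All directional derivatives of order at most [k] exist and are continuous
   on [U]; for an open subset [U] of a finite-dimensional [V] this is the usual
   class C^k. *)
Fixpoint Ck (k : nat) U f : Prop :=
  (forall x, U x -> {for x, continuous f}) /\
  (if k is k'.+1 then
     forall v, (forall x, U x -> derivable f x v) /\ Ck k' U (fun x => 'D_v f x)
   else True).

Definition Cinf U f := forall k, Ck k U f.

(* Smoothness on a subset which need not be open, such as a compact interval:
   local extendability to smooth maps. *)
Definition smooth_on X f := forall x, X x ->
  exists (U : set V) (F : V -> W),
    [/\ open U, U x, Cinf U F & forall y, U y -> X y -> F y = f y].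

End Smooth.

(* A chart is a homeomorphism [chart_fun] of [chart_dom] onto [chart_im] with
   inverse [chart_inv]; both maps take junk values elsewhere. *)
Record chart (K : realType) (T : Type) (m : nat) := Chart {
  chart_dom : set T;
  chart_fun :> T -> 'rV[K]_m;
  chart_inv : 'rV[K]_m -> T }.

Definition chart_im (K : realType) (T : Type) (m : nat) (c : chart K T m) :=
  c @` chart_dom c.

Definition topological_chart (K : realType) (T : topologicalType) (m : nat)
    (c : chart K T m) :=
  [/\ open (chart_dom c), open (chart_im c),
      forall x, chart_dom c x -> chart_inv c (c x) = x,
      forall x, chart_dom c x -> {for x, continuous c} &
      forall y, chart_im c y -> {for y, continuous (chart_inv c)}].

Record charted_space (K : realType) (m : nat) := ChartedSpace {
  carrier :> topologicalType;
  atlas : set (chart K carrier m) }.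

Section Manifold.
Context {K : realType} {m : nat}.

Definition smooth_map {m' : nat} (M : charted_space K m)
    (N : charted_space K m') (U : set M) (f : M -> N) :=
  (forall x, U x -> {for x, continuous f}) /\
  forall c d, atlas c -> atlas d ->
    Cinf (c @` (U `&` chart_dom c `&` f @^-1` chart_dom d))
         (d \o f \o chart_inv c).

Definition smooth_manifold (M : charted_space K m) :=
  [/\ hausdorff_space M, @second_countable M,
      forall c : chart K M m, atlas c -> topological_chart c,
      forall x : M, exists2 c : chart K M m, atlas c & chart_dom c x &
      forall c d : chart K M m, atlas c -> atlas d ->
        Cinf (c @` (chart_dom c `&` chart_dom d)) (d \o chart_inv c)].

Definition open_submanifold (M : charted_space K m) (U : set M) :=
  smooth_manifold M /\ open U.

Definition diffeo_onto_image (M N : charted_space K m) (U : set M)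
    (f : M -> N) :=
  [/\ open U, open (f @` U), smooth_map U f &
      exists g : N -> M,
        (forall x, U x -> g (f x) = x) /\ smooth_map (f @` U) g].

(* diag(1, ..., 1, -1) *)
Definition mink_mx (N : nat) : 'M[K]_N :=
  diag_mx (\row_(i < N) (-1) ^+ (i.+1 == N)).

(* [G c x] is the Gram matrix, in the coordinate basis of the chart [c] at [x],
   of a bilinear form on the tangent space at [x]; only charts of the atlas
   whose domain contains [x] matter. *)
Definition tensor_field (M : charted_space K m) := chart K M m -> M -> 'M[K]_m.

(* f^* G = g on U. Vectors are rows and the differential acts on them by right
   multiplication by the jacobian. *)
Definition pulls_back (M N : charted_space K m) (U : set M) (f : M -> N)
    (G : tensor_field N) (g : tensor_field M) :=
  forall c d x, atlas c -> atlas d -> U x -> chart_dom c x ->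
    chart_dom d (f x) ->
    let J := jacobian (d \o f \o chart_inv c) (c x) in
    g c x = J *m G d (f x) *m J^T.

(* The first clause is the transformation law of tensors under a change of
   charts, the last one says that each form has signature (+, ..., +, -). *)
Definition lorentz_metric (M : charted_space K m) (G : tensor_field M) :=
  [/\ pulls_back [set: M] id G G,
      forall c, atlas c -> Cinf (chart_im c) (fun y => G c (chart_inv c y)) &
      forall c x, atlas c -> chart_dom c x ->
        exists2 P, P \in unitmx & P *m G c x *m P^T = mink_mx m].

Definition local_isometry (M N : charted_space K m) (f : M -> N)
    (g : tensor_field M) (G : tensor_field N) :=
  forall x : M, exists U : set M,
    [/\ U x, diffeo_onto_image U f & pulls_back U f G g].

Definition christoffel (M : charted_space K m) (G : tensor_field M)
    (c : chart K M m) (k i j : 'I_m) (y : 'rV[K]_m) : K :=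
  let gm i j := fun z => G c (chart_inv c z) i j in
  let partial i (h : 'rV[K]_m -> K) := 'D_(delta_mx 0 i) h y in
  2^-1 * \sum_l invmx (G c (chart_inv c y)) k l *
    (partial i (gm j l) + partial j (gm i l) - partial l (gm i j)).

(* Geodesics are affinely parametrized and defined on the whole real line,
   that is, complete. *)
Definition complete_geodesic (M : charted_space K m) (G : tensor_field M)
    (gamma : K -> M) :=
  [/\ continuous gamma,
      forall c, atlas c -> Cinf (gamma @^-1` chart_dom c) (c \o gamma) &
      forall c t k, atlas c -> chart_dom c (gamma t) ->
        let x i := fun s => c (gamma s) 0 i in
        derive1n 2 (x k) t +
          \sum_i \sum_j christoffel G c k i j (c (gamma t)) *
                        derive1 (x i) t * derive1 (x j) t = 0].

End Manifold.

(* The time coordinate of Minkowski space-time 'rV_n.+1 is the last one. *)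
Definition mink (K : realType) (N : nat) (u v : 'rV[K]_N) : K :=
  (u *m mink_mx N *m v^T) 0 0.

Definition dS_set (K : realType) (n : nat) (R : K) : set 'rV[K]_n.+1 :=
  [set x | mink x x = R ^+ 2].

Definition dS (K : realType) (n : nat) (R : K) : topologicalType :=
  set_type (@dS_set K n R).

Lemma antipode_subproof (K : realType) (n : nat) (R : K) (x : dS n R) :
  - set_val x \in @dS_set K n R.
Proof.
apply/mem_set; apply: etrans (set_mem (valP x)).
by rewrite set_valE /mink mulNmx mulNmx linearN /= mulmxN opprK.
Qed.

Section DeSitter.
Context {K : realType} {n : nat} {R : K}.
Local Notation S := (dS n R).

Definition ev (p : S) : 'rV[K]_n.+1 := set_val p.

Definition antipode (x : S) : S := exist _ (- set_val x) (antipode_subproof x).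

(* Charts of the embedded submanifold: homeomorphisms, from an open set of
   events onto an open subset of K^n, that are smooth in both directions as
   maps between subsets of vector spaces. *)
Definition dS_chart (c : chart K S n) :=
  [/\ topological_chart c,
      Cinf (chart_im c) (ev \o chart_inv c) &
      forall x, chart_dom c x ->
        exists (U : set 'rV[K]_n.+1) (F : 'rV[K]_n.+1 -> 'rV[K]_n),
          [/\ open U, U (ev x), Cinf U F &
              forall y, chart_dom c y -> U (ev y) -> F (ev y) = c y]].

Definition dS_manifold : charted_space K n := ChartedSpace [set c | dS_chart c].

Definition dS_metric : tensor_field dS_manifold := fun c x =>
  let J := jacobian (ev \o chart_inv c) (c x) in J *m mink_mx n.+1 *m J^T.

(* Tangent vectors at [p] are identified with vectors of Minkowski space-time:
   the tangent space is the kernel of the differential 2 mink p of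
   x |-> mink x x, and g is the restriction of mink. *)
Definition tangent (p : S) (v : 'rV[K]_n.+1) := mink (ev p) v = 0.

Definition timelike (p : S) v := [/\ tangent p v, v != 0 & mink v v < 0].
Definition isotropic (p : S) v := [/\ tangent p v, v != 0 & mink v v = 0].
Definition nonspacelike (p : S) v := timelike p v \/ isotropic p v.

Definition velocity (gamma : K -> S) (t : K) : 'rV[K]_n.+1 :=
  derive1 (ev \o gamma) t.

Definition timelike_geodesic (gamma : K -> S) :=
  complete_geodesic (M := dS_manifold) dS_metric gamma /\
  forall t, timelike (gamma t) (velocity gamma t).

Definition isotropic_geodesic (gamma : K -> S) :=
  complete_geodesic (M := dS_manifold) dS_metric gamma /\
  forall t, isotropic (gamma t) (velocity gamma t).

Definition time_orientation (Y : S -> 'rV[K]_n.+1) := forall p,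
  [/\ tangent p (Y p), mink (Y p) (Y p) = -1,
      forall v, tangent p v -> v 0 ord_max = 0 -> mink (Y p) v = 0 &
      0 < Y p 0 ord_max].

(* The normalized tangential part of the unit vector of the time axis; see
   [time_orientationP]. *)
Definition time_field (p : S) : 'rV[K]_n.+1 :=
  let t := ev p 0 ord_max in
  (Num.sqrt (1 + t ^+ 2 / R ^+ 2))^-1 *:
    (delta_mx 0 ord_max + (t / R ^+ 2) *: ev p).

Lemma minkE N (u v : 'rV[K]_N) :
  mink u v = \sum_(i < N) (-1) ^+ (i.+1 == N) * u 0 i * v 0 i.
Proof.
rewrite /mink mxE; apply: eq_bigr => i _.
by rewrite mul_mx_diag !mxE (mulrC (u _ _)).
Qed.

Lemma mink_split (u v : 'rV[K]_n.+1) :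
  mink u v = \sum_(i < n) u 0 (widen_ord (leqnSn n) i) *
                          v 0 (widen_ord (leqnSn n) i)
             - u 0 ord_max * v 0 ord_max.
Proof.
rewrite minkE big_ord_recr /= eqxx mulN1r mulNr; congr (_ - _).
by apply: eq_bigr => i _; rewrite eqSS ltn_eqF //= mul1r.
Qed.

Lemma minkC N (u v : 'rV[K]_N) : mink u v = mink v u.
Proof. by rewrite !minkE; apply: eq_bigr => i _; rewrite mulrAC. Qed.

Lemma minkDl N (u v w : 'rV[K]_N) : mink (u + v) w = mink u w + mink v w.
Proof. by rewrite /mink !mulmxDl mxE. Qed.

Lemma minkZl N a (u v : 'rV[K]_N) : mink (a *: u) v = a * mink u v.
Proof. by rewrite /mink -!scalemxAl mxE. Qed.

Lemma minkDr N (u v w : 'rV[K]_N) : mink w (u + v) = mink w u + mink w v.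
Proof. by rewrite minkC minkDl !(minkC _ w). Qed.

Lemma minkZr N a (u v : 'rV[K]_N) : mink u (a *: v) = a * mink u v.
Proof. by rewrite minkC minkZl minkC. Qed.

Lemma mink_time (v : 'rV[K]_n.+1) : mink (delta_mx 0 ord_max) v = - v 0 ord_max.
Proof.
rewrite mink_split big1 ?add0r => [|i _]; rewrite !mxE /=.
  by rewrite !eqxx mul1r.
by rewrite -val_eqE /= ltn_eqF // mul0r.
Qed.

Lemma mink_space_eq0 (w : 'rV[K]_n.+1) :
  w 0 ord_max = 0 -> mink w w = 0 -> w = 0.
Proof.
move=> w0; rewrite mink_split w0 mul0r subr0 => /eqP.
rewrite psumr_eq0 => [|i _]; last by rewrite -expr2 sqr_ge0.
move=> /allP h; apply/rowP => i; rewrite mxE.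
have [ilt|ige] := ltnP i n; last first.
  suff -> : i = ord_max by [].
  apply/val_inj/eqP => /=.
  by rewrite eqn_leq ige -ltnS ltn_ord.
have := h (Ordinal ilt) (mem_index_enum _).
rewrite -expr2 sqrf_eq0 => /eqP <-; congr (w 0 _); exact/val_inj.
Qed.

Lemma mink_ev (p : S) : mink (ev p) (ev p) = R ^+ 2.
Proof. by case: p => x hx; have := set_mem hx; rewrite /ev set_valE. Qed.

Lemma time_orientationP (Y : S -> 'rV[K]_n.+1) : 0 < R ->
  time_orientation Y <-> Y = time_field.
Proof.
move=> R0; have Rn0 : R != 0 by rewrite gt_eqF.
have main : time_orientation time_field.
  move=> p; rewrite /time_field; set t := ev p 0 ord_max.
  set e := delta_mx 0 ord_max; set w := e + _.
  set s := Num.sqrt _.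
  have pos : 0 < 1 + t ^+ 2 / R ^+ 2.
    by rewrite ltr_wpDr // divr_ge0 // sqr_ge0.
  have s0 : 0 < s by rewrite sqrtr_gt0.
  have s2 : s ^+ 2 = 1 + t ^+ 2 / R ^+ 2 by rewrite sqr_sqrtr // ltW.
  have ep : mink e (ev p) = - t by rewrite mink_time.
  have ee : mink e e = -1 by rewrite mink_time mxE !eqxx.
  have ww : mink w w = - s ^+ 2.
    rewrite /w !(minkDl, minkDr, minkZl, minkZr) mink_ev (minkC (ev p)) ep ee s2.
    by field.
  split.
  - rewrite /tangent minkZr /w minkDr minkZr mink_ev (minkC _ e) ep.
    by rewrite mulfVK ?expf_neq0 // addNr mulr0.
  - rewrite minkZl minkZr ww; field; exact: lt0r_neq0.
  - move=> v; rewrite /tangent => pv v0.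
    by rewrite minkZl /w minkDl minkZl pv mink_time v0 oppr0 mulr0 addr0 mulr0.
  - rewrite mxE mulr_gt0 ?invr_gt0 // !mxE !eqxx /= -/t.
    by rewrite mulrAC -expr2.
split=> [hY|-> //]; apply/funext => p.
have [Yt YY Yo Y0] := hY p; have [Zt ZZ Zo Z0] := main p.
move: (Y p) (time_field p) Yt YY Yo Y0 Zt ZZ Zo Z0 => y z Yt YY Yo Y0 Zt ZZ Zo Z0.
pose a := y 0 ord_max / z 0 ord_max.
have a0 : 0 < a by rewrite divr_gt0.
pose w := y + (- a) *: z.
have w0 : w 0 ord_max = 0.
  have z0 : z 0 ord_max != 0 by rewrite gt_eqF.
  by rewrite /w !mxE /a mulNr (mulfVK z0) subrr.
have wt : tangent p w by rewrite /tangent /w minkDr minkZr Yt Zt mulr0 addr0.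
have /eqP : w = 0.
  apply: mink_space_eq0 => //.
  by rewrite {1}/w minkDl minkZl Yo // Zo // mulr0 addr0.
rewrite /w scaleNr subr_eq0 => /eqP ya.
move: YY; rewrite ya minkZl minkZr ZZ => h.
have /eqP : a ^+ 2 = 1 by rewrite expr2; lra.
rewrite sqrf_eq1 => /orP[/eqP ->|/eqP a1]; first by rewrite scale1r.
by move: a0; rewrite a1 oppr_gt0 ltr10.
Qed.

Definition future_vector (p : S) v :=
  nonspacelike p v /\ mink (time_field p) v < 0.
Definition past_vector (p : S) v :=
  nonspacelike p v /\ 0 < mink (time_field p) v.

Definition piecewise_smooth (a b : K) (c : K -> S) :=
  {within `[a, b], continuous (ev \o c)} /\
  exists s : seq K, itv_partition a b s /\
    forall i, (i < size s)%N ->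
      smooth_on `[nth b (a :: s) i, nth b (a :: s) i.+1] (ev \o c).

Definition one_sided_tangent (a b : K) (c : K -> S) (t : K)
    (v : 'rV[K]_n.+1) :=
  let quotient h : 'rV[K]_n.+1 := h^-1 *: (ev (c (t + h)) - ev (c t)) in
  (a <= t < b /\ quotient h @[h --> 0^'+] --> v) \/
  (a < t <= b /\ quotient h @[h --> 0^'-] --> v).

(* Only the restriction of [c] to the interval [a, b] matters. *)
Definition directed_curve (D : S -> 'rV[K]_n.+1 -> Prop) (a b : K)
    (c : K -> S) :=
  [/\ a < b, piecewise_smooth a b c &
      forall t v, one_sided_tangent a b c t v -> D (c t) v].

Definition causal_future (A : set S) : set S :=
  [set q | exists a b c,
    [/\ directed_curve future_vector a b c, A (c a) & c b = q]].

Definition causal_past (A : set S) : set S :=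
  [set q | exists a b c,
    [/\ directed_curve past_vector a b c, A (c a) & c b = q]].

Definition boundary (A : set S) : set S := closure A `\` interior A.

Definition future_horizon (A : set S) := boundary (causal_future A).
Definition past_horizon (A : set S) := boundary (causal_past A).

Definition glued : rel S := fun x y => (y == x) || (y == antipode x).

Lemma antipodeK : involutive antipode.
Proof.
by move=> x; apply/val_inj; rewrite /= !set_valE /= opprK.
Qed.

Lemma glued_refl : reflexive glued.
Proof. by move=> x; rewrite /glued eqxx. Qed.

Lemma glued_sym : symmetric glued.
Proof.
move=> x y; rewrite /glued eq_sym; congr (_ || _).
by apply/eqP/eqP => ->; rewrite antipodeK.
Qed.

Lemma glued_trans : transitive glued.
Proof.
move=> y x z /orP[/eqP->//|/eqP->] /orP[/eqP->|/eqP->]; rewrite /glued.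
  by rewrite eqxx orbT.
by rewrite antipodeK eqxx.
Qed.

Canonical glued_equiv := EquivRel glued glued_refl glued_sym glued_trans.

Definition dS_quot : topologicalType :=
  quotient_topology {eq_quot glued_equiv}%qT.

Definition pr (x : S) : dS_quot := (\pi_dS_quot x)%qT.

(* The quotient atlas: charts of S whose domain contains no two antipodal
   events, pushed forward by [pr]. *)
Definition dS_quot_chart (c : chart K dS_quot n) :=
  exists b : chart K S n,
    [/\ dS_chart b,
        forall x y, chart_dom b x -> chart_dom b y -> pr x = pr y -> x = y,
        chart_dom c = pr @` chart_dom b,
        forall x, chart_dom b x -> c (pr x) = b x &
        forall y, chart_im b y -> chart_inv c y = pr (chart_inv b y)].

Definition dS_quot_manifold : charted_space K n :=
  ChartedSpace [set c | dS_quot_chart c].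

Definition gluing : dS_manifold -> dS_quot_manifold := pr.

(* Whether a Lorentzian manifold is the space obtained from the hyperboloid by
   gluing antipodal events, with the metric for which the gluing map is a local
   isometry. A surjective local diffeomorphism is a topological quotient map, so
   the topology and the smooth structure are determined too. *)
Definition rosenfeld_lobachevsky (M : charted_space K n) (G : tensor_field M) :=
  [/\ smooth_manifold M, lorentz_metric G &
      exists q : dS_manifold -> M,
        [/\ forall z, exists x, q x = z,
            forall x y : S, q x = q y <-> y = x \/ y = antipode x &
            local_isometry q dS_metric G]].

End DeSitter.

Arguments dS_manifold {K} n R.
Arguments dS_quot_manifold {K} n R.
Arguments dS_metric {K n R}.
Arguments gluing {K n R}.
Arguments rosenfeld_lobachevsky {K n} R M G.

(* Main.v *)
Require Import Defs.
From HB Require Import structures.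
From mathcomp Require Import all_boot all_order all_algebra.
From mathcomp Require Import all_classical all_reals all_analysis.
From mathcomp Require Import ring lra.

Import Order.TTheory GRing.Theory Num.Theory.
Import numFieldNormedType.Exports.

Local Open Scope classical_set_scope.
Local Open Scope ring_scope.

Set Implicit Arguments.
Unset Strict Implicit.

(** In a chart, the Christoffel equation of the induced metric says that the
    acceleration in Minkowski space-time is normal to the hyperboloid, so a curve
    [u] is a geodesic iff [u'' = (<u'', u> / R^2) u]. For a time-like [u] the
    factor is a positive constant, so the line is [{E a + E^-1 b | 0 < E}] with
    [a] and [b] null, [2 <a, b> = R^2] and, up to exchange, [b_t < 0 < a_t].
    Along a past directed curve [<., a>] does not decrease; conversely, if
    [<q, a>] is positive then [<q, l> > R^2] for the points [l] of the line with
    [E] large, and the hyperbola through [l] and [q] is past directed. Hence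
    J^-(L) is the half-space [<., a> > 0], and likewise J^+(L) is [<., b> > 0];
    passing to -L replaces [(a, b)] by [(- a, - b)]. The horizons are the
    sections by the hyperplanes orthogonal to [a] and [b]; the first one is the
    union of the null lines of direction [a].

    The antipodal map is an isometry of the hyperboloid, so in charts without
    antipodal points the metric descends to the quotient. *)

(** * Calculus of maps of class C^k *)

Section Calculus.
Context {K : realType}.
Implicit Types V W : normedModType K.

(** [Ck] speaks of directional derivatives only, whereas changes of charts and the Christoffel
    equation need total differentials, the chain rule and the symmetry of second derivatives. That
    symmetry is what collapses the Christoffel symbols of an induced metric to products
    [<d2 i j, d1 l>] of second and first derivatives of the embedding.

    The charts used are stereographic projections from [- p] restricted to [<., p> > 0]. This domain
    contains no antipodal pair, so the same charts serve the hyperboloid and the quotient.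
    Transition maps of both, [pr], and its local inverses all read [b \o flip s \o chart_inv c] in
    charts, so that one smoothness lemma and one metric lemma, with a sign [s], cover them all.

    Monotonicity of [<., a>] rests on the sign of the product of two non-space-like vectors in
    opposite time cones. It gives a strict inequality on the causal set because [<., a>] equals
    [E^-1 <a, b>] on the line itself, which is positive. Past and future are one statement with the
    sign [(-1) ^+ s]; the future of [L] is obtained by exchanging [a] and [b]. *)

Lemma Ck_cont V W k (U : set V) (f : V -> W) x :
  Ck k U f -> U x -> {for x, continuous f}.
Proof. by case: k => [|k] [h _]; apply: h. Qed.

Lemma Ck_derivable V W k (U : set V) (f : V -> W) x {v} :
  Ck k.+1 U f -> U x -> derivable f x v.
Proof. by case=> _ h; apply: (h v).1. Qed.

Lemma Ck_derive V W k (U : set V) (f : V -> W) {v} :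
  Ck k.+1 U f -> Ck k U (fun x => 'D_v f x).
Proof. by case=> _ /(_ v)[]. Qed.

Lemma Ck_pred V W k (U : set V) (f : V -> W) : Ck k.+1 U f -> Ck k U f.
Proof.
elim: k f => [|k IH] f fU; first by split=> // x Ux; exact: Ck_cont fU Ux.
split=> [x Ux|v]; first exact: Ck_cont fU Ux.
split=> [x Ux|]; first exact: Ck_derivable fU Ux.
exact/IH/Ck_derive.
Qed.

(** Each clause of [Ck] is a condition on the germ of the map at a point, so nothing is asked of
    [U'] beyond containing [x]. Maps given by a formula only locally, such as changes of charts, are
    smooth by this lemma. *)
Lemma Ck_local V W k (U : set V) (f : V -> W) :
  (forall x, U x -> exists U' g,
    [/\ U' x, Ck k U' g & \forall y \near x, g y = f y]) -> Ck k U f.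
Proof.
move=> h; have fc x : U x -> {for x, continuous f}.
  move=> Ux; have [U' [g [U'x gU' gf]]] := h x Ux.
  have : g @ x --> g x := Ck_cont gU' U'x; rewrite (nbhs_singleton gf).
  by apply: cvg_trans; exact: near_eq_cvg.
elim: k f h fc => [|k IH] f h fc; split=> // v; split=> [x Ux|].
  have [U' [g [U'x gU' gf]]] := h x Ux.
  exact: near_eq_derivable gf (Ck_derivable gU' U'x).
suff h' : forall x, U x -> exists U' g,
    [/\ U' x, Ck k U' g & \forall y \near x, g y = 'D_v f y].
  apply: (IH _ h') => x Ux; have [U' [g [U'x gU' gf]]] := h' x Ux.
  have : g @ x --> g x := Ck_cont gU' U'x; rewrite (nbhs_singleton gf).
  by apply: cvg_trans; exact: near_eq_cvg.
move=> x Ux; have [U' [g [U'x gU' gf]]] := h x Ux.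
exists U', (fun x => 'D_v g x); split=> //; first exact: Ck_derive.
(* Equality near [x] is equality near every point close to [x], so the derivatives agree near [x] as
   well. *)
by have := near_join gf; apply: filterS => y; exact: near_eq_derive.
Qed.

Lemma Ck_eq V W k (U : set V) (f g : V -> W) :
  open U -> (forall x, U x -> f x = g x) -> Ck k U f -> Ck k U g.
Proof.
move=> oU fg fU; apply: Ck_local => x Ux; exists U, f; split=> //.
by apply: filterS fg _; exact: open_nbhs_nbhs.
Qed.

Lemma Ck_sub V W k (U U' : set V) (f : V -> W) :
  U' `<=` U -> Ck k U f -> Ck k U' f.
Proof.
move=> UU' fU; apply: Ck_local => x /UU' Ux; exists U, f; split=> //.
exact: nearW.
Qed.

Lemma Ck_cst V W k (U : set V) (w : W) : Ck k U (fun=> w).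
Proof.
elim: k w => [|k IH] w; split=> // x *; try exact: cst_continuous.
split=> *; first exact: derivable_cst.
have -> : (fun y => 'D_x (fun=> w) y) = fun=> 0; last exact: IH.
by apply/funext => y; exact: derive_cst.
Qed.

Lemma CkD V W k (U : set V) (f g : V -> W) : open U ->
  Ck k U f -> Ck k U g -> Ck k U (fun x => f x + g x).
Proof.
move=> oU; elim: k f g => [|k IH] f g fU gU.
  split=> // x Ux; exact: continuousD (Ck_cont fU Ux) (Ck_cont gU Ux).
split=> [x Ux|v].
  exact: continuousD (Ck_cont fU Ux) (Ck_cont gU Ux).
split=> [x Ux|].
  exact: derivableD (Ck_derivable fU Ux) (Ck_derivable gU Ux).
apply: Ck_eq (IH _ _ (Ck_derive (v := v) fU) (Ck_derive (v := v) gU)) => // x Ux.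
by rewrite deriveD //; [exact: Ck_derivable fU Ux|exact: Ck_derivable gU Ux].
Qed.

Lemma Ck_sum V W k (U : set V) (I : Type) (r : seq I) (f : I -> V -> W) :
  open U -> (forall i, Ck k U (f i)) -> Ck k U (fun x => \sum_(i <- r) f i x).
Proof.
move=> oU fU; elim: r => [|i r IH].
  by apply: Ck_eq (Ck_cst _ _ (0 : W)) => // x _; rewrite big_nil.
by apply: Ck_eq (CkD oU (fU i) IH) => // x _; rewrite big_cons.
Qed.

Lemma CkM V k (U : set V) (f g : V -> K) : open U ->
  Ck k U f -> Ck k U g -> Ck k U (fun x => f x * g x).
Proof.
move=> oU; elim: k f g => [|k IH] f g fU gU.
  split=> // x Ux; exact: continuousM (Ck_cont fU Ux) (Ck_cont gU Ux).
split=> [x Ux|v].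
  exact: continuousM (Ck_cont fU Ux) (Ck_cont gU Ux).
split=> [x Ux|].
  exact: derivableM (Ck_derivable fU Ux) (Ck_derivable gU Ux).
have fD := Ck_derive (v := v) fU; have gD := Ck_derive (v := v) gU.
apply: Ck_eq (CkD oU (IH _ _ (Ck_pred fU) gD) (IH _ _ (Ck_pred gU) fD)) => //.
move=> x Ux; rewrite [RHS]deriveM //.
- exact: Ck_derivable fU Ux.
- exact: Ck_derivable gU Ux.
Qed.

Lemma CkZ V k (U : set V) c (f : V -> K) : open U ->
  Ck k U f -> Ck k U (fun x => c * f x).
Proof. by move=> oU; apply: CkM => //; exact: Ck_cst. Qed.

Lemma CkN V k (U : set V) (f : V -> K) : open U ->
  Ck k U f -> Ck k U (fun x => - f x).
Proof.
move=> oU /(CkZ (-1) oU); apply: Ck_eq => // x _; exact: mulN1r.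
Qed.

Lemma CkB V k (U : set V) (f g : V -> K) : open U ->
  Ck k U f -> Ck k U g -> Ck k U (fun x => f x - g x).
Proof. by move=> oU fU gU; apply: CkD => //; exact: CkN. Qed.

Lemma CkV V k (U : set V) (f : V -> K) : open U ->
  (forall x, U x -> f x != 0) -> Ck k U f -> Ck k U (fun x => (f x)^-1).
Proof.
move=> oU f0; elim: k => [|k IH] fU.
  split=> // x Ux; exact: continuousV (f0 x Ux) (Ck_cont fU Ux).
split=> [x Ux|v]; first exact: continuousV (f0 x Ux) (Ck_cont fU Ux).
split=> [x Ux|]; first exact: derivableV (f0 x Ux) (Ck_derivable fU Ux).
have fV := IH (Ck_pred fU); have fD := Ck_derive (v := v) fU.
apply: Ck_eq (CkN oU (CkM oU (CkM oU fV fV) fD)) => // x Ux.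
rewrite [RHS]deriveV ?f0 //; last exact: Ck_derivable fU Ux.
by rewrite /GRing.scale /= mulNr -expr2 exprVn.
Qed.

Lemma derive_coord p q (v x : 'M[K]_(p, q)) i j :
  is_derive x v (fun y : 'M[K]_(p, q) => y i j) (v i j).
Proof.
have dx : derivable (@id 'M[K]_(p, q)) x v by exact: derivable_id.
apply: DeriveDef; first exact: (derivable_mxP _ _ _).1 dx i j.
by have := derive_mx dx; rewrite derive_id => /matrixP/(_ i j); rewrite mxE.
Qed.

Lemma Ck_coord k p q (U : set 'M[K]_(p, q)) i j :
  Ck k U (fun y : 'M[K]_(p, q) => y i j).
Proof.
have fc x : U x -> {for x, continuous (fun y : 'M[K]_(p, q) => y i j)}.
  by move=> _; exact: coord_continuous.
case: k => [|k]; split=> // v.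
split=> [x Ux|]; first exact: (@ex_derive _ _ _ _ _ _ _ (derive_coord _ _ _ _)).
rewrite [X in Ck k U X](_ : _ = fun=> v i j); first exact: Ck_cst.
by apply/funext => x; exact: (@derive_val _ _ _ _ _ _ _ (derive_coord _ _ _ _)).
Qed.

Lemma continuous_mxP (T : topologicalType) p q (f : T -> 'M[K]_(p, q)) x :
  {for x, continuous f} <-> forall i j, {for x, continuous (fun y => f y i j)}.
Proof.
split=> [fx i j|fx].
  exact: (continuous_comp fx (@coord_continuous _ _ _ _ _ _)).
apply/cvgrPdist_le => /= e e0; near=> y.
rewrite /Num.Def.normr/= mx_normrE (bigmax_le _ (ltW e0))//= => i _.
rewrite !mxE /=; move: i; near: y; apply: filter_forall => /= i.
by have /cvgrPdist_le := fx i.1 i.2; apply.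
Unshelve. all: by end_near. Qed.

Lemma Ck_mxP V k p q (U : set V) (f : V -> 'M[K]_(p, q)) : open U ->
  Ck k U f <-> forall i j, Ck k U (fun x => f x i j).
Proof.
move=> oU; elim: k f => [|k IH] f; split=> fU.
- move=> i j; split=> // x Ux.
  by have /continuous_mxP := Ck_cont fU Ux; apply.
- split=> // x Ux; apply/continuous_mxP => i j; exact: Ck_cont (fU i j) Ux.
- move=> i j; split=> [x Ux|v].
    by have /continuous_mxP := Ck_cont fU Ux; apply.
  split=> [x Ux|].
    by have /derivable_mxP := Ck_derivable (v := v) fU Ux; apply.
  apply: Ck_eq ((IH _).1 (Ck_derive (v := v) fU) i j) => // x Ux.
  by rewrite derive_mx ?mxE //; exact: Ck_derivable fU Ux.
split=> [x Ux|v].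
  by apply/continuous_mxP => i j; exact: Ck_cont (fU i j) Ux.
have fD x : U x -> derivable f x v.
  by move=> Ux; apply/derivable_mxP => i j; exact: Ck_derivable (fU i j) Ux.
split=> //; apply/IH => i j.
apply: Ck_eq (Ck_derive (v := v) (fU i j)) => // x Ux.
by rewrite derive_mx ?mxE //; exact: fD.
Qed.

(** The two free coefficients make the induction work: differentiation in the direction [v] sends
    [(a, b)] to [(v a, - v b)]. These are the coordinates of the hyperbolas that serve as causal
    curves. *)
Lemma Ck_exp k (U : set K) (a b : K) :
  Ck k U (fun t => a * expR t + b * expR (- t)).
Proof.
have D a' b' (t v : K) : is_derive t v
    (fun t => a' * expR t + b' * expR (- t))
    (v * a' * expR t + - v * b' * expR (- t)).
  have : is_derive t (1 : K) (fun t => a' * expR t + b' * expR (- t))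
      (a' * expR t - b' * expR (- t)).
    apply: is_derive_eq.
    by rewrite /GRing.scale /= mulrN1 mulrN.
  move=> [d e]; apply: DeriveDef.
    by apply: diff_derivable; exact/derivable1_diffP.
  rewrite deriveE; last exact/derivable1_diffP.
  rewrite -(mulr1 v) -[v * 1]/(v *: (1 : K)) linearZ /= -deriveE ?e.
    by rewrite /GRing.scale /=; ring.
  exact/derivable1_diffP.
have C a' b' : {in U, forall t,
    {for t, continuous (fun t => a' * expR t + b' * expR (- t))}}.
  move=> t _; apply/differentiable_continuous/derivable1_diffP.
  exact: (@ex_derive _ _ _ _ _ _ _ (D _ _ _ _)).
elim: k a b => [|k IH] a b; split=> // x *; try exact/C/mem_set.
split=> *; first exact: (@ex_derive _ _ _ _ _ _ _ (D _ _ _ _)).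
rewrite [X in Ck k U X](_ : _ = fun t => x * a * expR t + - x * b * expR (- t)).
  exact: IH.
by apply/funext => t; exact: (@derive_val _ _ _ _ _ _ _ (D _ _ _ _)).
Qed.

End Calculus.

(** * Differentiability of C^1 maps, chain rule, symmetry of second derivatives *)

Section Differentials.
Context {K : realType}.
Implicit Types V W : normedModType K.

Lemma is_derive_line V W (f : V -> W) (y v : V) (t : K) :
  derivable f (t *: v + y) v ->
  is_derive t 1 (fun s => f (s *: v + y)) ('D_v f (t *: v + y)).
Proof.
move=> df; have E : (fun h : K => h^-1 *: (f (h *: v + (t *: v + y)) -
    f (t *: v + y))) = (fun h : K => h^-1 *: (f ((h *: (1 : K) + t) *: v + y) -
    f (t *: v + y))).
  apply/funext => h; congr (_ *: (f _ - _)).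
  by rewrite [h%:A]mulr1 scalerDl addrA.
apply: DeriveDef; first by move: df; rewrite /derivable /= E.
by rewrite /derive /= E.
Qed.

(** Both signs of [s] are allowed because the increments in [C1_differentiable] are coordinates of
    an arbitrary vector. *)
Lemma mvt_line V (U : set V) (f : V -> K) (y v : V) (s : K) :
  (forall t : K, `|t| <= `|s| -> U (t *: v + y)) -> Ck 1 U f ->
  exists2 t : K, `|t| <= `|s| & f (s *: v + y) - f y = s * 'D_v f (t *: v + y).
Proof.
move=> yU fU; pose g (t : K) := f (t *: v + y).
have dg (t : K) : `|t| <= `|s| -> is_derive t 1 g ('D_v f (t *: v + y)).
  by move=> /yU Ut; apply: is_derive_line; exact: Ck_derivable fU Ut.
have cg (a b : K) : (forall t, t \in `[a, b] -> `|t| <= `|s|) ->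
    {within `[a, b], continuous g}.
  move=> h; apply: derivable_within_continuous => t /h /dg.
  by move/@ex_derive.
have [s0|/ltW s0] := leP 0 s.
  have [] := @MVT_segment K g (fun t => 'D_v f (t *: v + y)) 0 s s0.
  - move=> t; rewrite in_itv /= => /andP[t0 ts]; apply: dg.
    by rewrite !ger0_norm // ltW.
  - apply: cg => t; rewrite in_itv /= => /andP[t0 ts].
    by rewrite !ger0_norm.
  move=> t; rewrite in_itv /= => /andP[t0 ts]; rewrite /g scale0r add0r subr0.
  by move=> ->; exists t; rewrite 1?mulrC // !ger0_norm.
have [] := @MVT_segment K g (fun t => 'D_v f (t *: v + y)) s 0 s0.
- move=> t; rewrite in_itv /= => /andP[t0 ts]; apply: dg.
  by rewrite !ler0_norm // ?lerN2 ltW.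
- apply: cg => t; rewrite in_itv /= => /andP[t0 ts].
  by rewrite !ler0_norm ?lerN2.
move=> t; rewrite in_itv /= => /andP[t0 ts]; rewrite /g scale0r add0r sub0r.
move=> h; exists t; first by rewrite !ler0_norm // lerN2.
by rewrite -opprB h mulrN opprK mulrC.
Qed.

Lemma differentiable_of_expansion V W (f : V -> W) (x : V)
    (df : {linear V -> W}) : continuous df ->
  f \o shift x = cst (f x) + df +o_ 0 id -> differentiable f x.
Proof.
by move=> c e; apply/diff_locallyP; rewrite (diff_unique c e).
Qed.

(** The increment of [f] from [x] to [h + x] is telescoped along a path parallel to the axes; on
    each edge the mean value theorem and the continuity of one partial derivative bound the
    error. *)
Lemma C1_differentiable m (U : set 'rV[K]_m) (f : 'rV[K]_m -> K) x :
  open U -> U x -> Ck 1 U f -> differentiable f x.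
Proof.
move=> oU Ux fU.
pose d i := 'D_(delta_mx 0 i) f x.
pose df (h : 'rV[K]_m) : K := \sum_i h 0 i * d i.
have dfl : linear df.
  move=> a u v; rewrite /df scaler_sumr -big_split; apply: eq_bigr => i _ /=.
  by rewrite !mxE mulrDl /GRing.scale /= mulrA.
pose dfL : {linear 'rV[K]_m -> K} :=
  HB.pack df (GRing.isLinear.Build _ _ _ _ df dfl).
apply: (@differentiable_of_expansion _ _ f x dfL).
  have : Ck 0 setT df.
    apply: Ck_sum => [|i]; first exact: openT.
    apply: CkM; [exact: openT|exact: Ck_coord|exact: Ck_cst].
  by move=> c y; exact: (Ck_cont c).
apply/eqaddoP => e e0.
(* The errors of [m] edges are added up; [m.+1] keeps the denominator nonzero when [m = 0]. *)
pose e' := e / m.+1%:R; have e'0 : 0 < e' by rewrite divr_gt0.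
have : \forall y \near x, U y /\ forall i, `|'D_(delta_mx 0 i) f y - d i| <= e'.
  near=> y; split; first by near: y; exact: open_nbhs_nbhs.
  move=> i; rewrite distrC; move: i; near: y; apply: filter_forall => i.
  have := Ck_cont (Ck_derive (v := delta_mx 0 i) fU) Ux.
  by move=> /cvgrPdist_le; apply.
move=> /nbhs_ballP[r /= r0 xr]; near=> h.
pose p k : 'rV[K]_m := \row_j (if (j < k)%N then h 0 j else 0).
have hcoord j : `|h 0 j| <= `|h|.
  rewrite [leRHS]/Num.Def.normr /= mx_normrE.
  exact: (le_bigmax _ (fun i => `|h i.1 i.2|) (0, j)).
have hr : `|h| < r.
  near: h; apply/nbhs_ballP; exists r => // h.
  by rewrite -ball_normE /= sub0r normrN.
have key (i : 'I_m) : `|f (p i.+1 + x) - f (p i + x) - h 0 i * d i| <=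
    e' * `|h|.
  have inball (t : K) : `|t| <= `|h 0 i| ->
      ball x r (t *: delta_mx 0 i + (p i + x)).
    move=> th; rewrite -ball_normE /= addrA opprD addrA addrC.
    rewrite addrA addNr add0r normrN; apply: le_lt_trans hr.
    rewrite [leLHS]/Num.Def.normr /= mx_normrE.
    apply: bigmax_le => // -[a j] _; rewrite !mxE /= ord1 eqxx /=.
    have [->|ji] := eqVneq j i; first by rewrite ltnn mulr1 addr0 (le_trans th).
    by rewrite mulr0 add0r; case: ifP => _; rewrite ?normr0.
  have pS : p i.+1 = h 0 i *: delta_mx 0 i + p i.
    apply/rowP => j; rewrite !mxE eqxx /= ltnS leq_eqVlt.
    have [ji|ji] := eqVneq j i; first by rewrite ji eqxx ltnn mulr1 addr0.
    by rewrite val_eqE (negbTE ji) mulr0 add0r.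
  have [t th] := @mvt_line _ U f (p i + x) (delta_mx 0 i) (h 0 i)
    (fun t th => (xr _ (inball t th)).1) fU.
  rewrite pS -(addrA _ (p i) x) => ->; rewrite -mulrBr normrM mulrC.
  by apply: ler_pM => //; exact: (xr _ (inball t th)).2.
have -> : (f \o shift x - (cst (f x) + dfL)) h =
    \sum_(i < m) (f (p i.+1 + x) - f (p i + x) - h 0 i * d i).
  rewrite [RHS]big_split /= sumrN opprD addrA; congr (_ - _).
  rewrite -(big_mkord predT (fun i => f (p i.+1 + x) - f (p i + x))).
  rewrite (telescope_sumr (fun i => f (p i + x))) //; congr (f _ - f _).
    by rewrite /= /p; congr (_ + _); apply/rowP => j; rewrite !mxE ltn_ord.
  by rewrite -[LHS]add0r; congr (_ + _); apply/rowP => j; rewrite !mxE.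
apply: le_trans (ler_norm_sum _ _ _) _.
apply: le_trans (ler_sum _ (fun i _ => key i)) _.
rewrite sumr_const card_ord -mulrnAl ler_wpM2r // -mulr_natr /e' mulrAC.
by rewrite ler_pdivrMr // ler_pM2l // ler_nat.
Unshelve. all: by end_near. Qed.

Lemma C1_differentiable_row m k (U : set 'rV[K]_m) (f : 'rV[K]_m -> 'rV[K]_k) x :
  open U -> U x -> Ck 1 U f -> differentiable f x.
Proof.
move=> oU Ux /(Ck_mxP _ _ oU) fU.
have -> : f = \sum_(j < k) (fun y => f y 0 j *: delta_mx 0 j).
  by apply/funext => y; rewrite [LHS]row_sum_delta fct_sumE.
apply: differentiable_sum => j; apply: (@differentiableZl _ _ _ (fun y => f y 0 j)).
exact: C1_differentiable oU Ux (fU 0 j).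
Qed.

(** The map [g] is only known to be derivable in the direction [v], so the chain rule goes through
    the one-variable map [G], for which derivability is differentiability. *)
Lemma is_derive_comp V V' W (f : V' -> W) (g : V -> V') x v :
  derivable g x v -> differentiable f (g x) ->
  is_derive x v (f \o g) ('d f (g x) ('D_v g x)).
Proof.
move=> gx fx; pose G (h : K) := g (h *: v + x).
have G0 : G 0 = g x by rewrite /G scale0r add0r.
have dG : differentiable G 0.
  by apply: (derivable1_diffP _ _).1; apply: (derivable1P _ _ _).1.
have dfG : differentiable (f \o G) 0 by apply: differentiable_comp; rewrite ?G0.
have E : 'D_1 (f \o G) 0 = 'd f (g x) ('D_v g x).
  rewrite deriveE // diff_comp ?G0 //= -(deriveE _ dG).
  have -> // : 'D_1 G 0 = 'D_v g x.
  rewrite /derive /G /=.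
  set g1 := fun _ : K => _; set g2 := fun _ : K => _.
  suff -> : g1 = g2 by []; apply/funext => h; rewrite /g1 /g2.
  by rewrite addr0 scale0r add0r [_%:A]mulr1.
apply: DeriveDef.
  by apply: (derivable1P _ _ _).2; apply: (derivable1_diffP _ _).2.
rewrite -E /derive /G /=.
set g1 := fun _ : K => _; set g2 := fun _ : K => _.
suff -> : g1 = g2 by []; apply/funext => h; rewrite /g1 /g2.
by rewrite addr0 scale0r add0r [_%:A]mulr1.
Qed.

Lemma diff_rowE m W (f : 'rV[K]_m -> W) x v : differentiable f x ->
  'd f x v = \sum_i v 0 i *: 'D_(delta_mx 0 i) f x.
Proof.
move=> fx; rewrite {1}(row_sum_delta v) linear_sum; apply: eq_bigr => i _.
by rewrite linearZ deriveE.
Qed.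

(** The derivative of [f \o g] is the sum of the ['D_v g x 0 i] times the partial derivatives of [f]
    composed with [g], and the induction hypothesis applies to those composites. *)
Lemma Ck_comp_scalar V m k (U : set V) (A : set 'rV[K]_m) (f : 'rV[K]_m -> K)
    (g : V -> 'rV[K]_m) : open U -> open A -> (forall x, U x -> A (g x)) ->
  Ck k A f -> Ck k U g -> Ck k U (f \o g).
Proof.
move=> oU oA gUA; elim: k f => [|k IH] f fA gU.
  split=> // x Ux.
  exact: continuous_comp (Ck_cont gU Ux) (Ck_cont fA (gUA _ Ux)).
split=> [x Ux|v].
  exact: continuous_comp (Ck_cont gU Ux) (Ck_cont fA (gUA _ Ux)).
have fd x : U x -> differentiable f (g x).
  move=> Ux; apply: C1_differentiable oA (gUA _ Ux) _.
  by elim: (k) fA => // k' IHk /Ck_pred.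
have D x : U x -> is_derive x v (f \o g) ('d f (g x) ('D_v g x)).
  move=> Ux; apply: is_derive_comp (fd _ Ux).
  exact: Ck_derivable gU Ux.
split=> [x Ux|]; first exact: (@ex_derive _ _ _ _ _ _ _ (D x Ux)).
have := Ck_derive (v := v) gU => /(Ck_mxP _ _ oU) Dg.
apply: (@Ck_eq _ _ _ _ _ (fun x => \sum_i 'D_v g x 0 i *
    ('D_(delta_mx 0 i) f \o g) x)) => //.
  move=> x Ux; rewrite (@derive_val _ _ _ _ _ _ _ (D x Ux)) diff_rowE //.
  exact: fd.
apply: Ck_sum => // i; apply: CkM => //.
by apply: IH (Ck_pred gU); exact: Ck_derive.
Qed.

Lemma Ck_comp V m k p q (U : set V) (A : set 'rV[K]_m)
    (f : 'rV[K]_m -> 'M[K]_(p, q)) (g : V -> 'rV[K]_m) :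
  open U -> open A -> (forall x, U x -> A (g x)) ->
  Ck k A f -> Ck k U g -> Ck k U (f \o g).
Proof.
move=> oU oA gUA /(Ck_mxP _ _ oA) fA gU; apply/Ck_mxP => // i j.
exact: (@Ck_comp_scalar _ _ _ U A (fun y => f y i j)).
Qed.

(** The mean value theorem is applied along [u] to a difference in the direction [v], then along [v]
    to ['D_u f]. The left-hand side is symmetric in [u] and [v], which is the source of
    [derive_sym]. *)
Lemma second_difference V (U : set V) (f : V -> K) (x u v : V) (s : K) :
  0 <= s -> (forall a b, 0 <= a <= s -> 0 <= b <= s ->
    U (a *: u + (b *: v + x))) -> Ck 2 U f ->
  exists a b, [/\ 0 <= a <= s, 0 <= b <= s &
    f (s *: u + (s *: v + x)) - f (s *: u + x) - f (s *: v + x) + f x =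
    s * s * 'D_v (fun y => 'D_u f y) (a *: u + (b *: v + x))].
Proof.
move=> s0 xU fU; have s00 : 0 <= (0 : K) <= s by rewrite lexx.
have ss : 0 <= s <= s by rewrite s0 lexx.
have xU0 a : 0 <= a <= s -> U (a *: u + x).
  by move=> /xU - /(_ 0 s00); rewrite scale0r add0r.
pose g (t : K) := f (t *: u + (s *: v + x)) - f (t *: u + x).
pose dg (t : K) := 'D_u f (t *: u + (s *: v + x)) - 'D_u f (t *: u + x).
have g' (t : K) : 0 <= t <= s -> is_derive t 1 g (dg t).
  move=> ts; apply: is_deriveB; apply: is_derive_line.
    exact: Ck_derivable fU (xU _ _ ts ss).
  exact: Ck_derivable fU (xU0 _ ts).
have [] := @MVT_segment K g dg 0 s s0.
- by move=> t; rewrite in_itv /= => /andP[/ltW t0 /ltW ts]; apply/g'/andP.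
- apply: derivable_within_continuous => t; rewrite in_itv /= => /g'.
  by move/@ex_derive.
move=> a; rewrite in_itv /= => /[dup] as_ /andP[a0 _].
have E b : a *: u + (b *: v + x) = b *: v + (a *: u + x) by rewrite addrCA.
pose h (t : K) := 'D_u f (t *: v + (a *: u + x)).
pose dh (t : K) := 'D_v (fun y => 'D_u f y) (t *: v + (a *: u + x)).
have h' (t : K) : 0 <= t <= s -> is_derive t 1 h (dh t).
  move=> ts; apply: (is_derive_line (f := fun y => 'D_u f y)); rewrite -E.
  exact: Ck_derivable (Ck_derive fU) (xU _ _ as_ ts).
have [] := @MVT_segment K h dh 0 s s0.
- by move=> t; rewrite in_itv /= => /andP[/ltW t0 /ltW ts]; apply/h'/andP.
- apply: derivable_within_continuous => t; rewrite in_itv /= => /h'.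
  by move/@ex_derive.
move=> b; rewrite in_itv /= => bs hh gg; exists a, b; split=> //.
move: hh gg; rewrite /h /g /dg /dh !scale0r !add0r !subr0 !E => -> Eg.
transitivity (f (s *: u + (s *: v + x)) - f (s *: u + x) -
  (f (s *: v + x) - f x)); first by ring.
by rewrite Eg; ring.
Qed.

(** The two evaluations of a second difference give equal values of the mixed derivatives at two
    different points near [x]; continuity brings both points to [x]. *)
Lemma continuous_close_eq V (g h : V -> K) (x : V) :
  {for x, continuous g} -> {for x, continuous h} ->
  (\forall r \near 0^'+, exists y z, [/\ ball x r y, ball x r z & g y = h z]) ->
  g x = h x.
Proof.
move=> /cvgrPdist_le cg /cvgrPdist_le ch gh.
apply/eqP; rewrite -subr_eq0 -normr_le0.
apply/ler_addgt0Pr => e e0; rewrite add0r.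
have e20 : 0 < e / 2 by rewrite divr_gt0.
have /nbhs_ballP[r1 /= r10 gr] := cg _ e20.
have /nbhs_ballP[r2 /= r20 hr] := ch _ e20.
near (0 : K)^'+ => r.
have [y [z [xy xz yz]]] : exists y z, [/\ ball x r y, ball x r z & g y = h z].
  by near: r.
have rr1 : r <= r1 by near: r; exact: nbhs_right_le.
have rr2 : r <= r2 by near: r; exact: nbhs_right_le.
have {}gr := gr y (le_ball rr1 xy); have {}hr := hr z (le_ball rr2 xz).
rewrite (le_trans (ler_distD (g y) _ _)) // (splitr e) lerD //.
by rewrite yz distrC.
Unshelve. all: by end_near. Qed.

Lemma derive_sym V (U : set V) (f : V -> K) (x u v : V) : open U -> U x ->
  Ck 2 U f -> 'D_u (fun y => 'D_v f y) x = 'D_v (fun y => 'D_u f y) x.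
Proof.
move=> oU Ux fU.
have cu := Ck_cont (Ck_derive (v := u) (Ck_derive (v := v) fU)) Ux.
have cv := Ck_cont (Ck_derive (v := v) (Ck_derive (v := u) fU)) Ux.
apply: (continuous_close_eq cu cv).
have /nbhs_ballP[R0 /= R00 xR] := open_nbhs_nbhs (conj oU Ux).
pose M := `|u| + `|v| + 1.
have M0 : 0 < M by rewrite ltr_wpDl // addr_ge0.
near=> r.
have r0 : 0 < r by [].
have rR : r <= R0 by near: r; exact: nbhs_right_le.
(* This makes [s (|u| + |v|) < r], so the parallelogram stays in the ball; the summand 1 in [M]
   keeps it positive when [u = v = 0]. *)
pose s := r / 2 / M; have s0 : 0 < s by rewrite !divr_gt0.
have sM : s * M < r.
  by rewrite /s divfK ?gt_eqF // ltr_pdivrMr // ltr_pMr // ltr1n.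
have inb w w' a b : `|w| + `|w'| + 1 = M -> 0 <= a <= s -> 0 <= b <= s ->
    ball x r (a *: w + (b *: w' + x)).
  move=> wM /andP[a0 as_] /andP[b0 bs]; rewrite -ball_normE /=.
  rewrite addrA opprD addrCA subrr addr0 normrN; apply: le_lt_trans sM.
  apply: le_trans (ler_normD _ _) _; rewrite !normrZ !ger0_norm // -wM.
  rewrite !mulrDr mulr1 -[leLHS]addr0; apply: lerD; last exact: ltW.
  by apply: lerD; apply: ler_wpM2r.
have [|a [b [as_ bs E1]]] := @second_difference _ U f x u v s (ltW s0) _ fU.
  by move=> a b as_ bs; apply: xR; apply: le_ball rR _ _; exact: inb.
have Mv : `|v| + `|u| + 1 = M by rewrite /M (addrC `|v|).
have [|a' [b' [as' bs' E2]]] := @second_difference _ U f x v u s (ltW s0) _ fU.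
  by move=> c d cs ds; apply: xR; apply: le_ball rR _ _; exact: inb.
exists (a' *: v + (b' *: u + x)), (a *: u + (b *: v + x)).
split; [exact: inb|exact: inb|].
have ss0 : s * s != 0 by rewrite mulf_neq0 // gt_eqF.
have swap (A B C D P Q : K) :
  A - B - C + D = P -> A - C - B + D = Q -> P = Q.
  by move=> <- <-; rewrite [A - B - C]addrAC.
have E3 : s *: u + (s *: v + x) = s *: v + (s *: u + x) by exact: addrCA.
rewrite E3 in E1.
by have /(mulfI ss0)/esym := swap _ _ _ _ _ _ E1 E2.
Unshelve. all: by end_near. Qed.

End Differentials.

(** * Smooth maps and their jacobians *)

Section Jacobian.
Context {K : realType}.
Implicit Types V W : normedModType K.

Lemma Cinf_local V W (U : set V) (f : V -> W) :
  (forall x, U x -> exists U' g,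
    [/\ U' x, Cinf U' g & \forall y \near x, g y = f y]) -> Cinf U f.
Proof.
move=> h k; apply: Ck_local => x /h[U' [g [? gU' ?]]].
by exists U', g; split=> //; exact: gU'.
Qed.

Lemma Cinf_eq V W (U : set V) (f g : V -> W) :
  open U -> (forall x, U x -> f x = g x) -> Cinf U f -> Cinf U g.
Proof. by move=> oU fg fU k; exact: Ck_eq fg (fU k). Qed.

Lemma Cinf_sub V W (U U' : set V) (f : V -> W) :
  U' `<=` U -> Cinf U f -> Cinf U' f.
Proof. by move=> UU' fU k; exact: Ck_sub UU' (fU k). Qed.

Lemma Cinf_cont V W (U : set V) (f : V -> W) x :
  Cinf U f -> U x -> {for x, continuous f}.
Proof. by move=> fU; exact: Ck_cont (fU 0). Qed.

Lemma Cinf_comp V m p q (U : set V) (A : set 'rV[K]_m)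
    (f : 'rV[K]_m -> 'M[K]_(p, q)) (g : V -> 'rV[K]_m) :
  open U -> open A -> (forall x, U x -> A (g x)) ->
  Cinf A f -> Cinf U g -> Cinf U (f \o g).
Proof.
by move=> oU oA gUA fA gU k; exact: Ck_comp gUA (fA k) (gU k).
Qed.

Lemma Cinf_mxP V p q (U : set V) (f : V -> 'M[K]_(p, q)) : open U ->
  Cinf U f <-> forall i j, Cinf U (fun x => f x i j).
Proof.
move=> oU; split=> [fU i j k|fU k].
  exact: ((Ck_mxP _ _ oU).1 (fU k)).
by apply/Ck_mxP => // i j; exact: fU.
Qed.

Lemma Cinf_mulmxr V (p q r : nat) (U : set V) (f : V -> 'M[K]_(p, q))
    (A : 'M[K]_(q, r)) : open U -> Cinf U f -> Cinf U (fun x => f x *m A).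
Proof.
move=> oU fU; apply/Cinf_mxP => // i j k.
apply: (@Ck_eq _ _ _ _ _ (fun x => \sum_l f x i l * A l j)) => //.
  by move=> x _; rewrite mxE.
apply: Ck_sum => // l; apply: CkM => //; last exact: Ck_cst.
by have /(Cinf_mxP _ oU) := fU; apply.
Qed.

Lemma Cinf_mulmx V (p q r : nat) (U : set V) (f : V -> 'M[K]_(p, q))
    (g : V -> 'M[K]_(q, r)) :
  open U -> Cinf U f -> Cinf U g -> Cinf U (fun x => f x *m g x).
Proof.
move=> oU /(Cinf_mxP _ oU) fU /(Cinf_mxP _ oU) gU; apply/Cinf_mxP => // i j k.
apply: (@Ck_eq _ _ _ _ _ (fun x => \sum_l f x i l * g x l j)) => //.
  by move=> x _; rewrite mxE.
by apply: Ck_sum => // l; apply: CkM => //; [exact: fU|exact: gU].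
Qed.

Lemma Cinf_tr V (p q : nat) (U : set V) (f : V -> 'M[K]_(p, q)) :
  open U -> Cinf U f -> Cinf U (fun x => (f x)^T).
Proof.
move=> oU /(Cinf_mxP _ oU) fU; apply/Cinf_mxP => // i j k.
by apply: Ck_eq (fU j i k) => // x _; rewrite mxE.
Qed.

Lemma Cinf_scale V p q (U : set V) (a : V -> K) (f : V -> 'M[K]_(p, q)) :
  open U -> Cinf U a -> Cinf U f -> Cinf U (fun x => a x *: f x).
Proof.
move=> oU aU /(Cinf_mxP _ oU) fU; apply/Cinf_mxP => // i j k.
apply: Ck_eq (CkM oU (aU k) (fU i j k)) => // x _.
by rewrite !mxE.
Qed.

Lemma Cinf_id V (U : set V) : Cinf U (@id V).
Proof.
have c x : {for x, continuous (@id V)} by exact: cvg_id.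
case=> [|k]; split=> // v; split=> [x _|]; first exact: derivable_id.
rewrite [X in Ck k U X](_ : _ = fun=> v); first exact: Ck_cst.
by apply/funext => x; exact: derive_id.
Qed.

Lemma Cinf_differentiable m k (U : set 'rV[K]_m) (f : 'rV[K]_m -> 'rV[K]_k) x :
  open U -> U x -> Cinf U f -> differentiable f x.
Proof. by move=> oU Ux fU; exact: C1_differentiable_row oU Ux (fU 1). Qed.

Lemma near_eq_differentiable V W (f g : V -> W) x :
  (\forall y \near x, f y = g y) -> differentiable f x ->
  differentiable g x /\ 'd g x = 'd f x :> (V -> W).
Proof.
move=> fg /diff_locallyP[dfc /eqaddoP e].
suff E : g \o shift x = cst (g x) + 'd f x +o_ 0 id.
  by split; [exact: differentiable_of_expansion E|exact: diff_unique].
have fg0 : \forall h \near (0 : V), f (h + x) = g (h + x).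
  by move: fg; rewrite (near_shift 0) subr0.
apply/eqaddoP => eps /e; apply: filterS2 fg0 => h /= E.
by rewrite !fctE /= E (nbhs_singleton fg).
Qed.

Lemma near_eq_jacobian m k (f g : 'rV[K]_m -> 'rV[K]_k) x :
  (\forall y \near x, f y = g y) -> differentiable f x ->
  jacobian g x = jacobian f x.
Proof.
move=> fg df; have [_ E] := near_eq_differentiable fg df.
apply/matrixP => i j; rewrite /jacobian [LHS]mxE [RHS]mxE.
exact: (congr1 (fun h : 'rV[K]_m -> 'rV[K]_k => h (delta_mx 0 i) 0 j) E).
Qed.

Lemma mul_jacobian m k (f : 'rV[K]_m -> 'rV[K]_k) x v :
  v *m jacobian f x = 'd f x v.
Proof. by rewrite /jacobian mul_rV_lin1. Qed.

Lemma jacobian_comp m k l (f : 'rV[K]_m -> 'rV[K]_k) (g : 'rV[K]_k -> 'rV[K]_l)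
    x : differentiable f x -> differentiable g (f x) ->
  jacobian (g \o f) x = jacobian f x *m jacobian g (f x).
Proof.
move=> df dg; apply/row_matrixP => i.
rewrite (rowE i (jacobian (g \o f) x)) (rowE i (_ *m _)) mulmxA.
rewrite (mul_jacobian (g \o f)) (mul_jacobian f) (mul_jacobian g).
have E := diff_comp df dg.
exact: (congr1 (fun h : 'rV[K]_m -> 'rV[K]_l => h (delta_mx 0 i)) E).
Qed.

Lemma jacobian_linear m k (A : 'M[K]_(m, k)) x :
  jacobian (fun y => y *m A) x = A.
Proof.
have cA : continuous (mulmxr A : 'rV[K]_m -> 'rV[K]_k).
  move=> y; apply: (@Cinf_cont _ _ setT) => //.
  by apply: Cinf_mulmxr; [exact: openT|exact: Cinf_id].
have E := diff_lin x cA.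
apply/row_matrixP => i; rewrite !rowE mul_jacobian.
exact: (congr1 (fun h : 'rV[K]_m -> 'rV[K]_k => h (delta_mx 0 i)) E).
Qed.

Lemma jacobian_id m (x : 'rV[K]_m) : jacobian id x = 1%:M.
Proof.
rewrite -[RHS](jacobian_linear _ x); congr (jacobian _ _).
by apply/funext => y; rewrite mulmx1.
Qed.

Lemma jacobianE m k (f : 'rV[K]_m -> 'rV[K]_k) x i j :
  differentiable f x ->
  jacobian f x i j = 'D_(delta_mx 0 i) (fun y => f y 0 j) x.
Proof.
move=> df; have E := deriveEjacobian (delta_mx 0 i) df.
have := derive_mx (diff_derivable (v := delta_mx 0 i) df); rewrite {}E -rowE.
by move=> /matrixP/(_ 0 j); rewrite [LHS]mxE [RHS]mxE.
Qed.

End Jacobian.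

(** * Pseudo-orthonormal frames of the tangent spaces *)

Section Frames.
Context {K : realType}.

Local Notation eta N := (@mink_mx K N).

Lemma mink_mxT N : (eta N)^T = eta N.
Proof. by rewrite /mink_mx tr_diag_mx. Qed.

Lemma mink_mx_sqr N : eta N *m eta N = 1%:M.
Proof.
rewrite /mink_mx mulmx_diag; apply/matrixP => i j; rewrite !mxE.
by rewrite -signr_addb addbb.
Qed.

(** The minus sign sits in the last slot, so splitting off the first coordinate leaves a form of the
    same type; for [n = 0] that coordinate would be the time-like one. *)
Lemma mink_mx_block n : (0 < n)%N ->
  eta n.+1 = (block_mx 1%:M 0 0 (eta n) : 'M[K]_(1 + n)).
Proof.
move=> n0; apply/matrixP => i j; rewrite /block_mx /mink_mx [RHS]mxE.
case: splitP => i' Ei; rewrite [RHS]mxE; case: splitP => j' Ej;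
  rewrite !mxE -!val_eqE /= Ei Ej ?(ord1 i') ?(ord1 j') //.
by case: n n0 {i j i' j' Ei Ej}.
Qed.

Lemma mink_gram N k l (A : 'M[K]_(k, N)) (B : 'M[K]_(l, N)) i j :
  (A *m eta N *m B^T) i j = mink (row i A) (row j B).
Proof.
by rewrite /mink !mxE; apply: eq_bigr => m _; rewrite -row_mul !mxE.
Qed.

Lemma mink_scalar N (u v : 'rV[K]_N) : u *m eta N *m v^T = (mink u v)%:M.
Proof. exact: mx11_scalar. Qed.

(** The rows of [E] are a basis of the tangent space at [p] in which the induced form is diag(1,
    ..., 1, -1). *)
Definition frame (R : K) n (p : 'rV[K]_n.+1) (E : 'M[K]_(n, n.+1)) :=
  [/\ mink p p = R ^+ 2, E *m eta n.+1 *m E^T = eta n &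
      E *m eta n.+1 *m p^T = 0].

(** The obvious frame [E0] at [p0 = (R, 0, ..., 0)] is carried to [p] by a reflection [M w] of the
    Minkowski form. A reflection sending [p0] to [- p] does as well, since a frame at [- p] is a
    frame at [p]. *)
Lemma frame_exists (R : K) n (p : 'rV[K]_n.+1) : (0 < n)%N -> 0 < R ->
  mink p p = R ^+ 2 -> exists E, frame R p E.
Proof.
move=> n0 R0 pp; have Rn0 : R != 0 by rewrite gt_eqF.
pose p0 : 'rV[K]_n.+1 := row_mx (R%:M : 'M[K]_1) (0 : 'rV[K]_n).
pose E0 : 'M[K]_(n, n.+1) := row_mx (0 : 'cV[K]_n) 1%:M.
pose M (w : 'rV[K]_n.+1) : 'M[K]_n.+1 :=
  1%:M - (2 / mink w w) *: (eta n.+1 *m w^T *m w).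
have Mx w x : x *m M w = x - (2 / mink w w * mink x w) *: w.
  rewrite /M mulmxBr mulmx1 -scalemxAr !mulmxA mink_scalar mul_scalar_mx.
  by rewrite scalerA.
have MM w : mink w w != 0 -> M w *m eta n.+1 *m (M w)^T = eta n.+1.
  move=> w0; set c := 2 / mink w w.
  have cw : c * mink w w = 2 by rewrite divfK.
  pose a := eta n.+1 *m w^T.
  have aT : a^T = w *m eta n.+1 by rewrite trmx_mul trmxK mink_mxT.
  have tM : (M w)^T = 1%:M - c *: (w^T *m a^T).
    by rewrite /M -/a -/c linearB /= trmx1 linearZ /= trmx_mul.
  have M1 : M w *m eta n.+1 = eta n.+1 - c *: (a *m a^T).
    by rewrite /M -/a -/c mulmxBl mul1mx -scalemxAl -mulmxA aT.
  rewrite tM M1 mulmxBr mulmx1 -scalemxAr mulmxBl mulmxA -/a -scalemxAl.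
  rewrite -(mulmxA a) (mulmxA a^T) aT mink_scalar -aT mul_scalar_mx.
  rewrite -scalemxAr scalerBr !scalerA -mulrA cw; set X := a *m _.
  by apply/matrixP => i j; rewrite !mxE; ring.
have pT : p0^T = col_mx (R%:M : 'M[K]_1) (0 : 'cV[K]_n).
  by apply: etrans (tr_row_mx (R%:M : 'M[K]_1) (0 : 'rV[K]_n)) _; rewrite tr_scalar_mx trmx0.
have pe : p0 *m eta n.+1 = p0.
  rewrite mink_mx_block //.
  apply: etrans (mul_row_block (R%:M : 'M[K]_1) 0 (1%:M : 'M[K]_1) 0 0 (eta n)) _.
  by rewrite !mulmx0 !mul0mx !addr0 mulmx1.
have ET : E0^T = col_mx (0 : 'rV[K]_n) 1%:M.
  by apply: etrans (tr_row_mx (0 : 'cV[K]_n) 1%:M) _; rewrite trmx1 trmx0.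
have Ee : E0 *m eta n.+1 = row_mx (0 : 'cV[K]_n) (eta n).
  rewrite mink_mx_block //.
  apply: etrans (mul_row_block (0 : 'cV[K]_n) 1%:M (1%:M : 'M[K]_1) 0 0 (eta n)) _.
  by rewrite !mulmx0 !mul0mx !addr0 add0r mul1mx.
have p00 : mink p0 p0 = R ^+ 2.
  rewrite /mink pe pT (mul_row_col (R%:M : 'M[K]_1)) mulmx0 addr0.
  by rewrite -scalar_mxM mxE eqxx.
have E00 : E0 *m eta n.+1 *m E0^T = eta n.
  by rewrite Ee ET (mul_row_col (0 : 'cV[K]_n)) mul0mx add0r mulmx1.
have E0p0 : E0 *m eta n.+1 *m p0^T = 0.
  by rewrite Ee pT (mul_row_col (0 : 'cV[K]_n)) mul0mx add0r mulmx0.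
suff [w w0 Mp] : exists2 w, mink w w != 0 & p0 *m M w = p \/ p0 *m M w = - p.
  have EM k (A : 'M[K]_(k, n.+1)) :
      E0 *m M w *m eta n.+1 *m (A *m M w)^T = E0 *m eta n.+1 *m A^T.
    rewrite trmx_mul !mulmxA -(mulmxA E0) -(mulmxA E0 (M w *m _)).
    by rewrite MM.
  have E0p : E0 *m M w *m eta n.+1 *m (p0 *m M w)^T = 0 by rewrite EM.
  exists (E0 *m M w); split=> //; first by rewrite EM.
  case: Mp E0p => -> //; rewrite linearN /= mulmxN => /eqP.
  by rewrite oppr_eq0 => /eqP.
have R20 : R ^+ 2 != 0 by rewrite expf_neq0.
(* Reflection in [p - p0] swaps [p0] and [p], but [<p - p0, p - p0>] vanishes when [<p, p0> = R^2].
   In that case [p + p0] has square [4 R^2], and its reflection sends [p0] to [- p]. *)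
have [pp0|pp0] := eqVneq (mink p p0) (R ^+ 2).
  have ww : mink (p + p0) (p + p0) = 4 * R ^+ 2.
    by rewrite !(minkDl, minkDr) pp p00 (minkC p0) pp0; ring.
  exists (p + p0); first by rewrite ww mulf_neq0 ?pnatr_eq0.
  right; rewrite Mx ww minkDr p00 (minkC p0) pp0.
  have -> : 2 / (4 * R ^+ 2) * (R ^+ 2 + R ^+ 2) = 1 by field.
  by rewrite scale1r opprD addrCA subrr addr0.
have mB u : mink u (p + -1 *: p0) = mink u p - mink u p0.
  by rewrite minkDr minkZr mulN1r.
have ww : mink (p + -1 *: p0) (p + -1 *: p0) = 2 * (R ^+ 2 - mink p p0).
  by rewrite !(minkDl, minkZl, mB) pp p00 (minkC p0); ring.
have w0 : R ^+ 2 - mink p p0 != 0 by rewrite subr_eq0 eq_sym.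
exists (p + -1 *: p0); first by rewrite ww mulf_neq0 // pnatr_eq0.
left; rewrite Mx ww mB p00 (minkC p0).
have -> : 2 / (2 * (R ^+ 2 - mink p p0)) * (mink p p0 - R ^+ 2) = -1 by field.
by rewrite !scaleN1r opprK addrCA subrr addr0.
Qed.

Section FrameTheory.
Variables (R : K) (n : nat) (p : 'rV[K]_n.+1) (E : 'M[K]_(n, n.+1)).
Hypotheses (R0 : 0 < R) (n0 : (0 < n)%N) (fE : frame R p E).

(** The rows of [R^-1 p] and [E] have a Gram matrix [D] of square 1. Hence a right inverse of the
    square matrix [B] is explicit; it is also a left inverse, and this is the expansion of [x] in
    the frame. *)
Lemma frame_complete (x : 'rV[K]_n.+1) :
  x = (mink x p / R ^+ 2) *: p + x *m eta n.+1 *m E^T *m eta n *m E.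
Proof.
have [pp EE Ep] := fE; have Rn0 : R != 0 by rewrite gt_eqF.
have pE : p *m eta n.+1 *m E^T = 0.
  by move: (congr1 trmx Ep); rewrite !trmx_mul trmxK mink_mxT trmx0 mulmxA.
pose B : 'M[K]_(1 + n, n.+1) := col_mx (R^-1 *: p) E.
have BT : B^T = row_mx (R^-1 *: p)^T E^T by exact: tr_col_mx.
pose D : 'M[K]_(1 + n) := block_mx 1%:M 0 0 (eta n).
have BB : B *m eta n.+1 *m B^T = D.
  rewrite BT /B mul_col_mx mul_col_row; congr block_mx => //.
  - rewrite linearZ /= -!scalemxAl -scalemxAr mink_scalar pp.
    rewrite scalerA !scale_scalar_mx; congr (_%:M); by field.
  - by rewrite -!scalemxAl pE scaler0.
  - by rewrite linearZ /= -scalemxAr Ep scaler0.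
have DD : D *m D = 1%:M.
  by rewrite /D -mink_mx_block // mink_mx_sqr.
have BB1 : eta n.+1 *m B^T *m D *m B = 1%:M.
  by apply: (@mulmx1C _ n.+1); rewrite !mulmxA BB DD.
rewrite -[LHS]mulmx1 -BB1 BT /B /D -!mulmxA.
rewrite mul_block_col mul1mx !mul0mx addr0 add0r mul_row_col.
rewrite !mulmxDr !mulmxA; congr (_ + _).
rewrite linearZ /= [(_ *: p)^T]linearZ /= -scalemxAr -scalemxAl scalerA.
by rewrite mink_scalar mul_scalar_mx scalerA mulrC -invfM expr2.
Qed.

Lemma frame_gram (u v : 'rV[K]_n) : mink (u *m E) (v *m E) = mink u v.
Proof.
have [_ EE _] := fE; rewrite /mink trmx_mul !mulmxA.
by rewrite -(mulmxA u) -(mulmxA u (E *m _)) EE.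
Qed.

Lemma frame_orth (u : 'rV[K]_n) : mink (u *m E) p = 0.
Proof. by have [_ _ Ep] := fE; rewrite /mink -!mulmxA (mulmxA E) Ep mulmx0 mxE. Qed.

Lemma frame_coords (u : 'rV[K]_n) : u *m E *m eta n.+1 *m E^T *m eta n = u.
Proof.
have [_ EE _] := fE; rewrite -(mulmxA u) -(mulmxA u (E *m _)) EE -mulmxA.
by rewrite mink_mx_sqr mulmx1.
Qed.

End FrameTheory.

End Frames.

(** * Stereographic projection of the hyperboloid *)

Section Hyperboloid.
Context {K : realType}.
Local Notation eta N := (@mink_mx K N).

Lemma Cinf_mink (V : normedModType K) N (U : set V) (f g : V -> 'rV[K]_N) :
  open U -> Cinf U f -> Cinf U g -> Cinf U (fun x => mink (f x) (g x)).
Proof.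
move=> oU fU gU.
have /(Cinf_mxP _ oU) h : Cinf U (fun x => f x *m eta N *m (g x)^T).
  by apply: Cinf_mulmx => //; [exact: Cinf_mulmxr|exact: Cinf_tr].
exact: h.
Qed.

Lemma derive_mink (V : normedModType K) N (f g : V -> 'rV[K]_N) x v :
  derivable f x v -> derivable g x v ->
  is_derive x v (fun y => mink (f y) (g y))
    (mink ('D_v f x) (g x) + mink (f x) ('D_v g x)).
Proof.
move=> fx gx; pose h (i : 'I_N) y := (-1) ^+ (i.+1 == N) * f y 0 i * g y 0 i.
have -> : (fun y => mink (f y) (g y)) = \sum_(i < N) h i.
  by apply/funext => y; rewrite minkE fct_sumE.
have fd i : is_derive x v (fun y => f y 0 i) ('D_v f x 0 i).
  rewrite (derive_mx fx) mxE; apply: derivableP.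
  by have /derivable_mxP := fx; apply.
have gd i : is_derive x v (fun y => g y 0 i) ('D_v g x 0 i).
  rewrite (derive_mx gx) mxE; apply: derivableP.
  by have /derivable_mxP := gx; apply.
rewrite !minkE -big_split /=; apply: is_derive_sum => i.
rewrite /h; apply: is_derive_eq.
by rewrite /GRing.scale /=; ring.
Qed.

Lemma open_mink_gt0 N (p : 'rV[K]_N) : open [set x | 0 < mink x p].
Proof.
have c : continuous (fun x => mink x p).
  move=> x; apply: (@Cinf_cont _ _ _ setT) => //.
  by apply: Cinf_mink; [exact: openT|exact: Cinf_id|move=> k; exact: Ck_cst].
exact: (open_comp (fun x _ => c x) (@open_gt _ 0)).
Qed.

Section Stereographic.
Context {n : nat} {R : K}.
Hypotheses (R0 : 0 < R) (n0 : (0 < n)%N).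
Variables (p : 'rV[K]_n.+1) (E : 'M[K]_(n, n.+1)).
Hypothesis fE : frame R p E.

(* Stereographic projection from [- p] onto the hyperplane orthogonal to [p]. *)
Definition stereo_fwd (x : 'rV[K]_n.+1) : 'rV[K]_n :=
  (1 + mink x p / R ^+ 2)^-1 *: (x *m eta n.+1 *m E^T *m eta n).

Definition stereo_inv (y : 'rV[K]_n) : 'rV[K]_n.+1 :=
  (1 + mink y y / R ^+ 2)^-1 *: ((1 - mink y y / R ^+ 2) *: p + 2 *: (y *m E)).

Let R20 : R ^+ 2 != 0. Proof. by rewrite expf_neq0 // gt_eqF. Qed.
Let pp : mink p p = R ^+ 2. Proof. by case: fE. Qed.

Lemma stereo_inv_p y : 1 + mink y y / R ^+ 2 != 0 ->
  mink (stereo_inv y) p =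
  R ^+ 2 * ((1 - mink y y / R ^+ 2) / (1 + mink y y / R ^+ 2)).
Proof.
move=> m0; rewrite /stereo_inv minkZl minkDl !minkZl (frame_orth fE) pp.
set m := mink y y / R ^+ 2 in m0 *.
by field.
Qed.

Lemma stereo_invS y : 1 + mink y y / R ^+ 2 != 0 ->
  mink (stereo_inv y) (stereo_inv y) = R ^+ 2.
Proof.
move=> m0; rewrite /stereo_inv !(minkZl, minkZr, minkDl, minkDr) pp.
rewrite (minkC p) (frame_orth fE) (frame_gram fE).
set m := mink y y / R ^+ 2 in m0 *.
have -> : mink y y = m * R ^+ 2 by rewrite divfK.
by field.
Qed.

Lemma stereo_invK y : 1 + mink y y / R ^+ 2 != 0 ->
  stereo_fwd (stereo_inv y) = y.
Proof.
move=> m0; rewrite /stereo_fwd stereo_inv_p // mulrC mulrA mulVf // mul1r.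
rewrite /stereo_inv -!scalemxAl !mulmxDl -!scalemxAl (frame_coords fE).
have -> : p *m eta n.+1 *m E^T = 0.
  have [_ _] := fE => /(congr1 trmx).
  by rewrite !trmx_mul trmxK mink_mxT trmx0 mulmxA.
rewrite mul0mx scaler0 add0r !scalerA; set m := mink y y / _ in m0 *.
rewrite -[RHS]scale1r; congr (_ *: _); field.
by rewrite m0 addrACA subrr addr0 -mulr2n pnatr_eq0.
Qed.

Lemma stereo_fwd_gram x : mink x x = R ^+ 2 -> 1 + mink x p / R ^+ 2 != 0 ->
  mink (stereo_fwd x) (stereo_fwd x) / R ^+ 2 =
  (1 - mink x p / R ^+ 2) / (1 + mink x p / R ^+ 2).
Proof.
move=> xx s0; rewrite /stereo_fwd !(minkZl, minkZr).
set u := _ *m eta n; set s := mink x p / R ^+ 2 in s0 *.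
have uu : mink u u = R ^+ 2 * (1 - s ^+ 2).
  move: xx; rewrite {1 2}(frame_complete R0 n0 fE x) -/u -/s.
  rewrite !(minkDl, minkDr, minkZl, minkZr) pp (minkC p) (frame_orth fE).
  rewrite (frame_gram fE) => h; apply/(addrI (s * (s * R ^+ 2))).
  by apply: etrans (etrans _ h) _; ring.
by rewrite uu; field; rewrite s0 /=; move: R20; rewrite sqrf_eq0.
Qed.

Lemma stereo_fwdK x : mink x x = R ^+ 2 -> 1 + mink x p / R ^+ 2 != 0 ->
  stereo_inv (stereo_fwd x) = x.
Proof.
move=> xx s0; rewrite /stereo_inv stereo_fwd_gram //.
rewrite [RHS](frame_complete R0 n0 fE x) /stereo_fwd -scalemxAl.
set u := _ *m E; set s := mink x p / R ^+ 2 in s0 *.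
rewrite scalerDr !scalerA; congr (_ *: _ + _).
  field; rewrite s0 /=.
  by have -> : 1 + s + (1 - s) = 2; [ring|rewrite pnatr_eq0].
rewrite -[RHS]scale1r; congr (_ *: _).
field; rewrite s0 /=.
by have -> : 1 + s + (1 - s) = 2; [ring|rewrite pnatr_eq0].
Qed.

Lemma Cinf_stereo_fwd : Cinf [set x | 0 < mink x p] stereo_fwd.
Proof.
have oU := @open_mink_gt0 _ p.
apply: Cinf_scale => // [k|]; last first.
  by do 3!apply: Cinf_mulmxr => //; exact: Cinf_id.
apply: CkV => // [x /= x0|].
  by rewrite gt_eqF // addr_gt0 // divr_gt0 // exprn_gt0.
apply: CkD; [exact: oU|exact: Ck_cst|apply: CkM => //; last exact: Ck_cst].
by apply: Cinf_mink => //; [exact: Cinf_id|move=> ?; exact: Ck_cst].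
Qed.

(** The image of the part [<x, p> > 0] of the hyperboloid: for positive [s = <x, p> / R^2] the
    quotient [(1 - s) / (1 + s)] of [stereo_fwd_gram] lies strictly between -1 and 1. *)
Definition stereo_im := [set y : 'rV[K]_n | -1 < mink y y / R ^+ 2 < 1].

Lemma open_stereo_im : open stereo_im.
Proof.
have c : continuous (fun y : 'rV[K]_n => mink y y / R ^+ 2).
  move=> y; apply: (@Cinf_cont _ _ _ setT) => // k.
  apply: CkM; [exact: openT| |exact: Ck_cst].
  by apply: Cinf_mink; [exact: openT|exact: Cinf_id|exact: Cinf_id].
have -> : stereo_im = (fun y : 'rV[K]_n => mink y y / R ^+ 2) @^-1` `]-1, 1[.
  by apply/seteqP; split=> y /=; rewrite in_itv.
by apply: open_comp => [y _|]; [exact: c|exact: interval_open].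
Qed.

Lemma stereo_im_neq0 y : stereo_im y -> 1 + mink y y / R ^+ 2 != 0.
Proof. by move=> /andP[h _]; rewrite gt_eqF // -ltrBlDl sub0r. Qed.

Lemma Cinf_stereo_inv : Cinf stereo_im stereo_inv.
Proof.
have oU := open_stereo_im.
have mC k : Ck k stereo_im (fun y => mink y y / R ^+ 2).
  by apply: CkM => //; [apply: Cinf_mink => //; exact: Cinf_id|exact: Ck_cst].
apply: Cinf_scale => // [k|].
  apply: CkV => // [x /stereo_im_neq0 //|].
  by apply: CkD => //; exact: Ck_cst.
move=> k; apply: CkD => //.
  apply: Cinf_scale => // [k'|k']; last exact: Ck_cst.
  by apply: CkB => //; exact: Ck_cst.
apply: Cinf_scale => // [k'|]; first exact: Ck_cst.
by apply: Cinf_mulmxr => //; exact: Cinf_id.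
Qed.

End Stereographic.

End Hyperboloid.

(** * Charts, changes of charts and the metric of de Sitter space-time *)

Section Events.
Context {K : realType} {n : nat} {R : K}.
Hypotheses (R0 : 0 < R) (n0 : (0 < n)%N).
Local Notation S := (dS n R).
Local Notation eta N := (@mink_mx K N).

Lemma ev_continuous : continuous (ev : S -> 'rV[K]_n.+1).
Proof. exact: initial_continuous. Qed.

Lemma ev_inj : injective (ev : S -> 'rV[K]_n.+1).
Proof. exact: val_inj. Qed.

(** [S] carries the initial topology of [ev], so continuity into [S] can be tested in Minkowski
    space-time. *)
Lemma continuous_ev (T : topologicalType) (f : T -> S) x :
  {for x, continuous (ev \o f)} -> {for x, continuous f}.
Proof.
move=> c A; rewrite nbhsE => -[B [[A' oA' A'B] Bfx] BA].
have : nbhs (ev (f x)) A'.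
  by apply: open_nbhs_nbhs; split=> //; rewrite -A'B in Bfx.
move=> /c h; change (nbhs x (f @^-1` A)); move: h.
change (nbhs x ((ev \o f) @^-1` A') -> nbhs x (f @^-1` A)).
by apply: filterS => y /= Oy; apply: BA; rewrite -A'B.
Qed.

(* [P] is the junk value off the hyperboloid. *)
Definition mk_event (P : S) (x : 'rV[K]_n.+1) : S :=
  if pselect (dS_set R x) is left h then exist _ x (mem_set h) else P.

Lemma mk_eventE P x : mink x x = R ^+ 2 -> ev (mk_event P x) = x.
Proof. by rewrite /mk_event; case: pselect. Qed.

(** The deck transformations of [pr], indexed by a sign so that results on the hyperboloid
    ([s = false]) and on the quotient (either [s]) have common proofs. *)
Definition flip (s : bool) (x : S) : S := if s then antipode x else x.

Lemma ev_flip s x : ev (flip s x) = (-1) ^+ s *: ev x.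
Proof. by case: s; rewrite /flip /= ?scale1r // scaleN1r. Qed.

Lemma flipK s : involutive (flip s).
Proof. by case: s => x //=; exact: antipodeK. Qed.

Lemma flip_continuous s : continuous (flip s).
Proof.
move=> x; apply: continuous_ev.
rewrite (_ : ev \o flip s = ( *:%R ((-1) ^+ s)) \o ev); last first.
  by apply/funext => y; rewrite /= ev_flip.
by apply: continuous_comp; [exact: ev_continuous|exact: scaler_continuous].
Qed.

Lemma prP (x y : S) : pr x = pr y <-> exists s, y = flip s x.
Proof.
split=> [/eqmodP/orP[/eqP->|/eqP->]|[s ->]].
- by exists false.
- by exists true.
- by apply/eqmodP; case: s; rewrite /= /glued ?eqxx ?orbT.
Qed.

Definition stereo (P : S) (E : 'M[K]_(n, n.+1)) : chart K S n :=
  Chart [set q | 0 < mink (ev q) (ev P)] (stereo_fwd (R := R) (ev P) E \o ev)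
    (mk_event P \o stereo_inv (R := R) (ev P) E).

Lemma open_ev_preimage (O : set 'rV[K]_n.+1) : open O -> open (ev @^-1` O : set S).
Proof. by move=> oO; apply: open_comp => // x _; exact: ev_continuous. Qed.

Lemma stereo_chart P E : frame R (ev P) E -> dS_chart (stereo P E).
Proof.
move=> fE; have oU := @open_mink_gt0 _ _ (ev P).
have s0 (x : S) : 0 < mink (ev x) (ev P) -> 1 + mink (ev x) (ev P) / R ^+ 2 != 0.
  by move=> x0; rewrite gt_eqF // addr_gt0 // divr_gt0 // exprn_gt0.
have imE : chart_im (stereo P E) = stereo_im (n := n) (R := R).
  apply/seteqP; split=> [_ [x /= x0 <-]|y yim].
    rewrite /stereo_im /= (stereo_fwd_gram R0 n0 fE) ?mink_ev //; last exact: s0.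
    set s := mink (ev x) (ev P) / R ^+ 2.
    have s00 : 0 < s by rewrite divr_gt0 // exprn_gt0.
    have s10 : 0 < 1 + s by rewrite addr_gt0.
    by rewrite ltr_pdivrMr // ltr_pdivlMr //; apply/andP; split; lra.
  have y0 := stereo_im_neq0 yim.
  exists (mk_event P (stereo_inv (R := R) (ev P) E y)) => /=.
    rewrite mk_eventE; last exact: stereo_invS.
    rewrite (stereo_inv_p fE) //; move: yim => /andP[y1 y2].
    rewrite mulr_gt0 ?exprn_gt0 // divr_gt0 ?subr_gt0 //.
    by rewrite -ltrBlDl sub0r.
  rewrite mk_eventE; last exact: stereo_invS.
  exact: stereo_invK.
have invE y : stereo_im (R := R) y ->
    ev (chart_inv (stereo P E) y) = stereo_inv (R := R) (ev P) E y.
  move=> /stereo_im_neq0 y0; apply: mk_eventE; exact: (stereo_invS R0 fE).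
have oim := @open_stereo_im K n R.
have invC : Cinf (chart_im (stereo P E)) (ev \o chart_inv (stereo P E)).
  rewrite imE; apply: Cinf_eq (Cinf_stereo_inv (R := R) (ev P) E) => // y /invE.
  by [].
split; [|exact: invC|]; last first.
  move=> x x0; exists [set y | 0 < mink y (ev P)], (stereo_fwd (R := R) (ev P) E).
  by split=> //; exact: Cinf_stereo_fwd.
split.
- exact: (open_ev_preimage oU).
- by rewrite imE.
- move=> x x0; apply: ev_inj; rewrite invE.
    by rewrite /= stereo_fwdK ?mink_ev //; exact: s0.
  by rewrite -imE; exists x.
- move=> x x0; apply: continuous_comp; first exact: ev_continuous.
  exact: Cinf_cont (Cinf_stereo_fwd R0 (ev P) E) x0.
- by move=> y yim; apply: continuous_ev; exact: Cinf_cont invC yim.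
Qed.

Lemma stereo_exists (P : S) : exists2 c, dS_chart c &
  chart_dom c = [set q : S | 0 < mink (ev q) (ev P)].
Proof.
have [E fE] := frame_exists n0 R0 (mink_ev P).
by exists (stereo P E); [exact: stereo_chart|].
Qed.

Lemma mink_ev_gt0 (P : S) : 0 < mink (ev P) (ev P).
Proof. by rewrite mink_ev exprn_gt0. Qed.

Section ChartFacts.
Variables (c : chart K S n).
Hypothesis dc : dS_chart c.

Lemma chart_dom_open : open (chart_dom c). Proof. by case: dc => -[]. Qed.
Lemma chart_im_open : open (chart_im c). Proof. by case: dc => -[]. Qed.
Lemma chart_funK x : chart_dom c x -> chart_inv c (c x) = x.
Proof. by case: dc => -[_ _ h _ _ _ _]; exact: h. Qed.
Lemma chart_imP x : chart_dom c x -> chart_im c (c x). Proof. by exists x. Qed.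
Lemma chart_im_dom y : chart_im c y -> chart_dom c (chart_inv c y).
Proof. by case=> x xc <-; rewrite chart_funK. Qed.
Lemma chart_invK y : chart_im c y -> c (chart_inv c y) = y.
Proof. by case=> x xc <-; rewrite chart_funK. Qed.
Lemma chart_fun_cont x : chart_dom c x -> {for x, continuous c}.
Proof. by case: dc => -[_ _ _ h _ _ _]; exact: h. Qed.
Lemma chart_inv_cont y : chart_im c y -> {for y, continuous (chart_inv c)}.
Proof. by case: dc => -[_ _ _ _ h _ _]; exact: h. Qed.
Lemma chart_inv_Cinf : Cinf (chart_im c) (ev \o chart_inv c).
Proof. by case: dc. Qed.
Lemma chart_ext x : chart_dom c x -> exists U F,
  [/\ open U, U (ev x), Cinf U F &
      forall y, chart_dom c y -> U (ev y) -> F (ev y) = c y].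
Proof. by case: dc => _ _; apply. Qed.

End ChartFacts.

(** Near [flip s x] the chart [b] extends to a smooth map [F] of the ambient space, and
    [ev \o chart_inv c] is smooth into that space; the transition map is [F] after plus or minus the
    latter. *)
Lemma transition c b s x : dS_chart c -> dS_chart b ->
  chart_dom c x -> chart_dom b (flip s x) ->
  exists U, [/\ open U, U (c x),
    forall y, U y -> chart_im c y /\ chart_dom b (flip s (chart_inv c y)) &
    Cinf U (b \o flip s \o chart_inv c)].
Proof.
move=> dc db xc xb; have [A [F [oA Ax FA FE]]] := chart_ext db xb.
have cc : {for c x, continuous (flip s \o chart_inv c)}.
  apply: continuous_comp; last exact: flip_continuous.
  exact: chart_inv_cont dc _ (chart_imP xc).
have E0 : (flip s \o chart_inv c) (c x) = flip s x by rewrite /= chart_funK.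
have : nbhs (c x) [set y | [/\ chart_im c y,
    chart_dom b (flip s (chart_inv c y)) & A (ev (flip s (chart_inv c y)))]].
  have h1 : nbhs (c x) (chart_im c).
    by apply: open_nbhs_nbhs; split; [exact: chart_im_open|exact: chart_imP].
  have h2 : nbhs (c x) ((flip s \o chart_inv c) @^-1` chart_dom b).
    apply: cc; rewrite E0.
    by apply: open_nbhs_nbhs; split; [exact: chart_dom_open|].
  have h3 : nbhs (c x) ((flip s \o chart_inv c) @^-1` (@ev K n R @^-1` A)).
    apply: cc; rewrite E0.
    by apply: open_nbhs_nbhs; split; [exact: open_ev_preimage|].
  by apply: filterS3 h1 h2 h3 => y; split.
rewrite nbhsE => -[U [oU Ux] UA]; exists U; split=> //.
  by move=> y /UA[].
have UF y : U y -> A (((-1) ^+ s *: (ev (chart_inv c y)))).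
  by move=> /UA[_ _]; rewrite ev_flip.
apply: (@Cinf_eq _ _ _ _ (F \o (fun y => (-1) ^+ s *: (ev (chart_inv c y))))) => //.
  by move=> y /UA[yc yb yA] /=; rewrite -ev_flip FE.
apply: Cinf_comp oA _ FA _ => //.
apply: Cinf_scale => // [k|]; first exact: Ck_cst.
by apply: Cinf_sub (chart_inv_Cinf dc) => y /UA[].
Qed.

Lemma chart_inv_differentiable (c : chart K S n) y : dS_chart c -> chart_im c y ->
  differentiable (@ev K n R \o chart_inv c) y.
Proof.
move=> dc yc; apply: Cinf_differentiable yc (chart_inv_Cinf dc).
exact: chart_im_open.
Qed.

Definition chart_jac (c : chart K S n) (x : S) : 'M[K]_(n, n.+1) :=
  jacobian (ev \o chart_inv c) (c x).

(** Differentiate the identity saying that the parametrization by [c] is, up to the sign of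
    [flip s], the parametrization by [b] after the transition map. *)
Lemma chart_jac_transition c b s x : dS_chart c -> dS_chart b ->
  chart_dom c x -> chart_dom b (flip s x) ->
  chart_jac c x = (-1) ^+ s *:
    (jacobian (b \o flip s \o chart_inv c) (c x) *m chart_jac b (flip s x)).
Proof.
move=> dc db xc xb; have [U [oU Ux UP TU]] := transition dc db xc xb.
set T := b \o flip s \o chart_inv c in TU *.
have Tx : T (c x) = b (flip s x) by rewrite /T /= chart_funK.
have dT : differentiable T (c x) by exact: Cinf_differentiable oU Ux TU.
have db' : differentiable (ev \o chart_inv b) (T (c x)).
  by rewrite Tx; apply: chart_inv_differentiable => //; exact: chart_imP.
pose L (z : 'rV[K]_n.+1) := z *m ((-1) ^+ s)%:M.
have dL z : differentiable L z.
  apply: Cinf_differentiable openT I _.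
  by apply: Cinf_mulmxr; [exact: openT|exact: Cinf_id].
have near_E : \forall y \near c x,
    (L \o ((ev \o chart_inv b) \o T)) y = (ev \o chart_inv c) y.
  have : nbhs (c x) U by exact: open_nbhs_nbhs.
  apply: filterS => y /UP[yc yb] /=.
  rewrite /L mul_mx_scalar /T /= chart_funK // ev_flip scalerA.
  by rewrite -expr2 sqrr_sign scale1r.
have dbT : differentiable ((ev \o chart_inv b) \o T) (c x).
  exact: differentiable_comp.
rewrite /chart_jac (near_eq_jacobian near_E); last exact: differentiable_comp.
rewrite jacobian_comp // (jacobian_comp dT) // (jacobian_linear _ _) Tx.
by rewrite mul_mx_scalar.
Qed.

(** The sign in [chart_jac_transition] enters the Gram matrix twice and cancels: the antipodal map
    is an isometry. *)
Lemma metric_transition c b s x : dS_chart c -> dS_chart b ->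
  chart_dom c x -> chart_dom b (flip s x) ->
  let T := jacobian (b \o flip s \o chart_inv c) (c x) in
  dS_metric c x = T *m dS_metric b (flip s x) *m T^T.
Proof.
move=> dc db xc xb T; rewrite /dS_metric -/(chart_jac c x) -/(chart_jac b _).
rewrite (chart_jac_transition dc db xc xb) -/T linearZ /= -!scalemxAl -scalemxAr.
by rewrite scalerA -expr2 sqrr_sign scale1r trmx_mul !mulmxA.
Qed.

(** Differentiate the constant [<x, x> = R^2] along the coordinate directions of the chart. *)
Lemma chart_jac_tangent c x : dS_chart c -> chart_dom c x ->
  chart_jac c x *m eta n.+1 *m (ev x)^T = 0.
Proof.
move=> dc xc; have dx := chart_inv_differentiable dc (chart_imP xc).
apply/row_matrixP => i; rewrite row0 !row_mul rowE mul_jacobian mink_scalar.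
set v := delta_mx 0 i; rewrite -(deriveE _ dx).
have dv := diff_derivable (v := v) dx.
have [_ h] := derive_mink dv dv.
have : 'D_v (fun y => mink ((ev \o chart_inv c) y) ((ev \o chart_inv c) y)) (c x)
    = 0.
  rewrite -[RHS](derive_cst (R ^+ 2) (c x) v); apply: near_eq_derive.
  by apply: (@nearW _ (nbhs (c x))) => y; rewrite mink_ev.
rewrite {}h (minkC _ ('D_v _ _)) /= chart_funK // => /eqP.
by rewrite -mulr2n mulrn_eq0 /= => /eqP ->; rewrite raddf0.
Qed.

(** The rows of the jacobian are tangent, hence combinations of the frame. The matrix [P] of
    coefficients is invertible because the ambient extension [F] of the chart is a left inverse of
    the parametrization, and the chain rule makes [P] a factor of the identity. *)
Lemma chart_jac_frame c x E : dS_chart c -> chart_dom c x ->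
  frame R (ev x) E -> exists2 P, P \in unitmx & chart_jac c x = P *m E.
Proof.
move=> dc xc fE; pose P := chart_jac c x *m eta n.+1 *m E^T *m eta n.
have JE : chart_jac c x = P *m E.
  apply/row_matrixP => i; rewrite [LHS](frame_complete R0 n0 fE).
  have -> : mink (row i (chart_jac c x)) (ev x) = 0.
    have := chart_jac_tangent dc xc => /(congr1 (row i)).
    by rewrite !row_mul mink_scalar row0 => /matrixP/(_ 0 0); rewrite !mxE eqxx.
  by rewrite mul0r scale0r add0r /P !row_mul.
exists P => //.
have [A [F [oA Ax FA FE]]] := chart_ext dc xc.
have dF : differentiable F ((ev \o chart_inv c) (c x)).
  by rewrite /= chart_funK //; exact: Cinf_differentiable oA Ax FA.
have dx := chart_inv_differentiable dc (chart_imP xc).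
have : jacobian id (c x) = jacobian (F \o (ev \o chart_inv c)) (c x).
  apply: near_eq_jacobian; last exact: differentiable_comp.
  have cc : {for c x, continuous (ev \o chart_inv c)}.
    by apply: continuous_comp; [exact: chart_inv_cont (chart_imP xc)|
      exact: ev_continuous].
  have h1 : nbhs (c x) (chart_im c).
    by apply: open_nbhs_nbhs; split; [exact: chart_im_open|exact: chart_imP].
  have h2 : nbhs (c x) ((ev \o chart_inv c) @^-1` A).
    by apply: cc; rewrite /= chart_funK //; exact: open_nbhs_nbhs.
  apply: filterS2 h1 h2 => y yc yA /=.
  by rewrite FE // ?chart_invK //; exact: chart_im_dom.
rewrite jacobian_id jacobian_comp // -/(chart_jac c x) JE -mulmxA => h.
by case: (mulmx1_unit (esym h)).
Qed.

Lemma dS_metric_signature (c : chart K S n) x : dS_chart c -> chart_dom c x ->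
  exists2 P, P \in unitmx & P *m dS_metric c x *m P^T = eta n.
Proof.
move=> dc xc; have [E fE] := frame_exists n0 R0 (mink_ev x).
have [P Pu JP] := chart_jac_frame dc xc fE.
exists (invmx P); first by rewrite unitmx_inv.
rewrite /dS_metric -/(chart_jac c x) JP trmx_mul !mulmxA mulVmx // mul1mx.
rewrite -!mulmxA -trmx_mul mulVmx // trmx1 mulmx1 mulmxA.
by case: fE.
Qed.

Lemma dS_metric_Cinf (c : chart K S n) : dS_chart c ->
  Cinf (chart_im c) (fun y => dS_metric c (chart_inv c y)).
Proof.
move=> dc; have oim := chart_im_open dc.
have JC : Cinf (chart_im c) (fun y => chart_jac c (chart_inv c y)).
  apply/Cinf_mxP => // i j k.
  have /(Ck_mxP _ _ oim) := Ck_derive (v := delta_mx 0 i) (chart_inv_Cinf dc k.+1).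
  move=> /(_ 0 j); apply: Ck_eq => // y yc.
  rewrite /chart_jac chart_invK // derive_mx.
    by rewrite mxE jacobianE //; exact: chart_inv_differentiable.
  by apply: diff_derivable; exact: chart_inv_differentiable.
by apply: Cinf_mulmx => //; [exact: Cinf_mulmxr|exact: Cinf_tr].
Qed.

End Events.

(** * Transfer of the Hausdorff property and of second countability *)

Section Topology.
Context {K : realType}.

Lemma inj_continuous_hausdorff (T T' : topologicalType) (f : T -> T') :
  continuous f -> injective f -> hausdorff_space T' -> hausdorff_space T.
Proof.
move=> fc fi hT' x y xy; apply: fi; apply: hT' => A B /fc fA /fc fB.
by have [z [zA zB]] := xy _ _ fA fB; exists (f z).
Qed.

(** The base consists of the balls with rational centre and radius [1 / (k + 1)]. *)
Lemma matrix_second_countable p q : @second_countable 'M[K]_(p, q).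
Proof.
pose f (u : 'M[rat]_(p, q) * nat) : set 'M[K]_(p, q) :=
  ball (map_mx ratr u.1 : 'M[K]_(p, q)) (u.2.+1%:R^-1).
exists (range f).
  by apply: (card_le_trans (card_image_le f setT)); exact: countableP.
split=> [_ [u _ <-]|x A].
  apply: ball_open; by rewrite invr_gt0.
move=> /nbhs_ballP[e /= e0 eA].
have e20 : 0 < e / 2 by rewrite divr_gt0.
have [k _ ke] : exists2 k : nat, True & k.+1%:R^-1 < e / 2.
  exists (Num.truncn (e / 2)^-1) => //.
  rewrite -[X in _ < X]invrK ltf_pV2 ?posrE ?invr_gt0 //.
  exact: truncnS_gt.
pose r : K := k.+1%:R^-1; have r0 : 0 < r by rewrite invr_gt0.
have h i j : exists t : rat, `|x i j - ratr t| < r.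
  have xr : x i j - r < x i j + r by lra.
  have [t] := rat_in_itvoo xr.
  rewrite in_itv /= => /andP[t1 t2]; exists t.
  by rewrite ltr_norml; apply/andP; split; lra.
pose Q : 'M[rat]_(p, q) := \matrix_(i, j) xchoose (h i j).
have Qx : ball (map_mx ratr Q : 'M[K]_(p, q)) r x.
  split=> // i j; rewrite !mxE -ball_normE /= distrC.
  exact: (xchooseP (h i j)).
exists (ball (map_mx ratr Q : 'M[K]_(p, q)) r) => /=; first by split=> //; exists (Q, k).
move=> y yQ; apply: eA; rewrite (splitr e).
apply: ball_triangle (ball_sym (le_ball (ltW ke) Qx)) (le_ball (ltW ke) yQ).
Qed.

Lemma initial_second_countable (T T' : topologicalType) (f : T -> T') :
  continuous f ->
  (forall x A, nbhs x A -> exists B, [/\ open B, B (f x) & f @^-1` B `<=` A]) ->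
  @second_countable T' -> @second_countable T.
Proof.
move=> fc fo [B cB [Bo Bb]]; exists ((fun A => f @^-1` A) @` B).
  exact: card_le_trans (card_image_le _ _) cB.
split=> [_ [A BA <-]|x A /fo[A' [oA' A'x A'A]]].
  by apply: open_comp => [z _|]; [exact: fc|exact: Bo].
have [U [BU Ux] UA'] := Bb (f x) _ (open_nbhs_nbhs (conj oA' A'x)).
exists (f @^-1` U) => /=; first by split=> //; exists U.
by move=> y /UA'; exact: A'A.
Qed.

Lemma open_image_second_countable (T T' : topologicalType) (f : T -> T') :
  continuous f -> (forall A, open A -> open (f @` A)) ->
  (forall y, exists x, f x = y) ->
  @second_countable T -> @second_countable T'.
Proof.
move=> fc fo fs [B cB [Bo Bb]]; exists ((fun A => f @` A) @` B).
  exact: card_le_trans (card_image_le _ _) cB.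
split=> [_ [A BA <-]|y A yA]; first exact/fo/Bo.
have [x xy] := fs y; rewrite -xy in yA *.
have [U [BU Ux] UA] := Bb x _ (fc x _ yA).
exists (f @` U) => /=; first by split; [exists U|exists x].
by move=> _ [z Uz <-]; exact: UA.
Qed.

End Topology.

(** * The quotient by the antipodal map, its atlas and its metric *)

Section Quotient.
Context {K : realType} {n : nat} {R : K}.
Hypotheses (R0 : 0 < R) (n0 : (0 < n)%N).
Local Notation S := (dS n R).
Local Notation Q := (@dS_quot K n R).
Local Notation eta N := (@mink_mx K N).

Lemma pr_continuous : continuous (pr : S -> Q).
Proof. exact: pi_continuous. Qed.

Lemma pr_surj (z : Q) : exists x, pr x = z.
Proof. by exists (repr z); rewrite /pr reprK. Qed.

Lemma pr_flip s (x : S) : pr (flip s x) = pr x.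
Proof. by apply/esym/prP; exists s. Qed.

Lemma pr_open (A : set S) : open A -> open (pr @` A).
Proof.
move=> oA; change (open (pr @^-1` (pr @` A : set Q))).
have -> : pr @^-1` (pr @` A : set Q) = A `|` flip true @^-1` A.
  apply/seteqP; split=> [x [y Ay /prP[[|] ->]]|x [Ax|Ax]].
  - by right; rewrite /= antipodeK.
  - by left.
  - by exists x.
  - by exists (flip true x) => //; rewrite pr_flip.
by apply: openU => //; apply: open_comp => // x _; exact: flip_continuous.
Qed.

Lemma dS_hausdorff : hausdorff_space S.
Proof.
exact: inj_continuous_hausdorff ev_continuous ev_inj (@norm_hausdorff _ _).
Qed.

Lemma dS_second_countable : @second_countable S.
Proof.
apply: initial_second_countable ev_continuous _ (matrix_second_countable _ _).
move=> x A; rewrite nbhsE => -[B [[A' oA' A'B] Bx] BA].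
by exists A'; split=> //; [rewrite -A'B in Bx|rewrite A'B].
Qed.

(* [x^T x] separates the pairs of antipodal events. *)
Lemma dS_quot_hausdorff : hausdorff_space Q.
Proof.
pose f (z : Q) : 'M[K]_n.+1 := (ev (repr z))^T *m ev (repr z).
have fE x : f (pr x) = (ev x)^T *m ev x.
  rewrite /f; have /esym/prP[s ->] : pr (repr (pr x)) = pr x by rewrite /pr reprK.
  rewrite ev_flip [(_ *: _)^T]linearZ /= -scalemxAl -scalemxAr scalerA -expr2 sqrr_sign.
  by rewrite scale1r.
apply: (@inj_continuous_hausdorff _ _ f); last exact: norm_hausdorff.
  apply/quotient_continuous.
  rewrite (_ : f \o _ = (fun x => x^T *m x) \o ev); last first.
    by apply/funext => x; exact: fE.
  move=> x; apply: continuous_comp; first exact: ev_continuous.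
  apply: (@Cinf_cont _ _ _ setT) => //.
  apply: Cinf_mulmx; [exact: openT| |exact: Cinf_id].
  by apply: Cinf_tr; [exact: openT|exact: Cinf_id].
move=> z w; have [x <-] := pr_surj z; have [y <-] := pr_surj w.
rewrite !fE => xy; apply/prP.
have h : (mink (ev y) (ev x)) *: ev x = R ^+ 2 *: ev y.
  have : ev y *m eta n.+1 *m ((ev x)^T *m ev x) =
      ev y *m eta n.+1 *m ((ev y)^T *m ev y) by rewrite xy.
  by rewrite !mulmxA !mink_scalar !mul_scalar_mx mink_ev.
have R20 : R ^+ 2 != 0 by rewrite expf_neq0 // gt_eqF.
have yx : ev y = (mink (ev y) (ev x) / R ^+ 2) *: ev x.
  by rewrite mulrC -scalerA h scalerA mulVf // scale1r.
set a := _ / _ in yx.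
have : a ^+ 2 = 1.
  have := mink_ev y; rewrite yx minkZl minkZr mink_ev => E.
  by apply: (mulIf R20); rewrite mul1r expr2 -mulrA.
move=> /eqP; rewrite sqrf_eq1 => /orP[]/eqP a1; [exists false|exists true];
  by apply: ev_inj; rewrite ev_flip yx a1.
Qed.

Lemma dS_quot_second_countable : @second_countable Q.
Proof.
exact: open_image_second_countable pr_continuous pr_open pr_surj
  dS_second_countable.
Qed.

(** Smoothness of the two atlases, of [pr] and of its local inverses is reduced to naming the charts
    and the sign [s] for which the map is locally a transition map. *)
Lemma Cinf_transition (A : set 'rV[K]_n) (g : 'rV[K]_n -> 'rV[K]_n) :
  (forall y, A y -> exists c b s (x : S),
    [/\ dS_chart c, dS_chart b, chart_dom c x, chart_dom b (flip s x) &
        y = c x /\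
        \forall y' \near c x, (b \o flip s \o chart_inv c) y' = g y']) ->
  Cinf A g.
Proof.
move=> h; apply: Cinf_local => y /h[c [b [s [x [dc db xc xb [-> E]]]]]].
have [U [oU Ux _ TU]] := transition dc db xc xb.
by exists U, (b \o flip s \o chart_inv c).
Qed.

Lemma near_transition (c b : chart K S n) s x : dS_chart c -> dS_chart b ->
  chart_dom c x -> chart_dom b (flip s x) ->
  \forall y \near c x, chart_im c y /\ chart_dom b (flip s (chart_inv c y)).
Proof.
move=> dc db xc xb; have [U [oU Ux UP _]] := transition dc db xc xb.
have : nbhs (c x) U by exact: open_nbhs_nbhs.
by apply: filterS => y /UP.
Qed.

Lemma transition_differentiable (c b : chart K S n) s x :
  dS_chart c -> dS_chart b -> chart_dom c x -> chart_dom b (flip s x) ->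
  differentiable (b \o flip s \o chart_inv c) (c x).
Proof.
move=> dc db xc xb; have [U [oU Ux UP TU]] := transition dc db xc xb.
exact: Cinf_differentiable oU Ux TU.
Qed.

Lemma dS_smooth : smooth_manifold (dS_manifold n R).
Proof.
split.
- exact: dS_hausdorff.
- exact: dS_second_countable.
- by move=> c [].
- move=> x; have [c dc domc] := stereo_exists R0 n0 x.
  by exists c => //; rewrite domc /=; exact: mink_ev_gt0.
move=> c d dc dd; apply: Cinf_transition => _ [x [xc xd] <-].
exists c, d, false, x; split=> //; split=> //.
exact: (@nearW _ (nbhs (c x))).
Qed.

(** The body of [dS_quot_chart] with its witness exposed, so that the chart [b] upstairs stays
    available. *)
Definition chart_lift (c : chart K Q n) (b : chart K S n) :=
  [/\ dS_chart b,
      forall x y, chart_dom b x -> chart_dom b y -> pr x = pr y -> x = y,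
      chart_dom c = pr @` chart_dom b,
      forall x, chart_dom b x -> c (pr x) = b x &
      forall y, chart_im b y -> chart_inv c y = pr (chart_inv b y)].

Lemma lift_im c b : chart_lift c b -> chart_im c = chart_im b.
Proof.
case=> db _ dom cE _; apply/seteqP; split=> [y [z]|_ [x xb <-]].
  by rewrite dom => -[x xb <-] <-; rewrite cE //; exists x.
by exists (pr x); [rewrite dom; exists x|rewrite cE].
Qed.

Lemma lift_dom c b (x : S) : chart_lift c b -> chart_dom c (pr x) ->
  exists s, chart_dom b (flip s x).
Proof.
by case=> _ _ -> _ _ [y yb /esym/prP[s ys]]; exists s; rewrite -ys.
Qed.

Lemma lift_transition c b s (x : S) : chart_lift c b ->
  chart_dom b (flip s x) -> c (pr x) = b (flip s x).
Proof. by case=> _ _ _ cE _ xb; rewrite -cE // pr_flip. Qed.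

Lemma dS_quot_chart_topological c : dS_quot_chart (n := n) (R := R) c ->
  topological_chart c.
Proof.
move=> [b cb]; have imE := lift_im cb; have [db bi dom cE iE] := cb.
split.
- by rewrite dom; apply: pr_open; exact: chart_dom_open.
- by rewrite imE; exact: chart_im_open.
- move=> z; rewrite dom => -[x xb <-]; rewrite cE // iE; last exact: chart_imP.
  by rewrite chart_funK.
- move=> z; rewrite dom => -[x xb <-] A; rewrite cE // => bA.
  have : nbhs x (chart_dom b `&` b @^-1` A).
    apply: filterI; first by apply: open_nbhs_nbhs; split=> //; exact: chart_dom_open.
    exact: (chart_fun_cont db xb bA).
  rewrite nbhsE => -[B [oB Bx] BA]; change (nbhs (pr x) (c @^-1` A)).
  rewrite nbhsE; exists (pr @` B).
    by split; [exact: pr_open|exists x].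
  by move=> _ [y /BA[yb yA] <-]; rewrite /= cE.
- move=> y; rewrite imE => yb A; rewrite iE // => iA.
  have h1 : nbhs y (chart_im b).
    by apply: open_nbhs_nbhs; split=> //; exact: chart_im_open.
  have h2 : nbhs y ((pr \o chart_inv b) @^-1` A).
    apply: (continuous_comp (chart_inv_cont db yb)) iA; exact: pr_continuous.
  change (nbhs y (chart_inv c @^-1` A)).
  by apply: filterS2 h1 h2 => y' yb' /=; rewrite iE.
Qed.

Lemma dS_quot_chart_exists (P : S) : exists c b, [/\ chart_lift c b,
  dS_quot_chart (n := n) (R := R) c &
  chart_dom b = [set q : S | 0 < mink (ev q) (ev P)]].
Proof.
have [b db domb] := stereo_exists R0 n0 P.
have bi x y : chart_dom b x -> chart_dom b y -> pr x = pr y -> x = y.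
  rewrite domb /= => x0 y0 /prP[[|] E] //; move: y0.
  by rewrite E ev_flip minkZl mulN1r oppr_gt0 ltNge ltW.
(* [repr] picks either event of a pair. When [z] lies in the image of [chart_dom b], one of the two
   is in that domain; for other [z] the value is junk. *)
pose f (z : Q) : 'rV[K]_n :=
  if pselect (chart_dom b (repr z)) then b (repr z) else b (flip true (repr z)).
have fE x : chart_dom b x -> f (pr x) = b x.
  move=> xb; rewrite /f; have : pr (repr (pr x)) = pr x by rewrite /pr reprK.
  case: pselect => [rb|Nrb] /= h; first by rewrite (bi _ _ rb xb h).
  by move: h => /prP[[|] E]; [rewrite [in RHS]E|case: Nrb; rewrite -[repr _]E].
pose c : chart K Q n := Chart (pr @` chart_dom b) f (pr \o chart_inv b).
have cb : chart_lift c b by [].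
by exists c, b; split=> //; exists b.
Qed.

Lemma dS_quot_smooth : smooth_manifold (dS_quot_manifold n R).
Proof.
split.
- exact: dS_quot_hausdorff.
- exact: dS_quot_second_countable.
- exact: dS_quot_chart_topological.
- move=> z; have [x <-] := pr_surj z.
  have [c [b [[_ _ dom _ _] dc domb]]] := dS_quot_chart_exists x.
  by exists c => //; rewrite dom; exists x => //; rewrite domb; exact: mink_ev_gt0.
move=> c d [b cb] [b' db']; apply: Cinf_transition => _ [z [zc zd] <-].
have [db bi dom cE iE] := cb; move: zc zd; rewrite dom => -[x xb <-] xd.
have [s xb'] := lift_dom db' xd; have [db'' _ _ _ _] := db'.
exists b, b', s, x; split=> //; split; first by rewrite cE.
have := near_transition db db'' xb xb'; apply: filterS => y [yb yb'].
by rewrite /= iE // (lift_transition db' yb').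
Qed.

Lemma pr_smooth (U : set S) :
  smooth_map (M := dS_manifold n R) (N := dS_quot_manifold n R) U gluing.
Proof.
split=> [x _|c d dc [b db]]; first exact: pr_continuous.
apply: Cinf_transition => _ [x [[Ux xc] xd] <-].
have [s xb] := lift_dom db xd; have [db' _ _ _ _] := db.
exists c, b, s, x; split=> //; split=> //.
have := near_transition dc db' xc xb; apply: filterS => y [yc yb].
by rewrite /= (lift_transition db yb).
Qed.

(** Without antipodal pairs in [U], the inverse selects the one preimage lying in [U]. In charts it
    is again a transition map up to [flip s]. *)
Lemma pr_diffeo (U : set S) : open U -> (forall x, U x -> ~ U (antipode x)) ->
  diffeo_onto_image (M := dS_manifold n R) (N := dS_quot_manifold n R) U gluing.
Proof.
move=> oU Ua; split=> //; [exact: pr_open|exact: pr_smooth|].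
pose g (z : Q) : S := if pselect (U (repr z)) then repr z else flip true (repr z).
have gE x : U x -> g (pr x) = x.
  move=> Ux; rewrite /g; have : pr (repr (pr x)) = pr x by rewrite /pr reprK.
  case: pselect => [Ur|Nr] /prP[[|] E] //.
    by case: (Ua _ Ur); rewrite -[antipode _]E.
  by case: Nr; rewrite -[repr _]E.
exists g; split=> //; split.
  move=> _ [x Ux <-] A; rewrite gE // => xA.
  have : nbhs x (U `&` A) by apply: filterI => //; exact: open_nbhs_nbhs.
  rewrite nbhsE => -[B [oB Bx] BA].
  change (nbhs (pr x) (g @^-1` A)); rewrite nbhsE; exists (pr @` B).
    by split; [exact: pr_open|exists x].
  by move=> _ [y /BA[Uy Ay] <-]; rewrite /= gE.
move=> c d [b cb] dd; apply: Cinf_transition => _ [z [[[x Ux <-] xc] xd] <-].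
rewrite /= gE // in xd.
have [s xb] := lift_dom cb xc; have [db _ _ _ iE] := cb.
have Fx : flip s (flip s x) = x by rewrite flipK.
(* The lifted chart [b] may contain the antipode of [x] instead of [x]; its base point is therefore
   [flip s x], and the second [flip s] leads back into [U]. *)
exists b, d, s, (flip s x); split=> //; rewrite ?Fx //; split.
  exact: lift_transition.
have xd' : chart_dom d (flip s (flip s x)) by rewrite Fx.
have h1 := near_transition db dd xb xd'.
have h2 : nbhs (b (flip s x)) ((flip s \o chart_inv b) @^-1` U).
  have bx := chart_imP xb.
  apply: (continuous_comp (chart_inv_cont db bx)); first exact: flip_continuous.
  by rewrite /= (chart_funK db) // Fx; exact: open_nbhs_nbhs.
apply: filterS2 h1 h2 => y [yb yd] yU /=.
by rewrite iE // -(pr_flip s) gE.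
Qed.

(** A lift of the chart is selected by choice; by [metric_transition] this has no effect on how the
    metric pulls back. Outside the atlas the value 0 is junk. *)
Definition quot_metric : tensor_field (dS_quot_manifold n R) := fun c z =>
  if pselect (dS_quot_chart c) is left h then
    let b := sval (cid h) in dS_metric b (chart_inv b (c z))
  else 0.

Lemma quot_metric_lift (c : chart K Q n) : dS_quot_chart c ->
  exists b, chart_lift c b /\
    forall z, quot_metric c z = dS_metric b (chart_inv b (c z)).
Proof.
rewrite /quot_metric; case: pselect => // h _.
by exists (sval (cid h)); split=> //; exact: svalP (cid h).
Qed.

Lemma pulls_back_quot_metric :
  pulls_back [set: dS_manifold n R] gluing quot_metric dS_metric.
Proof.
move=> c d x dc dd _ xc xd J.
have [b [db mE]] := quot_metric_lift dd.
have [s xb] := lift_dom db xd; have [db' _ _ _ _] := db.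
have := metric_transition dc db' xc xb => /= ->.
have -> : jacobian (b \o flip s \o chart_inv c) (c x) = J.
  apply/esym/near_eq_jacobian; last exact: transition_differentiable.
  have := near_transition dc db' xc xb; apply: filterS => y [yc yb].
  by rewrite /= (lift_transition db yb).
by rewrite mE (lift_transition db xb) (chart_funK db').
Qed.

Lemma pulls_back_quot_metric_id :
  pulls_back [set: dS_quot_manifold n R] id quot_metric quot_metric.
Proof.
move=> c d z dc dd _ zc zd J.
have [b [cb mE]] := quot_metric_lift dc; have [db _ dom cE iE] := cb.
move: zc zd; rewrite dom => -[x xb xz]; rewrite -xz in J * => xd.
rewrite mE cE // (chart_funK db) //.
have := pulls_back_quot_metric db dd I xb xd => /= ->.
suff -> : jacobian (d \o gluing \o chart_inv b) (b x) = J by [].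
have [b' db'] := dd; have [db'' _ _ _ _] := db'.
have [s xb'] := lift_dom db' xd.
rewrite /J; have -> : c (pr x) = b x by rewrite cE.
have near1 := near_transition db db'' xb xb'.
have D := transition_differentiable db db'' xb xb'.
transitivity (jacobian (b' \o flip s \o chart_inv b) (b x)).
  apply: near_eq_jacobian => //; apply: filterS near1 => y [yb yb'].
  by rewrite /= (lift_transition db' yb').
apply/esym/near_eq_jacobian => //; apply: filterS near1 => y [yb yb'].
by rewrite /= iE // (lift_transition db' yb').
Qed.

Lemma quot_metric_lorentz : lorentz_metric quot_metric.
Proof.
split; first exact: pulls_back_quot_metric_id.
- move=> c dc; have [b [cb mE]] := quot_metric_lift dc.
  have [db _ _ cE iE] := cb; rewrite (lift_im cb).
  apply: Cinf_eq (dS_metric_Cinf db); first exact: chart_im_open.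
  move=> y yb; rewrite (mE (chart_inv c y)) (iE y yb).
  by rewrite (cE _ (chart_im_dom db yb)) (chart_invK db yb).
- move=> c z dc zc; have [b [cb mE]] := quot_metric_lift dc.
  have [db _ dom cE _] := cb; move: zc; rewrite dom => -[x xb <-].
  by rewrite mE cE // chart_funK //; exact: dS_metric_signature.
Qed.

Lemma quot_metric_unique (G : tensor_field (dS_quot_manifold n R)) :
  pulls_back [set: dS_manifold n R] gluing G dS_metric ->
  forall (c : chart K Q n) z, dS_quot_chart c -> chart_dom c z ->
    G c z = quot_metric c z.
Proof.
move=> pG c z dc; have [b cb] := dc; have [db _ dom cE iE] := cb.
rewrite dom => -[x xb <-].
have xc : chart_dom c (pr x) by rewrite dom; exists x.
have := pG b c x db dc I xb xc; rewrite (pulls_back_quot_metric db dc I xb xc) /=.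
suff -> : jacobian (c \o gluing \o chart_inv b) (b x) = 1%:M.
  by rewrite trmx1 !mul1mx !mulmx1.
rewrite -(jacobian_id (b x)); apply: near_eq_jacobian.
  have : nbhs (b x) (chart_im b).
    by apply: open_nbhs_nbhs; split; [exact: chart_im_open|exact: chart_imP].
  apply: filterS => y yb /=.
  by rewrite [c _]cE ?chart_invK //; exact: chart_im_dom.
exact: (Cinf_differentiable openT I (@Cinf_id _ _ _)).
Qed.

Lemma quot_rosenfeld :
  rosenfeld_lobachevsky R (dS_quot_manifold n R) quot_metric.
Proof.
split; [exact: dS_quot_smooth|exact: quot_metric_lorentz|].
exists gluing; split; first exact: pr_surj.
  move=> x y; split=> [/prP[[|] ->]|[->|->]]; [by right|by left|by []|].
  exact/esym/(pr_flip true).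
(* The half-space around [x] is an open neighbourhood without antipodal pairs. *)
move=> x; exists [set q : S | 0 < mink (ev q) (ev x)]; split.
- exact: mink_ev_gt0.
- apply: pr_diffeo; first exact: (open_ev_preimage (@open_mink_gt0 _ _ (ev x))).
  move=> y /= y0; rewrite -[antipode y]/(flip true y) ev_flip minkZl mulN1r.
  by rewrite oppr_gt0 ltNge ltW.
- by move=> c d y dc dd _; exact: pulls_back_quot_metric.
Qed.

End Quotient.

(** * Second derivatives and the linear algebra of the Christoffel equation *)

Section Acceleration.
Context {K : realType}.

Lemma derive1_coord p q (x : K -> 'M[K]_(p, q)) t i j :
  derivable x t 1 -> derive1 (fun s => x s i j) t = 'D_1 x t i j.
Proof. by move=> dx; rewrite derive1E (derive_mx dx) mxE. Qed.

Lemma derive_comp_rV m (f : 'rV[K]_m -> K) (x : K -> 'rV[K]_m) (t : K) :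
  differentiable f (x t) -> derivable x t 1 ->
  is_derive t 1 (f \o x) (\sum_j 'D_1 x t 0 j * 'D_(delta_mx 0 j) f (x t)).
Proof.
move=> df dx; have := is_derive_comp dx df.
by rewrite (diff_rowE _ df).
Qed.

Lemma second_derivative_comp m (A : set 'rV[K]_m) (O : set K)
    (f : 'rV[K]_m -> K) (x : K -> 'rV[K]_m) (t : K) :
  open A -> open O -> Cinf A f -> Cinf O x -> (forall s, O s -> A (x s)) ->
  O t ->
  'D_1 (fun s : K => 'D_1 (f \o x) s) t =
    \sum_j ('D_1 (fun s : K => 'D_1 x s 0 j) t * 'D_(delta_mx 0 j) f (x t) +
      'D_1 x t 0 j * \sum_i 'D_1 x t 0 i *
        'D_(delta_mx 0 i) (fun y => 'D_(delta_mx 0 j) f y) (x t)).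
Proof.
move=> oA oO fA xO xA Ot.
have dx s : O s -> derivable x s 1 by move=> Os; exact: Ck_derivable (xO 1) Os.
have df s : O s -> differentiable f (x s).
  by move=> Os; exact: C1_differentiable oA (xA s Os) (fA 1).
pose F j (s : K) := 'D_1 x s 0 j * 'D_(delta_mx 0 j) f (x s).
have E : \forall s \near t, (\sum_j F j) s = 'D_1 (f \o x) s.
  have : nbhs t O by exact: open_nbhs_nbhs.
  apply: filterS => s Os.
  rewrite (@derive_val _ _ _ _ _ _ _ (derive_comp_rV (df s Os) (dx s Os))).
  by rewrite fct_sumE.
rewrite -(near_eq_derive _ E).
have xj j : Ck 1 O (fun s : K => 'D_1 x s 0 j).
  by have /(Ck_mxP _ _ oO) := Ck_derive (v := 1 : K) (xO 2); apply.
have Fd j : is_derive t (1 : K) (F j)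
    ('D_1 (fun s : K => 'D_1 x s 0 j) t * 'D_(delta_mx 0 j) f (x t) +
      'D_1 x t 0 j * \sum_i 'D_1 x t 0 i *
        'D_(delta_mx 0 i) (fun y => 'D_(delta_mx 0 j) f y) (x t)).
  have h1 : is_derive t (1 : K) (fun s : K => 'D_1 x s 0 j)
      ('D_1 (fun s : K => 'D_1 x s 0 j) t).
    exact/derivableP/(Ck_derivable (xj j) Ot).
  have h2 := derive_comp_rV (C1_differentiable oA (xA t Ot)
    (Ck_derive (v := delta_mx 0 j) (fA 2))) (dx t Ot).
  apply: (@is_derive_eq _ _ _ _ _ _ _ _ (is_deriveM h1 h2)).
  by rewrite /GRing.scale /= addrC mulrC.
by have [_ ->] := is_derive_sum Fd.
Qed.

(** Here [d1] and [d2] stand for the first and second derivatives of the embedding. Of the six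
    products obtained by differentiating the Gram matrix, four cancel by symmetry and two
    coincide. *)
Lemma christoffel_symmetric n N (d1 : 'I_n -> 'rV[K]_N)
    (d2 : 'I_n -> 'I_n -> 'rV[K]_N) (g : K) i j l :
  (forall i j, d2 i j = d2 j i) ->
  2^-1 * (g * (mink (d2 i j) (d1 l) + mink (d1 j) (d2 i l) +
    (mink (d2 j i) (d1 l) + mink (d1 i) (d2 j l)) -
    (mink (d2 l i) (d1 j) + mink (d1 i) (d2 l j)))) = g * mink (d2 i j) (d1 l).
Proof.
move=> sym; rewrite (sym l i) (sym l j) (sym j i) (minkC (d1 j)).
by field.
Qed.

Lemma mink_suml (I : Type) (r : seq I) N (F : I -> 'rV[K]_N) v :
  mink (\sum_(i <- r) F i) v = \sum_(i <- r) mink (F i) v.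
Proof.
elim: r => [|i r IH]; last by rewrite !big_cons minkDl IH.
by rewrite !big_nil /mink !mul0mx mxE.
Qed.

(** With [W] the row of the products [<v, d1 l>], the Christoffel expression at [k] is the entry [k]
    of [W *m invmx gm]; since [gm] is invertible, both vanish together. In the application [v] is
    the acceleration in Minkowski space-time. *)
Lemma christoffel_equation n N (a b : 'I_n -> K) (d1 : 'I_n -> 'rV[K]_N)
    (d2 : 'I_n -> 'I_n -> 'rV[K]_N) (gm : 'M[K]_n)
    (G : 'I_n -> 'I_n -> 'I_n -> K) (v : 'rV[K]_N) :
  (forall i j, gm i j = mink (d1 i) (d1 j)) -> gm \in unitmx ->
  (forall k i j, G k i j = \sum_l invmx gm k l * mink (d2 i j) (d1 l)) ->
  v = \sum_j a j *: d1 j + \sum_j \sum_i (b j * b i) *: d2 i j ->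
  (forall k, a k + \sum_i \sum_j G k i j * b i * b j = 0) <->
  (forall l, mink v (d1 l) = 0).
Proof.
move=> gmE gu GE vE.
have wE l : mink v (d1 l) = \sum_k a k * gm k l +
    \sum_j \sum_i b j * b i * mink (d2 i j) (d1 l).
  rewrite vE minkDl !mink_suml; congr (_ + _); apply: eq_bigr => j _.
    by rewrite minkZl gmE.
  by rewrite mink_suml; apply: eq_bigr => i _; rewrite minkZl.
pose W : 'rV[K]_n := \row_l mink v (d1 l).
have gmT : gm^T = gm by apply/matrixP => i j; rewrite mxE !gmE minkC.
have step k : a k + \sum_i \sum_j G k i j * b i * b j = (W *m invmx gm) 0 k.
  pose A : 'rV[K]_n := \row_k a k.
  pose B : 'rV[K]_n := \row_l \sum_j \sum_i b j * b i * mink (d2 i j) (d1 l).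
  have -> : W = A *m gm + B.
    apply/rowP => l; rewrite !mxE wE; congr (_ + _).
    by apply: eq_bigr => j _; rewrite mxE.
  rewrite mulmxDl mulmxK // !mxE; congr (_ + _).
  have giT : (invmx gm)^T = invmx gm by rewrite trmx_inv gmT.
  transitivity (\sum_i \sum_j \sum_l
      invmx gm k l * mink (d2 i j) (d1 l) * b i * b j).
    apply: eq_bigr => i _; apply: eq_bigr => j _.
    by rewrite GE !mulr_suml.
  transitivity (\sum_i \sum_l \sum_j
      invmx gm k l * mink (d2 i j) (d1 l) * b i * b j).
    by apply: eq_bigr => i _; rewrite exchange_big.
  rewrite exchange_big /=; apply: eq_bigr => l _.
  rewrite mxE mulr_suml exchange_big; apply: eq_bigr => j _ /=.
  rewrite mulr_suml; apply: eq_bigr => i _.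
  have -> : invmx gm l k = invmx gm k l by rewrite -{1}giT mxE.
  by ring.
split=> [h l|h k]; last first.
  rewrite step; have -> : W = 0 by apply/rowP => l; rewrite !mxE h.
  by rewrite mul0mx mxE.
have : W *m invmx gm = 0 by apply/rowP => k; rewrite -step h mxE.
move=> /(congr1 (mulmx^~ gm)); rewrite mulmxKV // mul0mx => /rowP/(_ l).
by rewrite !mxE.
Qed.

(** The rows of [P *m E] span the tangent space at [p]; by [frame_complete] a vector orthogonal to
    all of them has only its component along [p]. *)
Lemma orth_frame_rowsP (R : K) n (p v : 'rV[K]_n.+1) E (P : 'M[K]_n) :
  0 < R -> (0 < n)%N -> frame R p E -> P \in unitmx ->
  (forall l, mink v (row l (P *m E)) = 0) <-> v = (mink v p / R ^+ 2) *: p.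
Proof.
move=> R0 n0 fE Pu; split=> [h|-> l]; last first.
  by rewrite minkZl (minkC p) row_mul (frame_orth fE) mulr0.
rewrite {1}(frame_complete R0 n0 fE v).
have h0 : v *m @mink_mx K n.+1 *m E^T *m P^T = 0.
  apply/rowP => l; rewrite -mulmxA -trmx_mul mink_gram row_id mxE.
  exact: h.
have -> : v *m @mink_mx K n.+1 *m E^T = 0.
  have PTu : P^T \in unitmx by rewrite unitmx_tr.
  by rewrite -[LHS](mulmxK PTu) h0 mul0mx.
by rewrite !mul0mx addr0.
Qed.

End Acceleration.

(** * Geodesics as curves in Minkowski space-time with normal acceleration *)

Section Geodesics.
Context {K : realType} {n : nat} {R : K}.
Hypotheses (R0 : 0 < R) (n0 : (0 < n)%N).
Local Notation S := (dS n R).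
Local Notation eta N := (@mink_mx K N).

Definition acceleration (u : K -> 'rV[K]_n.+1) (t : K) : 'rV[K]_n.+1 :=
  'D_1 (fun s : K => 'D_1 u s) t.

Section InChart.
Variables (c : chart K S n) (gamma : K -> S) (t : K).
Hypotheses (dc : dS_chart c) (gc : continuous gamma)
  (xC : Cinf (gamma @^-1` chart_dom c) (c \o gamma))
  (tc : chart_dom c (gamma t)).

Let O := gamma @^-1` chart_dom c.
Let phi := @ev K n R \o chart_inv c.
Let x := c \o gamma.
Let u := @ev K n R \o gamma.
Let e (i : 'I_n) : 'rV[K]_n := delta_mx 0 i.
Let d1 j := 'D_(e j) phi (x t).
Let d2 i j := 'D_(e i) (fun y => 'D_(e j) phi y) (x t).
Let b j := 'D_1 x t 0 j.
Let a j := 'D_1 (fun s : K => 'D_1 x s 0 j) t.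

Lemma curve_dom_open : open O.
Proof. by apply: open_comp => [s _|]; [exact: gc|exact: chart_dom_open]. Qed.

Let xA s : O s -> chart_im c (x s). Proof. exact: chart_imP. Qed.

Let phiC : Cinf (chart_im c) phi. Proof. exact: chart_inv_Cinf. Qed.

Lemma curve_in_chart_Cinf : Cinf O u.
Proof.
apply: (@Cinf_eq _ _ _ _ (phi \o x)).
- exact: curve_dom_open.
- by move=> s Os; rewrite /phi /x /= (chart_funK dc).
apply: Cinf_comp _ _ xA phiC xC; first exact: curve_dom_open.
exact: chart_im_open.
Qed.

Let uE : \forall s \near t, (phi \o x) s = u s.
Proof.
have : nbhs t O by apply: open_nbhs_nbhs; split=> //; exact: curve_dom_open.
by apply: filterS => s Os; rewrite /phi /x /= (chart_funK dc).
Qed.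

Lemma acceleration_in_chart : acceleration u t =
  \sum_j a j *: d1 j + \sum_j \sum_i (b j * b i) *: d2 i j.
Proof.
have oO := curve_dom_open; have oA := chart_im_open dc.
have uC := curve_in_chart_Cinf.
apply/rowP => k.
have phik : Cinf (chart_im c) (fun y => phi y 0 k).
  by have /(Cinf_mxP _ oA) := phiC; apply.
have := second_derivative_comp oA oO phik xC xA tc.
have -> : 'D_1 (fun s : K => 'D_1 ((fun y => phi y 0 k) \o x) s) t =
    acceleration u t 0 k.
  rewrite /acceleration derive_mx; last first.
    exact: Ck_derivable (Ck_derive (uC 2)) tc.
  rewrite mxE; apply: near_eq_derive.
  have : \forall s \near t, O s by exact: open_nbhs_nbhs.
  move=> h; have uE' := near_join uE; apply: filterS2 h uE' => s Os us.
  rewrite derive_mx ?mxE; last exact: Ck_derivable (uC 1) Os.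
  by apply: near_eq_derive; apply: filterS us => s' <-.
move=> ->; have dphi y : chart_im c y -> forall v, derivable phi y v.
  by move=> yc v; exact: Ck_derivable (phiC 1) yc.
have dphi2 j v : derivable (fun y => 'D_(e j) phi y) (x t) v.
  exact: Ck_derivable (Ck_derive (phiC 2)) (xA tc).
have d1k j : 'D_(e j) (fun y => phi y 0 k) (x t) = d1 j 0 k.
  by rewrite /d1 derive_mx ?mxE //; exact: dphi (xA tc) _.
have d2k i j : 'D_(e i) (fun y => 'D_(e j) (fun y => phi y 0 k) y) (x t) =
    d2 i j 0 k.
  rewrite /d2 derive_mx ?mxE //; apply: near_eq_derive.
  have : nbhs (x t) (chart_im c)
    by apply: open_nbhs_nbhs; split; [exact: chart_im_open|exact: xA].
  by apply: filterS => y yc; rewrite derive_mx ?mxE //; exact: dphi.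
rewrite big_split mxE !summxE; congr (_ + _); apply: eq_bigr => j _.
  by rewrite mxE /= d1k.
rewrite summxE mulr_sumr; apply: eq_bigr => i _.
by rewrite mxE /= d2k mulrA.
Qed.

Lemma chart_second_derivative_sym i j : d2 i j = d2 j i.
Proof.
apply/rowP => k; have oA := chart_im_open dc.
have dphi2 l v : derivable (fun y => 'D_(e l) phi y) (x t) v.
  exact: Ck_derivable (Ck_derive (phiC 2)) (xA tc).
have d2k l m : d2 l m 0 k =
    'D_(e l) (fun y => 'D_(e m) (fun y => phi y 0 k) y) (x t).
  rewrite /d2 derive_mx ?mxE //; apply/esym/near_eq_derive.
  have : nbhs (x t) (chart_im c)
    by apply: open_nbhs_nbhs; split; [exact: chart_im_open|exact: xA].
  apply: filterS => y yc; rewrite derive_mx ?mxE //.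
  exact: Ck_derivable (phiC 1) yc.
have phik : Ck 2 (chart_im c) (fun y => phi y 0 k).
  by have /(Cinf_mxP _ oA) := phiC; apply.
have := derive_sym (e i) (e j) oA (xA tc) phik.
by rewrite -(d2k i j) -(d2k j i).
Qed.

Let metric_entry y : chart_im c y -> forall i j,
  dS_metric c (chart_inv c y) i j = mink ('D_(e i) phi y) ('D_(e j) phi y).
Proof.
move=> yc i j; rewrite /dS_metric mink_gram (chart_invK dc yc).
have dy := chart_inv_differentiable dc yc.
by rewrite !rowE !mul_jacobian -!(deriveE _ dy).
Qed.

Let gm := dS_metric c (gamma t).

Let gmE i j : gm i j = mink (d1 i) (d1 j).
Proof. by have := metric_entry (xA tc) i j; rewrite /x /= (chart_funK dc). Qed.

Lemma christoffel_in_chart k i j : christoffel dS_metric c k i j (x t) =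
  \sum_l invmx gm k l * mink (d2 i j) (d1 l).
Proof.
have partial i' j' l : 'D_(e i') (fun y => dS_metric c (chart_inv c y) j' l)
    (x t) = mink (d2 i' j') (d1 l) + mink (d1 j') (d2 i' l).
  have dd m : derivable (fun y => 'D_(e m) phi y) (x t) (e i').
    exact: Ck_derivable (Ck_derive (phiC 2)) (xA tc).
  have [_ <-] := derive_mink (dd j') (dd l).
  apply: near_eq_derive.
  have : nbhs (x t) (chart_im c)
    by apply: open_nbhs_nbhs; split; [exact: chart_im_open|exact: xA].
  by apply: filterS => y yc; exact: metric_entry.
rewrite /christoffel mulr_sumr; apply: eq_bigr => l _.
rewrite !partial /gm {1}/x /= (chart_funK dc) //.
apply: christoffel_symmetric; exact: chart_second_derivative_sym.
Qed.

Lemma geodesic_in_chartP :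
  (forall k, a k + \sum_i \sum_j christoffel dS_metric c k i j (x t) *
     b i * b j = 0) <->
  acceleration u t = (mink (acceleration u t) (u t) / R ^+ 2) *: u t.
Proof.
have [E fE] := frame_exists n0 R0 (mink_ev (gamma t)).
have [P Pu JP] := chart_jac_frame R0 n0 dc tc fE.
have dx := chart_inv_differentiable dc (xA tc).
have d1E j : d1 j = row j (P *m E).
  by rewrite -JP rowE mul_jacobian -(deriveE _ dx).
have gu : gm \in unitmx.
  have [P' P'u PgP] := dS_metric_signature R0 n0 dc tc.
  have : P' *m gm *m P'^T \in unitmx.
    by rewrite PgP; apply: (mulmx1_unit (mink_mx_sqr n)).1.
  by rewrite !unitmx_mul unitmx_tr P'u andbT.
have h1 := christoffel_equation gmE gu christoffel_in_chart
  acceleration_in_chart.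
apply: (iff_trans h1); have h2 := orth_frame_rowsP (acceleration u t) R0 n0 fE Pu.
by apply: iff_trans h2; split=> h l; have := h l; rewrite d1E.
Qed.

Lemma derive1_chart_coord :
  (forall k, derive1n 2 (fun s => c (gamma s) 0 k) t = a k) /\
  (forall k, derive1 (fun s => c (gamma s) 0 k) t = b k).
Proof.
change ((forall k, derive1n 2 (fun s => x s 0 k) t = a k) /\
  (forall k, derive1 (fun s => x s 0 k) t = b k)).
have dx s : O s -> derivable x s 1 by move=> Os; exact: Ck_derivable (xC 1) Os.
split=> k; last by rewrite derive1_coord //; exact: dx.
rewrite derive1nS derive1n1 derive1E; apply: near_eq_derive.
have : nbhs t O by apply: open_nbhs_nbhs; split=> //; exact: curve_dom_open.
by apply: filterS => s Os; rewrite derive1_coord //; exact: dx.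
Qed.

End InChart.

(** This removes charts from the rest of the argument. Smoothness passes to the ambient curve
    through the inverses of charts, and back through the ambient extensions of charts. *)
Lemma complete_geodesicP (gamma : K -> S) :
  complete_geodesic (M := dS_manifold n R) dS_metric gamma <->
  continuous gamma /\ Cinf setT (ev \o gamma) /\
  forall t, acceleration (ev \o gamma) t =
    (mink (acceleration (ev \o gamma) t) (ev (gamma t)) / R ^+ 2) *:
      ev (gamma t).
Proof.
split=> [[gc gC geq]|[gc [uC ueq]]].
  have h t : exists2 c : chart K S n, dS_chart c & chart_dom c (gamma t).
    have [c dc domc] := stereo_exists R0 n0 (gamma t).
    by exists c => //; rewrite domc; exact: mink_ev_gt0.
  split=> //; split=> [|t].
    apply: Cinf_local => t _; have [c dc tc] := h t.
    exists (gamma @^-1` chart_dom c), (ev \o gamma); split=> //.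
      exact: curve_in_chart_Cinf dc gc (gC c dc).
    exact: (@nearW _ (nbhs t)).
  have [c dc tc] := h t; apply/(geodesic_in_chartP dc gc (gC c dc) tc) => k.
  have [h1 h2] := derive1_chart_coord dc gc (gC c dc) tc.
  have /= E := geq c t k dc tc.
  change (derive1n 2 (fun s => c (gamma s) 0 k) t + \sum_i \sum_j
    christoffel (M := dS_manifold n R) dS_metric c k i j (c (gamma t)) *
    derive1 (fun s => c (gamma s) 0 i) t *
    derive1 (fun s => c (gamma s) 0 j) t = 0) in E.
  rewrite h1 in E; rewrite -[RHS]E; congr (_ + _).
  by apply: eq_bigr => i _; apply: eq_bigr => j _; rewrite !h2.
have gC (c : chart K S n) : dS_chart c ->
    Cinf (gamma @^-1` chart_dom c) (c \o gamma).
  move=> dc; apply: Cinf_local => t tc.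
  have [A [F [oA At FA FE]]] := chart_ext dc tc.
  pose U := gamma @^-1` (@ev K n R @^-1` A).
  have oU : open U.
    by apply: open_comp => [s _|]; [exact: gc|exact: open_ev_preimage].
  exists U, (F \o (ev \o gamma)); split=> //.
    apply: Cinf_comp oU oA _ FA _ => //.
    by apply: Cinf_sub uC.
  have h1 : nbhs t U by exact: open_nbhs_nbhs.
  have h2 : nbhs t (gamma @^-1` chart_dom c).
    by apply: open_nbhs_nbhs; split=> //; exact: curve_dom_open.
  by apply: filterS2 h1 h2 => s sU sc; rewrite /= FE.
split=> // c t k dc tc.
have [h1 h2] := derive1_chart_coord dc gc (gC c dc) tc.
have E := (geodesic_in_chartP dc gc (gC c dc) tc).2 (ueq t) k.
change (derive1n 2 (fun s => c (gamma s) 0 k) t + \sum_i \sum_j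
    christoffel (M := dS_manifold n R) dS_metric c k i j (c (gamma t)) *
    derive1 (fun s => c (gamma s) 0 i) t *
    derive1 (fun s => c (gamma s) 0 j) t = 0).
rewrite h1 -[RHS]E; congr (_ + _).
by apply: eq_bigr => i _; apply: eq_bigr => j _; rewrite !h2.
Qed.

End Geodesics.

(** * Time-like geodesics as branches of hyperbolas *)

Section TimelikeLines.
Context {K : realType} {n : nat} {R : K}.
Hypotheses (R0 : 0 < R) (n0 : (0 < n)%N).
Local Notation S := (dS n R).

(** The normalization [2 <a, b> = R^2] puts every [E a + E^-1 b] on the hyperboloid. *)
Definition null_pair (a b : 'rV[K]_n.+1) :=
  [/\ mink a a = 0, mink b b = 0 & 2 * mink a b = R ^+ 2].

Definition line_set (a b : 'rV[K]_n.+1) : set S :=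
  [set q | exists2 E, 0 < E & ev q = E *: a + E^-1 *: b].

Definition halfspace (a : 'rV[K]_n.+1) : set S := [set q | 0 < mink (ev q) a].

Lemma null_pairC a b : null_pair a b -> null_pair b a.
Proof. by case=> aa bb ab; split=> //; rewrite minkC. Qed.

Lemma null_pairN a b : null_pair a b -> null_pair (- a) (- b).
Proof.
by case=> aa bb ab; rewrite -(scaleN1r a) -(scaleN1r b); split;
  rewrite minkZl minkZr mulN1r mulN1r opprK.
Qed.

Lemma line_setC a b : line_set a b = line_set b a.
Proof.
by apply/seteqP; split=> q [E E0 qE]; exists E^-1;
  rewrite ?invr_gt0 // invrK addrC.
Qed.

Lemma antipode_line a b : antipode @` line_set a b = line_set (- a) (- b).
Proof.
apply/seteqP; split=> [_ [q [E E0 qE] <-]|q [E E0 qE]].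
  exists E => //; have := ev_flip true q; rewrite /= => ->.
  by rewrite qE expr1 scaleN1r opprD !scalerN.
exists (antipode q); last exact: antipodeK.
exists E => //; have := ev_flip true q; rewrite /= => ->.
by rewrite qE expr1 scaleN1r !scalerN opprD !opprK.
Qed.

(** The combinations [y + w x] and [y - w x] solve [z' = w z] and [z' = - w z]; multiplying each by
    the opposite exponential gives a constant. *)
Lemma exp_solution (x y : K -> K) (w : K) : w != 0 ->
  (forall t : K, is_derive t 1 x (y t)) ->
  (forall t : K, is_derive t 1 y (w ^+ 2 * x t)) ->
  forall t, x t = expR (w * t) * (2^-1 * (x 0 + w^-1 * y 0)) +
    (expR (w * t))^-1 * (2^-1 * (x 0 - w^-1 * y 0)).
Proof.
move=> w0 dx dy t.
have dexp (c s : K) : is_derive s 1 (fun r : K => expR (c * r)) (c * expR (c * s)).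
  have h : is_derive s (1 : K) (fun r : K => c * r) c.
    by apply: is_derive_eq; rewrite /GRing.scale /= mulr1.
  apply: (@is_derive_eq _ _ _ _ _ _ _ _ (is_derive1_comp (is_derive_expR _) h)).
  by rewrite /GRing.scale /= mulrC.
have cst c (z : K -> K) : (forall s : K, is_derive s 1 z (c * z s)) ->
    z t = expR (c * t) * z 0.
  move=> dz; have dh s : is_derive s (1 : K)
      (fun r : K => expR (- c * r) * z r) 0.
    apply: (@is_derive_eq _ _ _ _ _ _ _ _ (is_deriveM (dexp (- c) s) (dz s))).
    by rewrite /GRing.scale /=; ring.
  have := is_derive_0_is_cst t 0 dh; rewrite mulr0 expR0 mul1r => <-.
  by rewrite mulrA -expRD mulNr subrr expR0 mul1r.
have p : y t + w * x t = expR (w * t) * (y 0 + w * x 0).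
  apply: (cst w (fun s => y s + w * x s)) => s.
  have h : is_derive s (1 : K) (fun r => w * x r) (w * y s).
    by have := is_deriveZ w (dx s).
  apply: (@is_derive_eq _ _ _ _ _ _ _ _ (is_deriveD (dy s) h)); ring.
have m : y t - w * x t = (expR (w * t))^-1 * (y 0 - w * x 0).
  rewrite -expRN -[- (w * t)]mulNr.
  apply: (cst (- w) (fun s => y s - w * x s)) => s.
  have h : is_derive s (1 : K) (fun r => w * x r) (w * y s).
    by have := is_deriveZ w (dx s).
  apply: (@is_derive_eq _ _ _ _ _ _ _ _ (is_deriveB (dy s) h)); ring.
have e0 : expR (w * t) != 0 by rewrite gt_eqF // expR_gt0.
have : 2 * w * x t = expR (w * t) * (y 0 + w * x 0) -
    (expR (w * t))^-1 * (y 0 - w * x 0) by rewrite -p -m; ring.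
move=> h; have -> : x t = (2 * w)^-1 * (2 * w * x t).
  by rewrite mulKf // mulf_neq0 // pnatr_eq0.
by rewrite h; field; rewrite e0 w0.
Qed.

Lemma null_pair_of_orthogonal (x y : 'rV[K]_n.+1) :
  mink x x = R ^+ 2 -> mink x y = 0 -> mink y y = - R ^+ 2 ->
  null_pair (2^-1 *: (x + y)) (2^-1 *: (x - y)).
Proof.
move=> xx xy yy; rewrite -(scaleN1r y) /null_pair.
rewrite !(minkZl, minkZr, minkDl, minkDr) xx yy (minkC y) xy.
by split; field.
Qed.

(** Differentiating [<u, u> = R^2] twice gives [<u, v> = 0] and [<u, v'> = - <v, v>]. Since [v'] is
    a multiple of [u], it is orthogonal to [v], so [<v, v>] is constant and [u'' = w^2 u] has
    constant coefficients. *)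
Lemma timelike_geodesic_line (gamma : K -> S) : timelike_geodesic gamma ->
  exists a b, null_pair a b /\ range gamma = line_set a b.
Proof.
move=> [/(complete_geodesicP R0 n0)[gc [uC ueq]] tl].
pose u := @ev K n R \o gamma; pose v (t : K) := 'D_1 u t.
have du t : derivable u t 1 by exact: Ck_derivable (uC 1) I.
have dv t : derivable v t 1 by exact: Ck_derivable (Ck_derive (uC 2)) I.
have uu t : mink (u t) (u t) = R ^+ 2 by exact: mink_ev.
have uv t : mink (u t) (v t) = 0.
  have := @derive_val _ _ _ _ _ _ _ (derive_mink (du t) (du t)).
  rewrite (_ : (fun y => mink (u y) (u y)) = cst (R ^+ 2)); last first.
    exact/funext.
  by rewrite derive_cst -/(v t) (minkC (v t)) => h; lra.
have ua t : mink (u t) ('D_1 v t) = - mink (v t) (v t).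
  have := @derive_val _ _ _ _ _ _ _ (derive_mink (du t) (dv t)).
  rewrite (_ : (fun y => mink (u y) (v y)) = cst 0); last exact/funext.
  by rewrite derive_cst -/(v t) => h; lra.
have aE t : 'D_1 v t = (mink ('D_1 v t) (u t) / R ^+ 2) *: u t by exact: ueq.
have vv t : mink (v t) (v t) = mink (v 0) (v 0).
  have d s : is_derive s (1 : K) (fun s => mink (v s) (v s)) 0.
    apply: (@is_derive_eq _ _ _ _ _ _ _ _ (derive_mink (dv s) (dv s))).
    by rewrite (minkC ('D_1 v s)) aE minkZr (minkC (v s)) uv mulr0 addr0.
  exact: is_derive_0_is_cst t 0 d.
have v0 : mink (v 0) (v 0) < 0.
  by have [_ _] := tl 0; rewrite /velocity derive1E.
(* The value with [w^2 = - <v, v> / R^2], real and nonzero because the velocity is time-like;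
   [w^-1 v 0] then has square [- R^2]. *)
pose w := Num.sqrt (- mink (v 0) (v 0)) / R.
have w0 : w != 0 by rewrite gt_eqF // divr_gt0 // sqrtr_gt0 oppr_gt0.
have R20 : R ^+ 2 != 0 by rewrite expf_neq0 // gt_eqF.
have w2 : w ^+ 2 = - mink (v 0) (v 0) / R ^+ 2.
  by rewrite expr_div_n sqr_sqrtr // oppr_ge0 ltW.
have vvw : mink (v 0) (v 0) = - (w ^+ 2 * R ^+ 2) by rewrite w2; field; rewrite -sqrf_eq0.
have aw t : 'D_1 v t = w ^+ 2 *: u t.
  by rewrite aE minkC ua vv w2.
pose a := 2^-1 *: (u 0 + w^-1 *: v 0); pose b := 2^-1 *: (u 0 - w^-1 *: v 0).
have uE t : u t = expR (w * t) *: a + (expR (w * t))^-1 *: b.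
  apply/rowP => i; rewrite !mxE.
  apply: (exp_solution (x := fun t => u t 0 i) (y := fun t => v t 0 i) w0) => s.
    rewrite /v (derive_mx (du s)) mxE; apply: derivableP.
    by have /derivable_mxP := du s; apply.
  have -> : w ^+ 2 * u s 0 i = 'D_1 v s 0 i by rewrite aw mxE.
  rewrite (derive_mx (dv s)) mxE; apply: derivableP.
  by have /derivable_mxP := dv s; apply.
exists a, b; split.
  apply: null_pair_of_orthogonal => //; first by rewrite minkZr uv mulr0.
  by rewrite minkZl minkZr vvw; field.
apply/seteqP; split=> [_ [t _ <-]|q [E E0 qE]].
  by exists (expR (w * t)); [exact: expR_gt0|exact: uE].
exists (ln E / w) => //; apply: ev_inj; rewrite -[LHS]/(u _) uE qE.
by rewrite mulrC divfK // lnK.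
Qed.

End TimelikeLines.

(** * Time cones, and the boundaries of the half-spaces *)

Section TimeSign.
Context {K : realType} {n : nat} {R : K}.
Hypothesis R0 : 0 < R.
Local Notation S := (dS n R).
Local Notation "u '^t'" := (u 0 ord_max) (at level 2, format "u '^t'").

(** The combination [w] of [u] and [v] has no time component, so [<w, w>] is nonnegative; expanding
    it gives the bound without square roots. Thus non-space-like vectors have a product of sign
    opposite to that of [u_t v_t]. *)
Lemma mink_time_sign (u v : 'rV[K]_n.+1) : mink u u <= 0 -> mink v v <= 0 ->
  u^t * v^t * mink u v <= 0.
Proof.
move=> uu vv; pose w := v^t *: u + (- u^t) *: v.
have w0 : w^t = 0 by rewrite !mxE; ring.
have ww : 0 <= mink w w.
  by rewrite mink_split w0 mul0r subr0 sumr_ge0 // => i _; rewrite -expr2 sqr_ge0.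
have h1 : v^t ^+ 2 * mink u u <= 0 by rewrite mulr_ge0_le0 // sqr_ge0.
have h2 : u^t ^+ 2 * mink v v <= 0 by rewrite mulr_ge0_le0 // sqr_ge0.
have : mink w w = v^t ^+ 2 * mink u u - 2 * (u^t * v^t * mink u v) +
    u^t ^+ 2 * mink v v.
  by rewrite /w !(minkDl, minkZl, minkDr, minkZr) (minkC v u); ring.
by move=> h; rewrite h in ww; lra.
Qed.

Lemma null_time_neq0 (u : 'rV[K]_n.+1) : u != 0 -> mink u u = 0 -> u^t != 0.
Proof.
by move=> u0 uu; apply: contraNneq u0 => ut; apply/eqP/mink_space_eq0.
Qed.

Lemma null_pair_neq0 (a b : 'rV[K]_n.+1) : null_pair (R := R) a b -> a != 0.
Proof.
move=> [_ _ ab]; apply/eqP => a0; move: ab.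
rewrite a0 /mink !mul0mx mxE mulr0 => /esym/eqP.
by rewrite sqrf_eq0 gt_eqF.
Qed.

(** A positive [<a, b>] forces two null vectors into opposite time cones. *)
Lemma null_pair_time (a b : 'rV[K]_n.+1) : null_pair (R := R) a b -> a^t * b^t < 0.
Proof.
move=> h; have [aa bb ab] := h.
have ab0 : 0 < mink a b by have := exprn_gt0 2 R0; rewrite -ab; lra.
have := @mink_time_sign a b; rewrite aa bb lexx => /(_ isT isT).
rewrite pmulr_lle0 // le_eqVlt mulf_eq0.
rewrite (negbTE (null_time_neq0 (null_pair_neq0 h) aa)).
by rewrite (negbTE (null_time_neq0 (null_pair_neq0 (null_pairC h)) bb)).
Qed.

Lemma halfspace_open (a : 'rV[K]_n.+1) : open (halfspace a : set S).
Proof. exact: (open_ev_preimage (open_mink_gt0 (p := a))). Qed.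

Lemma boundary_halfspace (a b : 'rV[K]_n.+1) : null_pair (R := R) a b ->
  boundary (halfspace a) = [set q : S | mink (ev q) a = 0].
Proof.
move=> [aa bb ab]; rewrite /boundary.
have /interior_id -> := halfspace_open a.
have Hn (q : S) : halfspace (- a) q <-> mink (ev q) a < 0.
  by rewrite /halfspace /= -scaleN1r minkZr mulN1r oppr_gt0.
apply/seteqP; split=> q /=.
  move=> [qc /negP]; rewrite -leNgt le_eqVlt => /orP[/eqP //|/Hn qn].
  have [x [xa /Hn xn]] := qc _ (open_nbhs_nbhs (conj (halfspace_open (- a)) qn)).
  by move: xn; rewrite /halfspace /= in xa *; rewrite ltNge ltW.
move=> qa; split; last by rewrite /halfspace /= qa ltxx.
(* [q + e b], rescaled to lie on the hyperboloid, is in the half-space. *)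
pose N e := R ^+ 2 + 2 * e * mink (ev q) b.
pose x e := (R / Num.sqrt (N e)) *: (ev q + e *: b).
have xx e : 0 < N e -> mink (x e) (x e) = R ^+ 2.
  move=> N0; have s2 := sqr_sqrtr (ltW N0).
  have s0 : Num.sqrt (N e) != 0 by rewrite gt_eqF // sqrtr_gt0.
  rewrite /x !(minkDl, minkZl, minkDr, minkZr) mink_ev bb (minkC b).
  apply: (mulfI (expf_neq0 2 s0)); rewrite {2}s2 /N; field.
  exact: s0.
have N0 : 0 < N 0 by rewrite /N mulr0 mul0r addr0 exprn_gt0.
have Nc : continuous N.
  have -> : N = fun e => R ^+ 2 + e * (2 * mink (ev q) b).
    by apply/funext => e; rewrite /N; ring.
  by move=> e; apply: cvgD; [exact: cvg_cst|apply: cvgMl; exact: cvg_id].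
have Npos : \forall e \near (0 : K), 0 < N e.
  exact: cvgr_gt (Nc 0) _ N0.
pose g e := mk_event q (x e).
have gE e : 0 < N e -> ev (g e) = x e by move=> Ne; rewrite mk_eventE // xx.
have g0 : g 0 = q.
  apply: ev_inj; rewrite gE // /x scale0r addr0 /N mulr0 mul0r addr0.
  by rewrite sqrtr_sqr gtr0_norm // divff ?scale1r // gt_eqF.
have xc : {for 0, continuous x}.
  apply: cvgZ.
    apply: cvgM; first exact: cvg_cst.
    apply: cvgV; first by rewrite gt_eqF // sqrtr_gt0.
    by apply: continuous_comp; [exact: Nc|exact: sqrt_continuous].
  by apply: cvgD; [exact: cvg_cst|apply: cvgZr_tmp; exact: cvg_id].
have gc : {for 0, continuous g}.
  apply: continuous_ev; have : x e @[e --> 0] --> x 0 := xc.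
  rewrite -(gE 0 N0); apply: cvg_trans; apply: near_eq_cvg.
  by apply: filterS Npos => e /gE <-.
move=> B Bq; have {}Bq : nbhs (g 0) B by rewrite g0.
have h : \forall e \near 0^'+, 0 < N e /\ B (g e).
  apply: cvg_within; apply: filterI; [exact: Npos|exact: gc Bq].
have := @filter_ex _ _ _ _ (filterI h (nbhs_right_gt (0 : K))).
move=> [e [[Ne Be] e0]]; exists (g e); split=> //.
rewrite /halfspace /= gE // /x minkZl minkDl minkZl qa add0r (minkC b).
have ab0 : 0 < mink a b by have := exprn_gt0 2 R0; rewrite -ab; lra.
by rewrite mulr_gt0 ?divr_gt0 ?sqrtr_gt0 // mulr_gt0.
Qed.

End TimeSign.

(** * Directed curves: monotonicity and hyperbolas *)

Section DirectedCurves.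
Context {K : realType} {n : nat} {R : K}.
Hypothesis R0 : 0 < R.
Local Notation S := (dS n R).
Local Notation "u '^t'" := (u 0 ord_max) (at level 2, format "u '^t'").

(* [true] stands for the past, so that [(-1) ^+ s] is the sign of time. *)
Definition directed_vector (s : bool) : S -> 'rV[K]_n.+1 -> Prop :=
  if s then @past_vector K n R else @future_vector K n R.

Definition causal (s : bool) : set S -> set S :=
  if s then @causal_past K n R else @causal_future K n R.

Lemma causalE s A : causal s A = [set q | exists x y c,
  [/\ directed_curve (directed_vector s) x y c, A (c x) & c y = q]].
Proof. by case: s. Qed.

(** The part of [time_field] along [ev p] is orthogonal to tangent vectors, and what remains is a
    positive multiple of the time axis; hence [<Y, v>] has the sign of [- v_t]. *)
Lemma directed_vectorP (s : bool) (p : S) v : directed_vector s p v <->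
  nonspacelike p v /\ 0 < (-1) ^+ s * v^t.
Proof.
have key : tangent p v -> exists2 k, 0 < k & mink (time_field p) v = - k * v^t.
  move=> pv; exists (Num.sqrt (1 + (ev p)^t ^+ 2 / R ^+ 2))^-1.
    by rewrite invr_gt0 sqrtr_gt0 ltr_wpDr // divr_ge0 // sqr_ge0.
  rewrite /time_field minkZl minkDl minkZl pv mulr0 addr0 mink_time.
  by rewrite mulrN mulNr.
have tv : nonspacelike p v -> tangent p v by case=> -[].
rewrite /directed_vector; case: s; rewrite /past_vector /future_vector;
  rewrite ?expr0 ?expr1; split=> -[h1 h2]; split=> //; move: h2;
  have [k k0 ->] := key (tv h1).
- by rewrite !mulNr mul1r !oppr_gt0 pmulr_rlt0.
- by rewrite !mulNr mul1r !oppr_gt0 pmulr_rlt0.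
- by rewrite mulNr ?mul1r oppr_lt0 pmulr_rgt0.
- by rewrite mulNr ?mul1r oppr_lt0 pmulr_rgt0.
Qed.

Lemma directed_vector_mink (s : bool) (p : S) v (a : 'rV[K]_n.+1) :
  mink a a = 0 -> (-1) ^+ s * a^t < 0 -> directed_vector s p v -> 0 <= mink v a.
Proof.
move=> aa sa /directed_vectorP[pv sv].
have vv : mink v v <= 0 by case: pv => -[_ _]; [exact: ltW|move=> ->].
have aa0 : mink a a <= 0 by rewrite aa.
have := mink_time_sign vv aa0.
have : v^t * a^t < 0.
  have : ((-1) ^+ s * v^t) * ((-1) ^+ s * a^t) < 0 by rewrite pmulr_rlt0.
  by rewrite mulrACA -expr2 sqrr_sign mul1r.
by move=> h; rewrite nmulr_rle0.
Qed.

Lemma one_sided_tangent_derive (x y t : K) (c : K -> S) : x <= t < y ->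
  derivable (ev \o c) t 1 -> one_sided_tangent x y c t ('D_1 (ev \o c) t).
Proof.
move=> xty dc; left; split=> //.
have h : (fun h : K => h^-1 *: ((ev \o c) (h *: (1 : K) + t) - (ev \o c) t)) @ 0^'+
    --> 'D_1 (ev \o c) t.
  exact: cvg_dnbhs_at_right dc.
apply: cvg_trans h; apply: near_eq_cvg; apply: nearW => h.
by rewrite /= [h%:A]mulr1 (addrC h).
Qed.

Lemma smooth_on_derivable (V : normedModType K) (x y t : K) (u : K -> V) :
  smooth_on `[x, y] u -> x < t < y -> derivable u t 1.
Proof.
move=> us xty; have [xt ty] := andP xty.
have [] := us t; first by rewrite /= in_itv /= !ltW.
move=> U [F [oU Ut FU FE]].
apply: near_eq_derivable (Ck_derivable (FU 1) Ut).
have h1 : nbhs t U by exact: open_nbhs_nbhs.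
have h2 : \forall s \near t, x < s < y.
  near=> s; apply/andP; split; near: s; [exact: lt_nbhsr|exact: lt_nbhsl].
apply: filterS2 h1 h2 => s Us /andP[xs sy]; apply: FE => //.
by rewrite /= in_itv /= !ltW.
Unshelve. all: by end_near. Qed.

Lemma nondecreasing_nth_last (f : K -> K) d x s :
  (forall i, (i < size s)%N -> f (nth d (x :: s) i) <= f (nth d (x :: s) i.+1)) ->
  f x <= f (last x s).
Proof.
elim: s x => //= y s IH x h; apply: le_trans (h 0 isT) (IH y _) => i.
exact: (h i.+1).
Qed.

(** On the interior of each smooth piece the derivative of [<c, a>] is [<c', a>], which is
    nonnegative; continuity joins the pieces, so tangents at the corners never enter. *)
Lemma directed_curve_monotone D (a : 'rV[K]_n.+1) (x y : K) (c : K -> S) :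
  (forall p v, D p v -> 0 <= mink v a) -> directed_curve D x y c ->
  mink (ev (c x)) a <= mink (ev (c y)) a.
Proof.
move=> Da [xy [cc [s [sP sm]]] cD]; pose f t := mink (ev (c t)) a.
have [sp sl] := sP; rewrite -(eqP sl) -!/(f _).
have m0 z : mink z (0 : 'rV[K]_n.+1) = 0.
  by rewrite -(scale0r (0 : 'rV[K]_n.+1)) minkZr mul0r.
have fc : {within `[x, y], continuous f}.
  have mc : continuous (fun z : 'rV[K]_n.+1 => mink z a).
    move=> z; apply: (@Cinf_cont _ _ _ setT) => //.
    by apply: Cinf_mink; [exact: openT|exact: Cinf_id|move=> k; exact: Ck_cst].
  by move=> t; exact: continuous_comp (cc t) (mc _).
apply: (nondecreasing_nth_last (d := y)) => i si.
have si' : (i < (size s).+1)%N := ltnW si.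
set l := nth y (x :: s) i; set r := nth y (x :: s) i.+1.
have lx : x <= l := itv_partition_nth_ge si' sP.
have ry : r <= y := @itv_partition_nth_le _ _ _ _ s i.+1 si sP.
have lr : l < r by have /(pathP y) := sp; apply.
have df t : t \in `]l, r[ -> derivable (ev \o c) t 1.
  by rewrite in_itv /= => /(smooth_on_derivable (sm i si)).
have df' t : t \in `]l, r[ -> is_derive t 1 f (mink ('D_1 (ev \o c) t) a).
  move=> /df h; have h' := derive_mink h (@derivable_cst _ K _ a t 1).
  by apply: is_derive_eq; rewrite derive_cst m0 addr0.
apply: (@ger0_derive1_ndecr _ f l r) => //; last exact: ltW.
- by move=> t /df' /@ex_derive.
- move=> t tlr; rewrite derive1E (@derive_val _ _ _ _ _ _ _ (df' t tlr)).
  apply: Da (cD t _ _); apply: one_sided_tangent_derive (df t tlr).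
  move: tlr; rewrite in_itv /= => /andP[lt tr].
  by rewrite (le_trans lx (ltW lt)) (lt_le_trans tr ry).
- apply: continuous_subspaceW fc => t /=; rewrite !in_itv /= => /andP[lt tr].
  by rewrite (le_trans lx lt) (le_trans tr ry).
Qed.

(** The curve is [e^t a + e^-t b] for [t] from 0 to [ln E]. Its velocity [e^t a - e^-t b] has square
    [- 2 <a, b> = - R^2], and since [a_t] and [b_t] have opposite signs, its time component has the
    sign of [a_t]. *)
Lemma hyperbola_directed (s : bool) (p q : S) (a b : 'rV[K]_n.+1) E :
  null_pair (R := R) a b -> 0 < (-1) ^+ s * a^t -> 1 < E ->
  ev p = a + b -> ev q = E *: a + E^-1 *: b ->
  exists x y c, [/\ directed_curve (directed_vector s) x y c, c x = p & c y = q].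
Proof.
move=> nab sa E1 pE qE; have [aa bb ab] := nab.
pose u (t : K) : 'rV[K]_n.+1 := expR t *: a + expR (- t) *: b.
pose v (t : K) : 'rV[K]_n.+1 := expR t *: a - expR (- t) *: b.
pose c t := mk_event p (u t).
have ee (t : K) : expR t * expR (- t) = 1 by rewrite -expRD subrr expR0.
have cE t : ev (c t) = u t.
  rewrite mk_eventE // /u !(minkDl, minkDr, minkZl, minkZr) aa bb (minkC b).
  transitivity (2 * (expR t * expR (- t)) * mink a b); first by ring.
  by rewrite ee mulr1.
have cu : ev \o c = u by exact/funext.
have uC : Cinf setT u.
  apply/Cinf_mxP => [|i j]; first exact: openT.
  move=> k; rewrite (_ : (fun x => _) = fun t => a i j * expR t + b i j * expR (- t)).
    exact: Ck_exp.
  by apply/funext => t; rewrite !mxE !(mulrC (expR _)).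
have du (t : K) : is_derive t (1 : K) u (v t).
  have d : derivable u t (1 : K) by exact: Ck_derivable (uC 1) I.
  apply: DeriveDef => //; apply/matrixP => i j; rewrite (derive_mx d) mxE.
  rewrite (_ : (fun x => _) = fun t => a i j * expR t + b i j * expR (- t)).
    apply: derive_val; apply: is_derive_eq.
    by rewrite /GRing.scale /= !mxE mulrN1 mulrN !(mulrC (expR _)).
  by apply/funext => s'; rewrite !mxE !(mulrC (expR _)).
have bt : (-1) ^+ s * b^t < 0.
  have : (-1) ^+ s * a^t * ((-1) ^+ s * b^t) < 0.
    by rewrite mulrACA -expr2 sqrr_sign mul1r (null_pair_time R0 nab).
  by rewrite pmulr_rlt0.
have ab0 : 0 < mink a b by have := exprn_gt0 2 R0; rewrite -ab; lra.
have E0 : 0 < E := lt_trans ltr01 E1.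
have vD t : directed_vector s (c t) (v t).
  have vv : mink (v t) (v t) = - R ^+ 2.
    rewrite /v -scaleNr !(minkDl, minkDr, minkZl, minkZr) aa bb (minkC b) -ab.
    by transitivity (- 2 * (expR t * expR (- t)) * mink a b); [ring|rewrite ee; ring].
  apply/directed_vectorP; split.
    left; split.
    - rewrite /tangent cE /u /v -scaleNr !(minkDl, minkDr, minkZl, minkZr).
      by rewrite aa bb (minkC b); ring.
    - apply: contra_eq_neq vv => ->; rewrite /mink !mul0mx mxE eq_sym oppr_eq0.
      by rewrite expf_neq0 // gt_eqF.
    - by rewrite vv oppr_lt0 exprn_gt0.
  rewrite /v !mxE mulrBr subr_gt0 !(mulrCA _ (expR _)).
  apply: lt_trans (_ : 0 < _); first by rewrite pmulr_rlt0 ?expR_gt0.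
  by rewrite pmulr_rgt0 ?expR_gt0.
exists 0, (ln E), c; split; last first.
- by apply: ev_inj; rewrite cE qE /u expRN lnK.
- by apply: ev_inj; rewrite cE pE /u oppr0 expR0 !scale1r.
split; first by rewrite ln_gt0.
- split.
    rewrite cu; apply: continuous_subspaceT => t.
    exact: Cinf_cont uC I.
  exists [:: ln E]; split; first by split; rewrite /= ?ln_gt0.
  move=> i _ t _; exists setT, u; split=> //; first exact: openT.
  by move=> t' _ _; rewrite cu.
(* The curve is differentiable on the whole real line, so by uniqueness of limits every one-sided
   tangent, also at the end points, is [v t]. *)
move=> t w tw; suff -> : w = v t by [].
have h : (fun h : K => h^-1 *: (ev (c (t + h)) - ev (c t))) @ 0^' --> v t.
  have := @ex_derive _ _ _ _ _ _ _ (du t).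
  rewrite /derivable -/('D_1 u t) (@derive_val _ _ _ _ _ _ _ (du t)).
  apply: cvg_trans; apply: near_eq_cvg; apply: nearW => h.
  by rewrite /= !cE [h%:A]mulr1 (addrC h).
case: tw => -[_ tw].
  by apply: (cvg_unique _ tw (cvg_dnbhs_at_right h)); exact: norm_hausdorff.
by apply: (cvg_unique _ tw (cvg_dnbhs_at_left h)); exact: norm_hausdorff.
Qed.

End DirectedCurves.

(** * Causal sets of lines as half-spaces; horizons as hyperplane sections *)

Section CausalHalfspaces.
Context {K : realType} {n : nat} {R : K}.
Hypotheses (R0 : 0 < R) (n0 : (0 < n)%N).
Local Notation S := (dS n R).
Local Notation "u '^t'" := (u 0 ord_max) (at level 2, format "u '^t'").

(* [C / R ^+ 2] is the hyperbolic cosine of the proper time from [l] to [q]. *)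
Lemma hyperbola_through (l q : S) : R ^+ 2 < mink (ev q) (ev l) ->
  exists F a b, [/\ 1 < F, null_pair (R := R) a b, ev l = a + b,
    ev q = F *: a + F^-1 *: b &
    (F - F^-1) *: a = ev q - F^-1 *: ev l].
Proof.
move=> ql; pose C := mink (ev q) (ev l) / R ^+ 2.
have R20 : 0 < R ^+ 2 by rewrite exprn_gt0.
have C1 : 1 < C by rewrite ltr_pdivlMr // mul1r.
have qlE : mink (ev q) (ev l) = C * R ^+ 2 by rewrite divfK // gt_eqF.
have D0 : 0 <= C ^+ 2 - 1 by rewrite subr_ge0 exprn_ege1 // ltW.
pose F := C + Num.sqrt (C ^+ 2 - 1).
have F1 : 1 < F by rewrite ltr_wpDr // sqrtr_ge0.
have F0 : 0 < F := lt_trans ltr01 F1.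
have Fn0 : F != 0 by rewrite gt_eqF.
have FE : C = 2^-1 * (F + F^-1).
  have : F ^+ 2 + 1 = 2 * C * F.
    rewrite /F; have := sqr_sqrtr D0; set r := Num.sqrt _ => h.
    have -> : (C + r) ^+ 2 = C ^+ 2 + 2 * C * r + r ^+ 2 by ring.
    by rewrite h; ring.
  move=> h; apply: (mulfI Fn0); transitivity (2^-1 * (F ^+ 2 + 1)).
    by rewrite h; field.
  by field.
have FV1 : F^-1 < 1 by rewrite invf_lt1.
have k0 : F - F^-1 != 0 by rewrite gt_eqF // subr_gt0 (lt_trans FV1).
have k1 : F ^+ 2 - 1 != 0.
  by rewrite gt_eqF // subr_gt0 exprn_egt1.
pose a := (F - F^-1)^-1 *: (ev q + (- F^-1) *: ev l).
pose b := (F - F^-1)^-1 *: (F *: ev l + (-1) *: ev q).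
exists F, a, b; split=> //.
- rewrite /null_pair /a /b !(minkZl, minkDl, minkZr, minkDr) !mink_ev.
  rewrite (minkC (ev l)) qlE FE.
  by split; field; rewrite ?k1 Fn0.
- apply/rowP => i; rewrite !mxE; field; by rewrite ?k1 Fn0.
- apply/rowP => i; rewrite !mxE; field; by rewrite ?k1 Fn0.
- by rewrite /a scalerA divff // scale1r scaleNr.
Qed.

Lemma causal_line (s : bool) (a b : 'rV[K]_n.+1) : null_pair (R := R) a b ->
  (-1) ^+ s * a^t < 0 -> causal s (line_set a b) = halfspace a :> set S.
Proof.
move=> nab sa; have [aa bb ab] := nab.
have ab0 : 0 < mink a b by have := exprn_gt0 2 R0; rewrite -ab; lra.
have R20 : 0 < R ^+ 2 by rewrite exprn_gt0.
rewrite causalE; apply/seteqP; split=> q.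
  move=> [x [y [c [dc [E E0 cE] <-]]]]; rewrite /halfspace /=.
  apply: lt_le_trans (directed_curve_monotone _ dc); last first.
    by move=> p v; exact: directed_vector_mink.
  rewrite cE minkDl !minkZl aa mulr0 add0r (minkC b).
  by rewrite mulr_gt0 ?invr_gt0.
rewrite /halfspace /= => qa; set al := mink (ev q) a in qa.
(* Since [E al = al + R^2 + |be|] and [E >= 1], the product [<q, l> = E al + E^-1 be] is at least
   [al + R^2], which exceeds [R^2]. *)
pose be := mink (ev q) b; pose E := 1 + (R ^+ 2 + `|be|) / al.
have E1 : 1 <= E.
  by rewrite lerDl divr_ge0 ?addr_ge0 // ltW.
have E0 : 0 < E := lt_le_trans ltr01 E1.
have Eal : E * al = al + R ^+ 2 + `|be|.
  by rewrite /E; field; rewrite gt_eqF.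
pose l := mk_event q (E *: a + E^-1 *: b).
have lE : ev l = E *: a + E^-1 *: b.
  rewrite mk_eventE // !(minkDl, minkDr, minkZl, minkZr) aa bb (minkC b) -ab.
  by field; rewrite gt_eqF.
have EV1 : E^-1 <= 1 by rewrite invf_le1.
have ql : R ^+ 2 < mink (ev q) (ev l).
  rewrite lE minkDr !minkZr -/al -/be Eal.
  have : - `|be| <= E^-1 * be.
    rewrite lerNl -mulrN (le_trans (ler_norm _)) // normrM normrN.
    rewrite ger0_norm; last by rewrite invr_ge0 ltW.
    by rewrite ler_piMl.
  by lra.
have [F [a' [b' [F1 nab' lab qab Fa]]]] := hyperbola_through ql.
have F0 : 0 < F := lt_trans ltr01 F1.
have FV1 : F^-1 < 1 by rewrite invf_lt1.
(* This fixes the time direction of the hyperbola from [l] to [q]: two null vectors with positive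
   product lie in opposite time cones, so [a'] points to the side required by [s] because [a] does
   not. Positivity comes from [(F - F^-1) a' = q - F^-1 l] and [<l, a> = E^-1 <a, b> < al]. *)
have a'a : 0 < mink a' a.
  have : 0 < (F - F^-1) * mink a' a.
    rewrite -minkZl Fa -scaleNr minkDl minkZl lE minkDl !minkZl aa mulr0 add0r.
    rewrite -/al (minkC b) mulNr subr_gt0.
    have h : E^-1 * mink a b < al.
      rewrite mulrC ltr_pdivrMr // mulrC Eal -ab.
      by have := normr_ge0 be; lra.
    apply: le_lt_trans h; rewrite ler_piMl ?ltW // mulr_gt0 ?invr_gt0 //.
  by rewrite pmulr_rgt0 // subr_gt0 (lt_trans FV1).
have [a'0 _ _] := nab'.
have sa' : 0 < (-1) ^+ s * a'^t.
  have := @mink_time_sign _ _ a' a; rewrite a'0 aa lexx => /(_ isT isT).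
  rewrite pmulr_lle0 // => h.
  have t0 := null_time_neq0 (null_pair_neq0 R0 nab') a'0.
  have : (-1) ^+ s * a'^t * ((-1) ^+ s * a^t) <= 0.
    by rewrite mulrACA -expr2 sqrr_sign mul1r.
  by rewrite nmulr_lle0 // le_eqVlt eq_sym mulf_eq0 signr_eq0 (negbTE t0).
have [x [y [c [dc cx cy]]]] := hyperbola_directed R0 nab' sa' F1 lab qab.
by exists x, y, c; split=> //; rewrite cx; exists E.
Qed.

(** The straight line stays on the hyperboloid because [a] is null and orthogonal to [q]; its
    acceleration is zero, hence trivially normal. *)
Lemma isotropic_line (q : S) (a : 'rV[K]_n.+1) : a != 0 -> mink a a = 0 ->
  mink (ev q) a = 0 -> exists2 gamma : K -> S, isotropic_geodesic gamma &
    forall t, ev (gamma t) = ev q + t *: a.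
Proof.
move=> a0 aa qa; pose u (t : K) := ev q + t *: a.
pose c t := mk_event q (u t).
have cE t : ev (c t) = u t.
  rewrite mk_eventE // /u !(minkDl, minkDr, minkZl, minkZr) mink_ev aa.
  by rewrite (minkC a) qa !mulr0 !addr0.
have cu : ev \o c = u by exact/funext.
have uC : Cinf setT u.
  apply/Cinf_mxP => [|i j]; first exact: openT.
  move=> k; rewrite (_ : (fun x => _) = fun t => ev q i j + t * a i j).
    apply: CkD; [exact: openT|exact: Ck_cst|].
    apply: CkM; [exact: openT|exact: (Cinf_id (V := K))|exact: Ck_cst].
  by apply/funext => t; rewrite !mxE.
have du (t : K) : 'D_1 u t = a.
  have d : derivable u t (1 : K) by exact: Ck_derivable (uC 1) I.
  apply/matrixP => i j; rewrite (derive_mx d) mxE.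
  rewrite (_ : (fun x => _) = fun t => ev q i j + t * a i j).
    apply: derive_val; apply: is_derive_eq.
    by rewrite /GRing.scale /= mulr0 !add0r mulr1 mul1r.
  by apply/funext => s; rewrite !mxE.
exists c => //; split.
  apply/(complete_geodesicP R0 n0); rewrite cu; split.
    move=> t; apply: continuous_ev; rewrite cu; exact: Cinf_cont uC I.
  split=> // t; rewrite /acceleration.
  rewrite (_ : (fun s : K => 'D_1 u s) = cst a); last exact/funext.
  by rewrite derive_cst /mink !mul0mx mxE mul0r scale0r.
move=> t; rewrite /isotropic /velocity derive1E cu du; split=> //.
by rewrite /tangent cE /u minkDl minkZl qa aa mulr0 addr0.
Qed.

Lemma mink_hyperplane (a : 'rV[K]_n.+1) : a != 0 ->
  exists alpha : {vspace 'rV[K]_n.+1}, \dim alpha = n /\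
    forall x, (x \in alpha) = (mink x a == 0).
Proof.
move=> a0; pose f (x : 'rV[K]_n.+1) : 'rV[K]_1 := x *m (@mink_mx K n.+1 *m a^T).
have fl : linear f by move=> k x y; rewrite /f mulmxDl scalemxAl.
pose fL : {linear 'rV[K]_n.+1 -> 'rV[K]_1} :=
  HB.pack f (GRing.isLinear.Build _ _ _ _ f fl).
pose g : 'Hom('rV[K]_n.+1, 'rV[K]_1) := linfun fL.
have gE x : g x = (mink x a)%:M by rewrite lfunE /= /f mulmxA mink_scalar.
exists (lker g); split; last first.
  move=> x; rewrite memv_ker gE; apply/eqP/eqP => [/matrixP/(_ 0 0)|->].
    by rewrite !mxE eqxx.
  by apply/matrixP => i j; rewrite !mxE mul0rn.
have img : \dim (limg g) = 1.
  apply/eqP; rewrite eqn_leq; apply/andP; split.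
    by have := dimvS (subvf (limg g)); rewrite dimvf /dim /= muln1.
  rewrite lt0n dimv_eq0; apply: contra_neq a0 => g0.
  have h x : mink x a = 0.
    have : g x \in limg g by exact/memv_img/memvf.
    by rewrite g0 memv0 gE => /eqP/matrixP/(_ 0 0); rewrite !mxE eqxx.
  (* At [a *m mink_mx n.+1] the functional takes the Euclidean square of [a], so it vanishes
     identically only if [a = 0]; the dimension of the kernel then follows from rank and nullity. *)
  have := h (a *m @mink_mx K n.+1); rewrite /mink -(mulmxA a) mink_mx_sqr mulmx1.
  rewrite mxE => /eqP; rewrite psumr_eq0 => [/allP ai|i _]; last first.
    by rewrite mxE -expr2 sqr_ge0.
  apply/rowP => i; rewrite mxE; have := ai i (mem_index_enum _).
  by rewrite mxE -expr2 sqrf_eq0 => /eqP.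
have := limg_ker_dim g fullv; rewrite capfv img dimvf /dim /= mul1n addn1.
by case.
Qed.

End CausalHalfspaces.

(** * Antipodal half-spaces and the orientation of a line *)

Section Antipodes.
Context {K : realType} {n : nat} {R : K}.
Hypothesis R0 : 0 < R.
Local Notation S := (dS n R).

Lemma antipode_halfspace (a : 'rV[K]_n.+1) :
  antipode @` (halfspace a : set S) = halfspace (- a).
Proof.
have h (q : S) : mink (ev (antipode q)) (- a) = mink (ev q) a.
  have := ev_flip true q; rewrite /= => ->.
  by rewrite -(scaleN1r a) minkZl minkZr mulrA expr1 mulrNN mulr1 mul1r.
apply/seteqP; split=> [_ [q qa <-]|q qa]; first by rewrite /halfspace /= h.
exists (antipode q); last exact: antipodeK.
by rewrite /halfspace /= -h antipodeK.
Qed.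

Lemma halfspaceN_disjoint (a : 'rV[K]_n.+1) :
  (halfspace a : set S) `&` halfspace (- a) = set0.
Proof.
apply/seteqP; split=> // q []; rewrite /halfspace /= -(scaleN1r a) minkZr mulN1r.
by rewrite oppr_gt0 => /ltW; rewrite leNgt => /negP.
Qed.

Lemma boundary_halfspaceN (a b : 'rV[K]_n.+1) : null_pair (R := R) a b ->
  boundary (halfspace (- a)) = boundary (halfspace a : set S).
Proof.
move=> nab; rewrite (boundary_halfspace R0 nab).
rewrite (boundary_halfspace R0 (null_pairN nab)).
by apply/seteqP; split=> q /=; rewrite -(scaleN1r a) minkZr mulN1r; lra.
Qed.

(** The time components of a null pair have opposite signs, and a line does not depend on the order
    of its pair, so the future directed vector can be put first. *)
Lemma oriented_timelike_line (n0 : (0 < n)%N) (gamma : K -> S) :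
  timelike_geodesic gamma -> exists a b,
    [/\ null_pair (R := R) a b, 0 < a 0 ord_max, b 0 ord_max < 0 &
        range gamma = line_set a b].
Proof.
move=> /(timelike_geodesic_line R0 n0)[a [b [nab ->]]].
have := null_pair_time R0 nab.
have [a0 h|a0 h|<-] := ltgtP 0 (a 0 ord_max); last by rewrite mul0r ltxx.
  by exists a, b; split=> //; rewrite pmulr_rlt0 in h.
exists b, a; split=> //; [exact: null_pairC|by rewrite nmulr_rlt0 in h|].
exact: line_setC.
Qed.

End Antipodes.

Theorem theorem1 (K : realType) (n : nat) (R : K) (hn : (2 <= n)%N)
    (hR : 0 < R) (L : set (dS n R))
    (hL : exists2 gamma : K -> dS n R,
        timelike_geodesic gamma & L = range gamma) :
  let mL := antipode @` L in
  (* 1 *)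
  ((exists alpha : {vspace 'rV[K]_n.+1},
      \dim alpha = n /\ past_horizon L = [set x | ev x \in alpha]) /\
   (exists F : set (K -> dS n R),
      (forall gamma, F gamma -> isotropic_geodesic gamma) /\
      past_horizon L = \bigcup_(gamma in F) range gamma)) /\
  (* 2 *)
  (causal_future L = antipode @` causal_past mL /\
   causal_past L = antipode @` causal_future mL) /\
  (* 3 *)
  ([/\ causal_past L `&` causal_future mL = set0,
       boundary (causal_past L) = past_horizon L &
       boundary (causal_future mL) = past_horizon L] /\
   [/\ causal_future L `&` causal_past mL = set0,
       boundary (causal_future L) = future_horizon L &
       boundary (causal_past mL) = future_horizon L] /\
   past_horizon L = future_horizon mL /\
   future_horizon L = past_horizon mL) /\
  (* 4 *)
  (forall U : set (dS n R),
     [\/ U = causal_future L, U = causal_past mL,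
         U = causal_past L | U = causal_future mL] ->
     [/\ open_submanifold (M := dS_manifold n R) U,
         diffeo_onto_image (M := dS_manifold n R) U gluing,
         forall x, boundary U x -> boundary U (antipode x) &
         forall x y, boundary U x -> boundary U y ->
           (pr x = pr y <-> y = x \/ y = antipode x)]) /\
  (* 5 *)
  (exists G : tensor_field (dS_quot_manifold n R),
     [/\ lorentz_metric G,
         pulls_back [set: dS_manifold n R] gluing G dS_metric,
         forall G' : tensor_field (dS_quot_manifold n R),
           lorentz_metric G' ->
           pulls_back [set: dS_manifold n R] gluing G' dS_metric ->
           forall c x, atlas c -> chart_dom c x -> G' c x = G c x &
         rosenfeld_lobachevsky R (dS_quot_manifold n R) G]).
Proof.
have n0 : (0 < n)%N := ltnW hn.
have [gamma gammaT ->] := hL.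
have [a [b [nab a0 b0 ->]]] := oriented_timelike_line hR n0 gammaT.
have [aa bb ab] := nab.
have nba := null_pairC nab.
have nab' := null_pairN nab; have nba' := null_pairN nba.
move=> mL; have mLE : mL = line_set (- a) (- b) by exact: antipode_line.
have pL : causal_past (line_set a b) = halfspace a :> set (dS n R).
  by apply: (causal_line hR (s := true) nab); rewrite expr1 mulN1r oppr_lt0.
(* For the future the null vector must have negative time component, so [b] takes the place of
   [a]. *)
have fL : causal_future (line_set a b) = halfspace b :> set (dS n R).
  by rewrite line_setC; apply: (causal_line hR (s := false) nba); rewrite mul1r.
have fmL : causal_future mL = halfspace (- a) :> set (dS n R).
  rewrite mLE; apply: (causal_line hR (s := false) nab').
  by rewrite mul1r mxE oppr_lt0.
have pmL : causal_past mL = halfspace (- b) :> set (dS n R).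
  rewrite mLE line_setC; apply: (causal_line hR (s := true) nba').
  by rewrite expr1 mulN1r mxE opprK.
have bN := boundary_halfspaceN hR nab; have bN' := boundary_halfspaceN hR nba.
have an0 := null_pair_neq0 hR nab.
rewrite /past_horizon /future_horizon pL fL fmL pmL bN bN'.
split; [|split; [|split; [|split]]].
- split.
    have [alpha [da aE]] := mink_hyperplane an0.
    exists alpha; split=> //; rewrite (boundary_halfspace hR nab).
    by apply/seteqP; split=> q /=; rewrite aE => /eqP.
  (* All isotropic geodesics inside the horizon are taken; the one through [q] in the direction [a]
     shows that they cover it. *)
  exists [set g | isotropic_geodesic g /\ range g `<=` boundary (halfspace a)].
  split=> [g []//|].
  apply/seteqP; split=> [q|q [g [_ gb] /gb//]].
  rewrite (boundary_halfspace hR nab) => qa.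
  have [g gi gE] := isotropic_line hR n0 an0 aa qa.
  exists g; last by exists 0 => //; apply: ev_inj; rewrite gE scale0r addr0.
  split=> // _ [t _ <-] /=; rewrite gE minkDl minkZl aa mulr0 addr0.
  exact: qa.
- by rewrite !antipode_halfspace !opprK.
- by rewrite !halfspaceN_disjoint.
(* Each of the four sets is the half-space of the first vector of some null pair, so one argument
   serves all. *)
- have main c d (U : set (dS n R)) : null_pair (R := R) c d -> U = halfspace c ->
    [/\ open_submanifold (M := dS_manifold n R) U,
        diffeo_onto_image (M := dS_manifold n R) U gluing,
        forall x, boundary U x -> boundary U (antipode x) &
        forall x y, boundary U x -> boundary U y ->
          (pr x = pr y <-> y = x \/ y = antipode x)].
    move=> ncd ->; have evN (x : dS n R) : ev (antipode x) = (-1) *: ev x.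
      by have := ev_flip true x.
    split.
    + split; [exact: dS_smooth hR n0|exact: halfspace_open].
    + apply: pr_diffeo; first exact: halfspace_open.
      move=> x; rewrite /halfspace /= evN minkZl mulN1r oppr_gt0 => h1 h2.
      by have := lt_trans h1 h2; rewrite ltxx.
    + move=> x; rewrite (boundary_halfspace hR ncd) /= evN minkZl => ->.
      exact: mulr0.
    + move=> x y _ _; apply: (iff_trans (prP x y)); split=> [[[] ->]|[->|->]].
      * by right.
      * by left.
      * by exists false.
      * by exists true.
  by move=> U [] UE; [apply: main nba UE|apply: main nba' UE|
    apply: main nab UE|apply: main nab' UE].
exists quot_metric; split.
- exact: quot_metric_lorentz hR n0.
- exact: pulls_back_quot_metric.
- by move=> G _ GP c x; exact: quot_metric_unique.
- exact: quot_rosenfeld hR n0.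
Qed.
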